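(* Consider the continuous-time delayed averaging algorithm $$\dot x_i(t)=\sum_{j\in\mathcal V,\ j\ne i}a_{ij}(t)\bigl(x_j(t-h_{ij}(t))-x_i(t)\bigr),\qquad i\in\mathcal V,$$ where $\bar h\ge 0$, the weights $a_{ij}:[0,\infty)\to[0,\infty)$ are locally $L_1$-summable and the delays $h_{ij}:[0,\infty)\to[0,\bar h]$ are Lebesgue measurable. Assume that the matrix-valued function $A(\cdot)=(a_{ij}(\cdot))$ with nonnegative entries possesses the non-instantaneous type-symmetry (NITS) property and that $\sup_{t\ge 0,\ i,j\in\mathcal V}\int_t^{t+D}a_{ij}(s)\,ds<\infty$ for every finite $D>0$. Then every solution converges: the limits $\bar x_i=\lim_{t\to\infty}x_i(t)$ exist for all $i\in\mathcal V$. The algorithm establishes consensus between agents $i$ and $j$ if and only if $i$ and $j$ belong to the same connected component of the persistent graph $\mathcal G_\infty$ (equivalently, a walk between $i$ and $j$ exists). The algorithm establishes global consensus if and only if $\mathcal G_\infty$ is connected.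
   Context: $\mathcal V$ is a finite set of agents. Solutions: for a starting time $t_*\ge0$, the solution (right-continuous at $t_*$) is determined on $[t_*,\infty)$ by the initial condition $x(t_* )=x_*\in\mathbb R^{\mathcal V}$ and $x(t_*+s)=\varphi(s)$ for $s\in[-\bar h,0)$, where $\varphi\in L_\infty([-\bar h,0]\to\mathbb R^{\mathcal V})$. Consensus in a group $\mathcal V'\subseteq\mathcal V$ (between $i$ and $j$: $\mathcal V'=\{i,j\}$; global: $\mathcal V'=\mathcal V$) is established if for every starting time $t_*\ge0$ and every initial condition the limits $\bar x_i=\lim_{t\to\infty}x_i(t)$ exist for all $i\in\mathcal V'$ and $\bar x_i=\bar x_j$ for all $i,j\in\mathcal V'$. NITS: there exist an increasing sequence $t_p\ge0$, $p=0,1,\dots$, $t_p\to\infty$, and a constant $K\ge1$ such that (1) for all $i,j\in\mathcal V$ and all $p$, $\frac1K\int_{t_p}^{t_{p+1}}a_{ji}(t)\,dt\le\int_{t_p}^{t_{p+1}}a_{ij}(t)\,dt\le K\int_{t_p}^{t_{p+1}}a_{ji}(t)\,dt$; (2) $\sup_{p\ge0,\ i\ne j}\int_{t_p}^{t_{p+1}}a_{ij}(s)\,ds<\infty$. The persistent graph $\mathcal G_\infty=(\mathcal V,\mathcal E_\infty)$ has the arc $(j,i)$ if and only if $\int_0^\infty a_{ij}(t)\,dt=\infty$. Under NITS it is undirected ($(i,j)\in\mathcal E_\infty$ iff $(j,i)\in\mathcal E_\infty$). *)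

(* Defs.v *)
From mathcomp Require Import all_boot all_order all_algebra.
From mathcomp Require Import all_classical all_reals all_analysis.

Set Implicit Arguments.
Unset Strict Implicit.
Unset Printing Implicit Defensive.

Import Order.TTheory GRing.Theory Num.Theory.
Import numFieldNormedType.Exports.

Local Open Scope classical_set_scope.
Local Open Scope ring_scope.

(* The real line with its Lebesgue (not merely Borel) sigma-algebra, which is
   the domain of [completed_lebesgue_measure]; as a type it unfolds to R. *)
Definition lebesgueType (R : realType) :=
  caratheodory_type ((wlength (idfun : R -> R))^*)%mu.

Local Notation leb := (@completed_lebesgue_measure _).

Definition lebesgue_measurable_fun (R : realType) (D : set R) (f : R -> R) :=
  @measurable_fun _ _ (lebesgueType R) (measurableTypeR R) D f.

Definition locally_summable (R : realType) (f : R -> R) :=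
  forall T : R, leb.-integrable `[0, T] (fun t : lebesgueType R => (f t)%:E).

Definition abs_continuous_on (R : realType) (b c : R) (f : R -> R) :=
  forall e : R, 0 < e -> exists2 d : R, 0 < d &
    forall (n : nat) (u v : 'I_n -> R),
      (forall k, b <= u k /\ u k <= v k /\ v k <= c) ->
      trivIset [set: 'I_n] (fun k => (`]u k, v k[)%classic) ->
      \sum_(k < n) (v k - u k) < d ->
      \sum_(k < n) `|f (v k) - f (u k)| < e.

Section Averaging.
Context (R : realType) (V : finType).
Implicit Types (a h : V -> V -> R -> R) (hbar : R) (x phi : R -> V -> R).

Definition integral_weight a (i j : V) (b c : R) : \bar R :=
  (\int[leb]_(s in `[b, c]) (a i j s)%:E)%E.

Definition NITS a :=
  exists (t : nat -> R) (K : R),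
    [/\ (forall p, 0 <= t p), increasing_seq t, t p @[p --> \oo] --> +oo,
        1 <= K
      & (forall (i j : V) (p : nat),
           (K^-1%:E * integral_weight a j i (t p) (t p.+1)
              <= integral_weight a i j (t p) (t p.+1))%E /\
           (integral_weight a i j (t p) (t p.+1)
              <= K%:E * integral_weight a j i (t p) (t p.+1))%E)
        /\
        (ereal_sup [set y | exists (p : nat) (i j : V),
           i != j /\ y = integral_weight a i j (t p) (t p.+1)] < +oo)%E].

Definition uniformly_summable a :=
  forall D : R, 0 < D ->
    (ereal_sup [set y | exists (t : R) (i j : V),
       (0 <= t)%R /\ y = integral_weight a i j t (t + D)%R] < +oo)%E.

Definition persistent_graph a : rel V :=
  fun j i => `[< (\int[leb]_(t in `[0%R, +oo[) (a i j t)%:E = +oo)%E >].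

Definition connected_graph (e : rel V) := forall i j : V, connect e i j.

(* Membership in L_oo([- hbar, 0] -> R^V); the function is extended by zero
   outside the interval.  An actual function rather than an a.e.-class is
   needed, since the delayed argument t - h_ij(t) may take a given value on a
   set of positive measure. *)
Definition Linfty_history hbar phi :=
  forall i : V,
    ((fun s => phi s i) \_ `[- hbar, 0] : lebesgueType R -> R)
      \in Lfun leb +oo%E.

(* Caratheodory solutions: locally absolutely continuous on [ts, +oo[ and
   satisfying the equation almost everywhere.  Only the values of x on
   [ts - hbar, +oo[ matter. *)
Definition is_solution a h hbar (ts : R) (xs : V -> R) phi x :=
  [/\ (forall i, x ts i = xs i),
      (forall s : R, - hbar <= s -> s < 0 -> forall i, x (ts + s) i = phi s i),
      (forall (T : R) (i : V), abs_continuous_on ts T (fun t => x t i))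
    & \forall t \ae leb, ts < t -> forall i : V,
        is_derive (t : R) (1 : R) (fun s : R => x s i)
          (\sum_(j | j != i) a i j t * (x (t - h i j t) j - x t i))].

Definition all_solutions_converge a h hbar :=
  forall (ts : R) (xs : V -> R) phi x,
    0 <= ts -> Linfty_history hbar phi -> is_solution a h hbar ts xs phi x ->
    forall i : V, cvg (x t i @[t --> +oo]).

Definition establishes_consensus a h hbar (V' : {set V}) :=
  forall (ts : R) (xs : V -> R) phi x,
    0 <= ts -> Linfty_history hbar phi -> is_solution a h hbar ts xs phi x ->
    exists xbar : V -> R,
      (forall i, i \in V' -> x t i @[t --> +oo] --> xbar i) /\
      (forall i j, i \in V' -> j \in V' -> xbar i = xbar j).

End Averaging.

(* Main.v *)
From mathcomp Require Import all_boot all_order all_algebra.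
From mathcomp Require Import all_classical all_reals all_analysis.
From mathcomp Require Import measurable_realfun ess_sup_inf.
From mathcomp Require Import ring lra.
Require Import Defs.

(** The difficulty is that delayed values are stale, the weights of an arc and of
its reverse are only comparable after integration over a whole interval, and
nothing bounds how long a given cut has to wait for its interactions.  The
proof follows two numbers per agent and a potential built from their ranks.

Merging consecutive intervals of the type-symmetry condition until each is
longer than the maximal delay keeps the weights of a block bounded (this is
where uniform summability enters) and comparable with their transposes.  In
block p, let z_i be the value of agent i at the left end and xi_i its largest
value over the delay window before that end.  Order the agents by decreasing
z and give the r-th one the weight q^r with q small; Phi z is the weighted sum
(wsum, rank_by), and Psi = Phi z + B * Phi xi with B large.  Psi decreases
from block to block (one_step).  By the layer-cake decomposition (layer_cake)
and the superposition of explicit supersolutions, one for each level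
(superposition), it is enough to treat an initial state where every z_i and
xi_i is 0 or 1, say z = 1 on S and xi = 1 on T with S included in T.  If S <> T
then all xi_i with i outside S will have dropped strictly below 1, and B pays
for the values that the stale ones have lifted.  If S = T, agents outside S
rise by at most the flow u across the cut; by reciprocity some agent of S falls
by a fixed fraction of u, and since the weight of an agent of S is at least 1/q
times that of any agent ranked after S, the fall outweighs the rise
(one_level).

Psi is bounded below, so the total dissipation is finite.  Hence xi_i - z_i
tends to 0, and if the values of a connected group did not merge, some gap
between a top set S and its complement would persist until a fixed amount of
flow has crossed the cut, which would make Psi drop by a fixed amount
infinitely often (core_consensus).  The interactions between different
components of the persistent graph have finite total weight; subtracting a
convergent monotone function turns the restriction of a solution, and of its
opposite, to one component into subsolutions of the closed system of that
component, so that all agents of a component converge to one limit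
(component_limit).

Conversely, start late from the indicator function of a component: the
remaining flow across its boundary is at most 1/4, so agents inside stay above
3/4 and the others below 1/4 (separated_solution).  Such a solution exists
because the integral form of the equation, with the integrating factor of the
own decay, is monotone in the unknown: iterating it from 0 gives a bounded
increasing sequence whose limit is a fixed point (picard_fixpoint).

All differential inequalities are used through one fact: an absolutely
continuous function whose derivative is nonpositive almost everywhere does not
increase (ac_nonincreasing). *)

Set Implicit Arguments.
Unset Strict Implicit.
Unset Printing Implicit Defensive.

Import Order.TTheory GRing.Theory Num.Theory.
Import numFieldNormedType.Exports.

Local Open Scope classical_set_scope.
Local Open Scope ring_scope.

(** * Absolutely continuous functions with nonpositive derivative *)

Section AC.
Context (R : realType).
Implicit Types (f g : R -> R) (b c t : R).
Local Notation mu := (@lebesgue_measure R).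
Local Notation leb := (@completed_lebesgue_measure R).

Lemma negligible_completed (N : set R) :
  (leb.-negligible N) <-> (mu.-negligible N).
Proof.
split=> [[A [mA A0 NA]]|[A [mA A0 NA]]].
  apply/negligible_outer_measure/eqP; rewrite eq_le outer_measure_ge0 andbT.
  by rewrite -A0; exact: le_outer_measure.
by exists A; split => //; exact: sub_caratheodory.
Qed.

Lemma ae_completed (P : R -> Prop) :
  (\forall t \ae leb, P t) <-> {ae mu, forall t, P t}.
Proof. exact: negligible_completed. Qed.

(** The strict margin between d and e absorbs the error of the difference
quotient. *)
Lemma is_derive_near (f : R -> R) t d e : is_derive t 1 f d -> d < e ->
  exists2 r : R, 0 < r & forall s, `|s - t| < r ->
    (t <= s -> f s - f t <= e * (s - t)) /\ (s <= t -> f t - f s <= e * (t - s)).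
Proof.
move=> [dft <-] lt_de.
have cv : h^-1 *: ((f \o shift t) (h *: 1) - f t) @[h --> 0^'] --> 'D_1 f t.
  by apply/cvg_ex; move: dft => /cvg_ex.
have /cvgr_lt /(_ _ lt_de) : h^-1 *: ((f \o shift t) (h *: 1) - f t) @[h --> 0^'] -->
    ('D_1 f t : R^o).
  exact: cv.
move=> /nbhs_ballP [r /= r0 H]; exists r => // s str.
have {}H : s != t -> (s - t)^-1 * (f s - f t) < e.
  move=> nst; have := H (s - t); rewrite /ball /= sub0r normrN => /(_ str).
  by rewrite subr_eq0 => /(_ nst); rewrite /shift /= -[_ *: 1]/(_ * 1) mulr1 subrK.
split; rewrite le_eqVlt => /predU1P[->|lt]; rewrite ?subrr ?mulr0 //.
  have := H (negbT (gt_eqF lt)); rewrite mulrC ltr_pdivrMr ?subr_gt0 //.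
  exact: ltW.
have := H (negbT (lt_eqF lt)).
rewrite -opprB -[X in _ * X]opprB invrN mulrNN mulrC ltr_pdivrMr ?subr_gt0 //.
exact: ltW.
Qed.

(** Cover the exceptional null set by an open set U of measure below the delta
that absolute continuity assigns to e.  Moving to the right from b, a point
outside U allows a step on which f grows by at most e times its length; a
point of U allows a step inside U, and all steps of the second kind together
contribute at most e.  A supremum argument shows that the steps reach c. *)
Lemma ac_nonincreasing f b c : b <= c -> abs_continuous_on b c f ->
  (\forall t \ae leb, b < t -> t < c -> exists2 d : R, d <= 0 & is_derive t 1 f d) ->
  f c <= f b.
Proof.
move=> le_bc acf /ae_completed aef.
suff H e : 0 < e -> f c <= f b + e * (c - b) + e.
  apply/ler_addgt0Pr => e e0.
  have e1 : 0 < e / (c - b + 1) by rewrite divr_gt0 // ltr_wpDl // subr_ge0.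
  rewrite (le_trans (H _ e1)) // -addrA lerD2l -{2}[e / _]mulr1 -mulrDr.
  by rewrite divfK // gt_eqF // ltr_wpDl // subr_ge0.
move=> e0; have [d d0 acd] := acf _ e0.
set N := [set t | ~ (b < t -> t < c -> exists2 d : R, d <= 0 & is_derive t 1 f d)].
have negN : mu.-negligible (N `|` [set b; c]).
  apply: negligibleU => //; exists [set b; c]; split => //.
    by rewrite /=; apply: measurableU => //; exact: measurable_set1.
  by apply: countable_lebesgue_measure0; apply: finite_set_countable.
have d20 : 0 < d / 2 by rewrite divr_gt0.
have [U [oU NU]] := outer_measure_open_le (N `|` [set b; c]) d20.
move/negligible_outer_measure : negN => ->; rewrite add0e => muU.
pose P t := [/\ b <= t, t <= c & exists n (u v : nat -> R),
  [/\ forall k, (k < n)%N -> b <= u k /\ u k <= v k /\ v k <= t,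
      forall j k, (j < k < n)%N -> v j <= u k,
      forall k, (k < n)%N -> `]u k, v k[ `<=` U
    & f t <= f b + e * (t - b) + \sum_(k < n) `|f (v k) - f (u k)|]].
suff Pc : P c.
  case: Pc => _ _ [n [u [v [uv1 uv2 uvU fc]]]].
  have tI : trivIset [set: 'I_n] (fun k => `]u k, v k[%classic).
    move=> j k _ _ [x /=[]]; rewrite !in_itv /= => /andP[x1 x2] /andP[x3 x4].
    apply: val_inj; case: (ltngtP j k) => // lt.
      have := uv2 j k; rewrite lt ltn_ord => /(_ isT) h.
      by have := lt_trans (lt_le_trans x2 h) x3; rewrite ltxx.
    have := uv2 k j; rewrite lt ltn_ord => /(_ isT) h.
    by have := lt_trans (lt_le_trans x4 h) x1; rewrite ltxx.
  rewrite (le_trans fc) // lerD2l ltW //.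
  apply: (acd n (fun k => u k) (fun k => v k)) => [k|//|]; first exact: uv1.
  rewrite -lte_fin; apply: (@le_lt_trans _ _ (d / 2)%:E); last first.
    by rewrite lte_fin ltr_pdivrMr // ltr_pMr // ltr1n.
  apply: le_trans muU.
  rewrite -sumEFin (eq_bigr (fun k : 'I_n => mu `]u k, v k[%classic)); last first.
    move=> k _; rewrite lebesgue_measure_itv /= lte_fin.
    have [_ [+ _]] := uv1 k (ltn_ord k).
    by rewrite le_eqVlt => /predU1P[->|->]; rewrite ?subrr ?ltxx ?EFinB.
  rewrite -(@measure_bigsetU_ord _ _ _ mu n xpredT (fun k => `]u k, v k[%classic)) //.
  apply: le_measure; rewrite ?inE //.
  - by apply: bigsetU_measurable => k _; exact: measurable_itv.
  - exact: measurable_realfun.open_measurable.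
  - by rewrite -(bigcup_mkord n (fun k => `]u k, v k[%classic)) => x [k kn]; exact: uvU.
have Pb : P b.
  split => //; exists 0%N, (fun=> 0), (fun=> 0); split => //.
  by rewrite big_ord0 subrr mulr0 !addr0.
have PU t s : P t -> t <= s -> s <= c -> `]t, s[ `<=` U -> P s.
  move=> [bt tc [n [u [v [uv1 uv2 uvU fc]]]]] ts sc tsU.
  split => //; first exact: le_trans ts.
  exists n.+1, (fun k => if (k < n)%N then u k else t), (fun k => if (k < n)%N then v k else s).
  split.
  - move=> k; rewrite ltnS leq_eqVlt => /predU1P[->|kn]; first by rewrite ltnn.
    by rewrite kn; have [? [? ?]] := uv1 k kn; split => //; split => //; exact: le_trans ts.
  - move=> j k /andP[jk]; rewrite ltnS leq_eqVlt => /predU1P[kn|kn].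
      by move: jk; rewrite kn => jn; rewrite ltnn jn; have [_ []] := uv1 j jn.
    by rewrite kn (ltn_trans jk kn); apply: uv2; rewrite jk.
  - move=> k; rewrite ltnS leq_eqVlt => /predU1P[->|kn]; first by rewrite ltnn.
    by rewrite kn; apply: uvU.
  - rewrite big_ord_recr /= ltnn.
    rewrite (eq_bigr (fun k : 'I_n => `|f (v k) - f (u k)|)); last first.
      by move=> k _; rewrite ltn_ord.
    have h1 := ler_norm (f s - f t).
    have h2 : e * (t - b) <= e * (s - b) by rewrite ler_pM2l // lerD2r.
    lra.
have Pd t s : P t -> t <= s -> s <= c -> f s - f t <= e * (s - t) -> P s.
  move=> [bt tc [n [u [v [uv1 uv2 uvU fc]]]]] ts sc fst.
  split => //; first exact: le_trans ts.
  exists n, u, v; split => //.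
    by move=> k kn; have [? [? ?]] := uv1 k kn; split => //; split => //; exact: le_trans ts.
  by lra.
have hsP : has_sup P by split; [exists b|exists c => t []].
set tau := sup P.
have b_tau : b <= tau by apply: ub_le_sup => //; case: hsP.
have tau_c : tau <= c by apply: ge_sup; [exists b|move=> t []].
have [r r0 Hr] : exists2 r : R, 0 < r & forall t s, P t -> tau - r < t -> t <= tau ->
    tau <= s -> s < tau + r -> s <= c -> P s.
  have [Utau|nUtau] := pselect (U tau).
    have /nbhs_ballP[r /= r0 rU] : nbhs tau U by exact: open_nbhs_nbhs.
    exists r => // t s Pt t1 t2 s1 s2 sc; apply: (PU t) => //; first exact: le_trans s1.
    move=> x /=; rewrite in_itv /= => /andP[x1 x2]; apply: rU.
    by rewrite /ball /= ltr_distl; apply/andP; split; lra.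
  have nN : ~ (N `|` [set b; c]) tau by move=> /NU.
  have b_tau' : b < tau.
    by rewrite lt_neqAle b_tau andbT; apply/eqP => h; apply: nN; right; left.
  have tau_c' : tau < c.
    by rewrite lt_neqAle tau_c andbT; apply/eqP => h; apply: nN; right; right.
  have [d' d'0 fd'] : exists2 d : R, d <= 0 & is_derive tau 1 f d.
    by apply: contrapT => h; apply: nN; left => H; exact: h (H b_tau' tau_c').
  have [r r0 Hr] := is_derive_near fd' (le_lt_trans d'0 e0).
  exists r => // t s Pt t1 t2 s1 s2 sc.
  have [_ /(_ t2) h1] : (tau <= t -> f t - f tau <= e * (t - tau)) /\
      (t <= tau -> f tau - f t <= e * (tau - t)).
    by apply: Hr; rewrite ler0_norm; lra.
  have [/(_ s1) h2 _] : (tau <= s -> f s - f tau <= e * (s - tau)) /\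
      (s <= tau -> f tau - f s <= e * (tau - s)).
    by apply: Hr; rewrite ger0_norm; lra.
  by apply: (Pd t) => //; [exact: le_trans s1|lra].
have [t Pt tlt] := sup_adherent r0 hsP.
have t_tau : t <= tau by apply: ub_le_sup => //; case: hsP.
have [tauc|tauc] := ltP tau c; last first.
  have -> : c = tau by apply/eqP; rewrite eq_le tauc tau_c.
  by apply: (Hr t) => //; rewrite ltrDl.
pose s := Num.min (tau + r / 2) c.
have ts : tau < s by rewrite lt_min tauc andbT ltrDl divr_gt0.
have sc : s <= c by rewrite ge_min lexx orbT.
have : P s.
  apply: (Hr t) => //; first exact: ltW.
  by rewrite gt_min ltrD2l ltr_pdivrMr // ltr_pMr // ltr1n.
by move=> /(ub_le_sup (proj2 hsP)); rewrite leNgt ts.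
Qed.

End AC.

(** * Calculus of absolutely continuous functions and a maximum principle *)

Section ACcalculus.
Context (R : realType).
Implicit Types (f g df dg : R -> R) (b c t : R).
Local Notation leb := (@completed_lebesgue_measure R).

Lemma ac_restrict b c b' c' f : b <= b' -> c' <= c ->
  abs_continuous_on b c f -> abs_continuous_on b' c' f.
Proof.
move=> bb cc acf e e0; have [d d0 H] := acf e e0; exists d => // n u v uv.
apply: H => k; have [? [? ?]] := uv k.
by split; [exact: le_trans bb _|split => //; exact: le_trans cc].
Qed.

Lemma ac_unif b c f : abs_continuous_on b c f -> forall e, 0 < e ->
  exists2 d : R, 0 < d & forall u v, b <= u -> u <= v -> v <= c -> v - u < d ->
    `|f v - f u| < e.
Proof.
move=> acf e e0; have [d d0 H] := acf e e0; exists d => // u v bu uv vc vu.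
have := H 1%N (fun=> u) (fun=> v); rewrite !big_ord1; apply => //.
by move=> i j _ _ _; rewrite !ord1.
Qed.

(** Uniform continuity bounds the increase of |f| on each step of a fixed length,
and finitely many such steps cover the interval. *)
Lemma ac_bounded b c f : abs_continuous_on b c f ->
  exists2 M : R, 0 <= M & forall t, b <= t -> t <= c -> `|f t| <= M.
Proof.
move=> /ac_unif /(_ 1 ltr01) [d d0 H].
have Hn n t : b <= t -> t <= c -> t - b < n%:R * (d / 2) -> `|f t| <= `|f b| + n%:R.
  elim: n t => [|n IHn] t bt tc; first by rewrite mul0r subr_lt0 ltNge bt.
  move=> tn; have [t1|t1] := leP t (b + d / 2).
    have := H _ _ (lexx b) bt tc; have h1 : t - b < d by lra.
    move=> /(_ h1) h2; have h3 := ler_normD (f t - f b) (f b); rewrite subrK in h3.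
    have h4 : 1 <= n.+1%:R :> R by rewrite ler1n.
    lra.
  have : `|f (t - d / 2)| <= `|f b| + n%:R.
    by apply: IHn; [lra|lra|move: tn; rewrite -natr1; lra].
  have h1 : b <= t - d / 2 by lra.
  have h2 : t - d / 2 <= t by lra.
  have h3 : t - (t - d / 2) < d by lra.
  have := H _ _ h1 h2 tc h3.
  have h4 := ler_normD (f t - f (t - d / 2)) (f (t - d / 2)); rewrite subrK in h4.
  by rewrite -natr1; lra.
pose n := (Num.truncn ((c - b) / (d / 2))).+1.
exists (`|f b| + n%:R); first by rewrite addr_ge0.
move=> t bt tc; apply: Hn => //.
rewrite -ltr_pdivrMr ?divr_gt0 //; apply: le_lt_trans (truncnS_gt _).
by rewrite ler_pM2r ?invr_gt0 ?divr_gt0 // lerD2r.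
Qed.

(** A common source for the stability of absolute continuity under sums,
products and the exponential. *)
Lemma ac_lip b c f g1 g2 L : 0 <= L ->
  abs_continuous_on b c g1 -> abs_continuous_on b c g2 ->
  (forall u v, b <= u -> u <= v -> v <= c ->
     `|f v - f u| <= L * (`|g1 v - g1 u| + `|g2 v - g2 u|)) ->
  abs_continuous_on b c f.
Proof.
move=> L0 ac1 ac2 H e e0.
have L1 : 0 < L + 1 by rewrite ltr_wpDl.
have e1 : 0 < e / (2 * (L + 1)) by rewrite divr_gt0 // mulr_gt0.
have [d1 d10 H1] := ac1 _ e1; have [d2 d20 H2] := ac2 _ e1.
exists (Num.min d1 d2); first by rewrite lt_min d10.
move=> n u v uv tI; rewrite lt_min => /andP[/(H1 _ _ _ uv tI) h1 /(H2 _ _ _ uv tI) h2].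
apply: (@le_lt_trans _ _ (L * (\sum_(k < n) `|g1 (v k) - g1 (u k)| +
    \sum_(k < n) `|g2 (v k) - g2 (u k)|))).
  rewrite -big_split mulr_sumr ler_sum // => k _; have [? [? ?]] := uv k; exact: H.
have h3 : L * (\sum_(k < n) `|g1 (v k) - g1 (u k)| + \sum_(k < n) `|g2 (v k) - g2 (u k)|)
   <= L * (e / (2 * (L + 1)) + e / (2 * (L + 1))).
  by rewrite ler_wpM2l // lerD // ltW.
apply: le_lt_trans h3 _.
have -> : L * (e / (2 * (L + 1)) + e / (2 * (L + 1))) = e * (L / (L + 1)).
  by field; rewrite gt_eqF.
by rewrite gtr_pMr // ltr_pdivrMr // mul1r ltrDl.
Qed.

Lemma ac_cst b c k : abs_continuous_on b c (fun=> k).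
Proof.
by move=> e e0; exists 1 => // n u v _ _ _; rewrite big1 // => i _; rewrite subrr normr0.
Qed.

Lemma acN b c f : abs_continuous_on b c f -> abs_continuous_on b c (fun t => - f t).
Proof.
move=> acf; apply: (@ac_lip _ _ _ f f 1) => // u v _ _ _.
by rewrite mul1r -opprD normrN lerDl.
Qed.

Lemma acD b c f g : abs_continuous_on b c f -> abs_continuous_on b c g ->
  abs_continuous_on b c (fun t => f t + g t).
Proof.
move=> acf acg; apply: (@ac_lip _ _ _ f g 1) => // u v _ _ _.
by rewrite mul1r opprD addrACA ler_normD.
Qed.

Lemma acB b c f g : abs_continuous_on b c f -> abs_continuous_on b c g ->
  abs_continuous_on b c (fun t => f t - g t).
Proof. by move=> acf acg; apply: acD => //; exact: acN. Qed.

Lemma acM b c f g : abs_continuous_on b c f -> abs_continuous_on b c g ->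
  abs_continuous_on b c (fun t => f t * g t).
Proof.
move=> acf acg.
have [Mf Mf0 fM] := ac_bounded acf; have [Mg Mg0 gM] := ac_bounded acg.
apply: (@ac_lip _ _ _ f g (Mf + Mg)) => //; first exact: addr_ge0.
move=> u v bu uv vc.
have -> : f v * g v - f u * g u = f v * (g v - g u) + g u * (f v - f u) by ring.
apply: le_trans (ler_normD _ _) _; rewrite !normrM.
have h1 : `|f v| <= Mf by apply: fM => //; exact: le_trans uv.
have h2 : `|g u| <= Mg by apply: gM => //; exact: le_trans uv _.
have h3 := ler_wpM2r (normr_ge0 (g v - g u)) h1.
have h4 := ler_wpM2r (normr_ge0 (f v - f u)) h2.
have h5 : 0 <= Mf * `|f v - f u| by rewrite mulr_ge0.
have h6 : 0 <= Mg * `|g v - g u| by rewrite mulr_ge0.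
lra.
Qed.

(** A function and its density, kept together through algebraic operations. *)
Definition acd b c f df := abs_continuous_on b c f /\
  \forall t \ae leb, b < t -> t < c -> is_derive t (1 : R) f (df t).

Lemma aeW2 (P Q S : R -> Prop) : (forall t, P t -> Q t -> S t) ->
  (\forall t \ae leb, P t) -> (\forall t \ae leb, Q t) -> (\forall t \ae leb, S t).
Proof.
move=> H /ae_completed HP /ae_completed HQ; apply/ae_completed.
have F := ae_filter_ringOfSetsType (@lebesgue_measure R).
by apply: (@filterS2 _ _ F P Q S H HP HQ).
Qed.

Lemma aeW (P S : R -> Prop) : (forall t, P t -> S t) ->
  (\forall t \ae leb, P t) -> (\forall t \ae leb, S t).
Proof. by move=> H HP; apply: (aeW2 _ HP HP) => t + _; exact: H. Qed.

Lemma acd_restrict b c b' c' f df : b <= b' -> c' <= c -> acd b c f df -> acd b' c' f df.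
Proof.
move=> bb cc [acf adf]; split; first exact: ac_restrict acf.
by apply: aeW adf => t H bt tc; apply: H; [exact: le_lt_trans bt|exact: lt_le_trans cc].
Qed.

Lemma acd_cst b c k : acd b c (fun=> k) (fun=> 0).
Proof.
split; first exact: ac_cst.
by apply/ae_completed/nearW => t _ _; exact: is_derive_cst.
Qed.

Lemma acd_add b c f g df dg : acd b c f df -> acd b c g dg ->
  acd b c (fun t => f t + g t) (fun t => df t + dg t).
Proof.
move=> [acf adf] [acg adg]; split; first exact: acD.
by apply: aeW2 adf adg => t Hf Hg bt tc; apply: is_deriveD; [exact: Hf|exact: Hg].
Qed.

Lemma acd_mul b c f g df dg : acd b c f df -> acd b c g dg ->
  acd b c (fun t => f t * g t) (fun t => f t * dg t + g t * df t).
Proof.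
move=> [acf adf] [acg adg]; split; first exact: acM.
by apply: aeW2 adf adg => t Hf Hg bt tc; apply: is_deriveM; [exact: Hf|exact: Hg].
Qed.

Lemma acd_scale b c f df k : acd b c f df -> acd b c (fun t => k * f t) (fun t => k * df t).
Proof.
move=> adf; have [acf aef] := acd_mul (acd_cst b c k) adf; split => //.
by apply: aeW aef => t /= H bt tc; have := H bt tc; rewrite mulr0 addr0.
Qed.

Lemma acd_opp b c f df : acd b c f df -> acd b c (fun t => - f t) (fun t => - df t).
Proof.
move=> [acf adf]; split; first exact: acN.
by apply: aeW adf => t H bt tc; apply: is_deriveN; exact: H.
Qed.

Lemma acd_sum b c (J : Type) (r : seq J) (P : pred J) (F dF : J -> R -> R) :
  (forall j, P j -> acd b c (F j) (dF j)) ->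
  acd b c (fun t => \sum_(j <- r | P j) F j t) (fun t => \sum_(j <- r | P j) dF j t).
Proof.
move=> H; elim: r => [|j r IH].
  have E (G : J -> R -> R) : (fun t => \sum_(j <- [::] | P j) G j t) = fun=> 0.
    by apply/funext => t; rewrite big_nil.
  by rewrite !E; exact: acd_cst.
case Pj : (P j); last first.
  have E (G : J -> R -> R) : (fun t => \sum_(j <- j :: r | P j) G j t) =
      (fun t => \sum_(j <- r | P j) G j t).
    by apply/funext => t; rewrite big_cons Pj.
  by rewrite !E.
have E (G : J -> R -> R) : (fun t => \sum_(j <- j :: r | P j) G j t) =
    (fun t => G j t + \sum_(j <- r | P j) G j t).
  by apply/funext => t; rewrite big_cons Pj.
by rewrite !E; apply: acd_add => //; exact: H.
Qed.

Lemma expR_lip (M x y : R) : x <= M -> y <= M -> `|expR x - expR y| <= expR M * `|x - y|.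
Proof.
wlog le_yx : x y / y <= x.
  move=> W; have [yx|/ltW xy] := leP y x; first exact: W.
  by move=> xM yM; rewrite distrC [`|x - _|]distrC; exact: W.
move=> xM _; rewrite !ger0_norm ?subr_ge0 ?ler_expR //.
have := expR_ge1Dx (y - x); rewrite expRD expRN => h1.
have h2 : expR x * (1 + (y - x)) <= expR y.
  rewrite (le_trans (ler_wpM2l (expR_ge0 x) h1)) // mulrCA divff ?mulr1 //.
  by rewrite gt_eqF // expR_gt0.
have h3 : expR x * (x - y) <= expR M * (x - y).
  by rewrite ler_wpM2r ?subr_ge0 // ler_expR.
lra.
Qed.

Lemma acd_exp b c f df : acd b c f df ->
  acd b c (fun t => expR (f t)) (fun t => expR (f t) * df t).
Proof.
move=> [acf adf]; split.
  have [M M0 fM] := ac_bounded acf.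
  apply: (@ac_lip _ _ _ f (fun=> 0) (expR M)) => //; [exact: ac_cst|].
  move=> u v bu uv vc; rewrite subrr normr0 addr0; apply: expR_lip.
    by apply: le_trans (ler_norm _) _; apply: fM => //; exact: le_trans uv.
  by apply: le_trans (ler_norm _) _; apply: fM => //; exact: le_trans uv _.
apply: aeW adf => t Hf bt tc; apply: is_derive1_comp; exact: Hf.
Qed.

(** The e_i stand for the excess of a subsolution over a supersolution.  If E
bounds all of them, then (e_i - E) * exp A_i does not increase, so that
e_i <= E * (1 - exp (- A_i)) up to a shift of A_i, with A_i bounded; the least
E >= 0 must then vanish.  The hypothesis on the derivative only involves the
past of t, which is how delays enter. *)
Lemma max_principle (I : finType) (e A al : I -> R -> R) b c : b <= c ->
  (forall i, acd b c (A i) (al i)) ->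
  (forall i, abs_continuous_on b c (e i)) ->
  (forall i, e i b <= 0) ->
  (\forall t \ae leb, b < t -> t < c -> forall i,
     exists2 d : R, is_derive t (1 : R) (e i) d &
     forall E, 0 <= E -> (forall j s, b <= s -> s <= t -> e j s <= E) ->
       d <= al i t * (E - e i t)) ->
  forall i t, b <= t -> t <= c -> e i t <= 0.
Proof.
move=> bc acA ace e0 aee.
have [M M0 AM] : exists2 M, 0 <= M & forall i t, b <= t -> t <= c -> `|A i t| <= M.
  have /choice[M HM] : forall i, exists M, forall t, b <= t -> t <= c -> `|A i t| <= M.
    by move=> i; have [M _ ?] := ac_bounded (proj1 (acA i)); exists M.
  exists (\sum_i `|M i|); first exact: sumr_ge0.
  move=> i t bt tc; rewrite (le_trans (HM i t bt tc)) // (le_trans (ler_norm _)) //.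
  by rewrite (bigD1 i) //= lerDl sumr_ge0.
have [N N0 eN] : exists2 M, 0 <= M & forall i t, b <= t -> t <= c -> `|e i t| <= M.
  have /choice[M' HM] : forall i, exists M, forall t, b <= t -> t <= c -> `|e i t| <= M.
    by move=> i; have [? _ ?] := ac_bounded (ace i); eexists; eassumption.
  exists (\sum_i `|M' i|); first exact: sumr_ge0.
  move=> i t bt tc; rewrite (le_trans (HM i t bt tc)) // (le_trans (ler_norm _)) //.
  by rewrite (bigD1 i) //= lerDl sumr_ge0.
pose V := [set y | y = 0 \/ exists i t, [/\ b <= t, t <= c & y = e i t]].
have hsV : has_sup V.
  split; first by exists 0; left.
  exists N => y [->//|[i [t [bt tc ->]]]]; exact: le_trans (ler_norm _) (eN i t bt tc).
set E := sup V.
have E0 : 0 <= E by apply: ub_le_sup; [case: hsV|left].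
have eE i t : b <= t -> t <= c -> e i t <= E.
  by move=> bt tc; apply: ub_le_sup; [case: hsV|right; exists i, t].
pose q := expR (- (M + M)).
have q0 : 0 < q by exact: expR_gt0.
have q1 : q <= 1 by rewrite -expR0 ler_expR oppr_le0 addr_ge0.
have key i t : b <= t -> t <= c -> e i t <= E * (1 - q).
  move=> bt tc.
  have acA' := acd_exp (acd_restrict (lexx b) tc (acA i)).
  have H : (e i t - E) * expR (A i t) <= (e i b - E) * expR (A i b).
    apply: (@ac_nonincreasing _ (fun t => (e i t - E) * expR (A i t))) => //.
      by apply: acM (proj1 acA'); apply: acB (ac_cst _ _ _); exact: ac_restrict (ace i).
    apply: aeW2 aee (proj2 acA') => s He HA bs st.
    have [d Hd dle] := He bs (lt_le_trans st tc) i.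
    exists ((e i s - E) * (expR (A i s) * al i s) + expR (A i s) * d).
      rewrite (_ : _ + _ = expR (A i s) * (d - al i s * (E - e i s))); last by ring.
      apply: mulr_ge0_le0; first exact: expR_ge0.
      rewrite subr_le0; apply: dle => // j r br rs; apply: eE => //.
      exact: le_trans rs (le_trans (ltW st) tc).
    have D1 : is_derive s 1 (fun t => e i t - E) (d - 0) by apply: is_deriveB.
    rewrite subr0 in D1.
    exact: (is_deriveM D1 (HA bs st)).
  have h1 : (e i b - E) * expR (A i b) <= - E * expR (A i b).
    by rewrite ler_wpM2r ?expR_ge0 // gerDr; exact: e0.
  have h2 : (e i t - E) <= - E * expR (A i b - A i t).
    rewrite expRD expRN mulrA ler_pdivlMr ?expR_gt0 //; exact: le_trans H h1.
  have h3 : q <= expR (A i b - A i t).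
    rewrite ler_expR lerNl opprB.
    by rewrite (le_trans (ler_norm _)) // (le_trans (ler_normB _ _)) // lerD // AM.
  have h4 := ler_wpM2l E0 h3.
  lra.
have EE : E <= E * (1 - q).
  apply: ge_sup; first by exists 0; left.
  by move=> y [->|[i [t [bt tc ->]]]]; [rewrite mulr_ge0 // subr_ge0|exact: key].
have E00 : E <= 0.
  rewrite -(pmulr_lle0 E q0); lra.
by move=> i t bt tc; exact: le_trans (eE i t bt tc) E00.
Qed.

End ACcalculus.

(** * Explicit supersolutions on one interval *)

Section Supersolutions.
Context (R : realType) (I : finType).
Implicit Types (a h G : I -> I -> R -> R) (x : R -> I -> R) (S T : {set I}).
Local Notation leb := (@completed_lebesgue_measure R).

Lemma ae_forall (J : finType) (P : J -> R -> Prop) :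
  (forall j, \forall t \ae leb, P j t) -> \forall t \ae leb, forall j, P j t.
Proof.
move=> H; apply/ae_completed.
have F := ae_filter_ringOfSetsType (@lebesgue_measure R).
by apply: filter_forall => j; apply/ae_completed; exact: H.
Qed.

Lemma acd_le b c (f df : R -> R) : acd b c f df ->
  (forall t, b < t -> t < c -> 0 <= df t) ->
  forall s t, b <= s -> s <= t -> t <= c -> f s <= f t.
Proof.
move=> acf df0 s t bs st tc; rewrite -lerN2.
have [ac1 ae1] := acd_opp (acd_restrict bs tc acf).
apply: (ac_nonincreasing st ac1).
apply: aeW ae1 => r H sr rt; exists (- df r); last exact: H.
by rewrite oppr_le0 df0 //; [exact: le_lt_trans bs sr|exact: lt_le_trans rt tc].
Qed.

(** An inequality, rather than the equation, is stable under subtracting a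
nondecreasing function of time, and a solution and its opposite both satisfy
it. *)
Definition subsolution a h (b c : R) x :=
  (forall i, abs_continuous_on b c (x^~ i)) /\
  \forall t \ae leb, b < t -> t < c -> forall i,
    exists2 d : R, is_derive t (1 : R) (x^~ i) d &
      d <= \sum_j a i j t * (x (t - h i j t) j - x t i).

Section OneInterval.
Context (b c : R) (a G : I -> I -> R -> R).
Context (le_bc : b <= c).
Context (acG : forall i j, acd b c (G i j) (a i j)).
Context (a_ge0 : forall i j t, b < t -> t < c -> 0 <= a i j t).

Definition incr i j t := G i j t - G i j b.

Lemma incr_acd i j : acd b c (incr i j) (a i j).
Proof.
have [acf aef] := acd_add (acG i j) (acd_cst b c (- G i j b)); split => //.
by apply: aeW aef => t H bt tc; have := H bt tc; rewrite addr0.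
Qed.

Lemma incr_le i j s t : b <= s -> s <= t -> t <= c -> incr i j s <= incr i j t.
Proof. by apply: acd_le; [exact: incr_acd|exact: a_ge0]. Qed.

Lemma incrb i j : incr i j b = 0. Proof. exact: subrr. Qed.

Lemma incr_ge0 i j t : b <= t -> t <= c -> 0 <= incr i j t.
Proof. by move=> bt tc; rewrite -(incrb i j) incr_le. Qed.

Definition into_flow S T t := \sum_(i | i \notin S) \sum_(j in T) incr i j t.
Definition into_rate S T t := \sum_(i | i \notin S) \sum_(j in T) a i j t.
Definition out_flow S i t := \sum_(j | j \notin S) incr i j t.
Definition out_rate S i t := \sum_(j | j \notin S) a i j t.
Definition tot_flow i t := \sum_j incr i j t.
Definition tot_rate i t := \sum_j a i j t.

Lemma into_acd S T : acd b c (into_flow S T) (into_rate S T).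
Proof. by apply: acd_sum => i _; apply: acd_sum => j _; exact: incr_acd. Qed.
Lemma out_acd S i : acd b c (out_flow S i) (out_rate S i).
Proof. by apply: acd_sum => j _; exact: incr_acd. Qed.
Lemma tot_acd i : acd b c (tot_flow i) (tot_rate i).
Proof. by apply: acd_sum => j _; exact: incr_acd. Qed.

Lemma into_le S T s t : b <= s -> s <= t -> t <= c -> into_flow S T s <= into_flow S T t.
Proof.
by move=> bs st tc; apply: ler_sum => i _; apply: ler_sum => j _; exact: incr_le.
Qed.
Lemma out_ge0 S i t : b <= t -> t <= c -> 0 <= out_flow S i t.
Proof. by move=> bt tc; apply: sumr_ge0 => j _; exact: incr_ge0. Qed.
Lemma tot_ge0 i t : b <= t -> t <= c -> 0 <= tot_flow i t.
Proof. by move=> bt tc; apply: sumr_ge0 => j _; exact: incr_ge0. Qed.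

Definition low_level S T t : R := 1 - expR (- into_flow S T t).

(** The first exponential is the least distance from low_level to 1 on the
interval; the last one accounts for the agents of S that pull back. *)
Definition loss S T i t : R :=
  if S == T then expR (- into_flow S T c) * (out_flow S i t * expR (- tot_flow i t)) else 0.

(** A supersolution that equals the indicator of S at time b, for a history
equal to the indicator of T.  Outside S it rises no faster than the flow coming
from T.  Inside S it falls when S = T; if a member of T outside S has just
fallen, it may still act through its past values, and the bound 1 is kept. *)
Definition level S T i t : R := if i \in S then 1 - loss S T i t else low_level S T t.

(** Bounds all the values of level that are visible at time t through a delay. *)
Definition level_bound S T i t : R := if i \in T then 1 else low_level S T t.
Definition level_rate S T i t : R :=
  if i \in S then
    if S == T then - (expR (- into_flow S T c) *
      (out_flow S i t * (expR (- tot_flow i t) * - tot_rate i t) +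
          expR (- tot_flow i t) * out_rate S i t))
    else 0
  else expR (- into_flow S T t) * into_rate S T t.

Lemma low_level_le1 S T t : low_level S T t <= 1.
Proof. by rewrite gerBl expR_ge0. Qed.

Lemma low_level_le S T s t : b <= s -> s <= t -> t <= c -> low_level S T s <= low_level S T t.
Proof. by move=> bs st tc; rewrite lerD2l lerN2 ler_expR lerN2 into_le. Qed.

Lemma loss_ge0 S T i t : b <= t -> t <= c -> 0 <= loss S T i t.
Proof.
move=> bt tc; rewrite /loss; case: ifP => // _.
by rewrite !mulr_ge0 ?expR_ge0 // out_ge0.
Qed.

Lemma level_acd S T i : acd b c (level S T i) (level_rate S T i).
Proof.
have acl (f df : R -> R) : acd b c f df -> acd b c (fun t => 1 - f t) (fun t => - df t).
  move=> acf; have [ac1 ae1] := acd_add (acd_cst b c 1) (acd_opp acf); split => //.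
  by apply: aeW ae1 => t H bt tc; have := H bt tc; rewrite add0r.
rewrite /level /level_rate /loss; case iS: (i \in S); last first.
  have [ac1 ae1] := acl _ _ (acd_exp (acd_opp (into_acd S T))); split => //.
  by apply: aeW ae1 => t H bt tc; have := H bt tc; rewrite mulrN opprK.
case ST: (S == T); last by have [ac1 ae1] := acl _ _ (acd_cst b c 0); split => //;
  apply: aeW ae1 => t H bt tc; have := H bt tc; rewrite oppr0.
apply: acl; apply: acd_scale.
exact: (acd_mul (out_acd S i) (acd_exp (acd_opp (tot_acd i)))).
Qed.

Lemma level_le_bound S T i s t : S \subset T -> b <= s -> s <= t -> t <= c ->
  level S T i s <= level_bound S T i t.
Proof.
move=> ST bs st tc; rewrite /level /level_bound; case: ifP => iS.
  rewrite (fintype.subsetP ST _ iS) gerBl loss_ge0 //; exact: le_trans tc.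
by case: ifP => _; [exact: low_level_le1|exact: low_level_le].
Qed.

Lemma level_rate_ge S T i t : S \subset T -> b < t -> t < c ->
  \sum_j a i j t * (level_bound S T j t - level S T i t) <= level_rate S T i t.
Proof.
move=> sST bt tc; have a0 j k := a_ge0 j k bt tc.
have [bt' tc'] : b <= t /\ t <= c by split; exact: ltW.
rewrite /level /level_rate; case: ifP => iS; last first.
  rewrite (eq_bigr (fun j => (if j \in T then a i j t else 0) * expR (- into_flow S T t)));
      last first.
    move=> j _; rewrite /level_bound; case: ifP => _; last by rewrite subrr mulr0 mul0r.
    by rewrite /low_level opprB addrC subrK.
  rewrite -big_distrl /= -big_mkcond mulrC /= ler_pM2l ?expR_gt0 //.
  rewrite /into_rate [X in _ <= X](bigD1 i) ?iS //= lerDl.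
  by apply: sumr_ge0 => k _; apply: sumr_ge0.
have [ST|nST] := eqVneq S T; last first.
  rewrite /loss (negbTE nST) subr0; apply: sumr_le0 => j _.
  apply: mulr_ge0_le0 => //; rewrite subr_le0 /level_bound; case: ifP => // _.
  exact: low_level_le1.
set l := loss S T i t.
have El : l = expR (- into_flow S T c) * (out_flow S i t * expR (- tot_flow i t)).
  by rewrite /l /loss ST eqxx.
have -> : \sum_j a i j t * (level_bound S T j t - (1 - l)) =
   tot_rate i t * l - out_rate S i t * expR (- into_flow S T t).
  rewrite /tot_rate /out_rate !big_distrl /= (big_mkcond (fun j => j \notin S)) /= -sumrB.
  apply: eq_bigr => j _; rewrite /level_bound -ST; case: ifP => jS /=.
    by rewrite opprB addrC subrK subr0.
  by rewrite /low_level; ring.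
rewrite El.
have h1 : expR (- into_flow S T c) * expR (- tot_flow i t) <= expR (- into_flow S T t).
  rewrite -expRD ler_expR -opprD lerN2.
  have := into_le S T bt' tc' (lexx c); have := tot_ge0 i bt' tc'; lra.
have h2 : 0 <= out_rate S i t by apply: sumr_ge0.
have := ler_wpM2l h2 h1; lra.
Qed.

Lemma level_b S T i : level S T i b = (i \in S)%:R.
Proof.
rewrite /level /loss /low_level /out_flow /into_flow; case: ifP => iS.
  rewrite [X in _ * (X * _)]big1 ?mul0r ?mulr0 ?if_same ?subr0 // => j _; exact: incrb.
rewrite big1 ?oppr0 ?expR0 ?subrr // => k _; rewrite big1 // => j _; exact: incrb.
Qed.

(** A nonnegative combination of the functions level is again a supersolution,
so max_principle applies to the difference.  Working with explicit
supersolutions, instead of the solutions with the same initial data, avoids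
any appeal to existence. *)
Lemma superposition h hbar x q (g : nat -> R) (S T : nat -> {set I}) base :
  (forall i j t, b < t -> t < c -> 0 <= h i j t <= hbar) ->
  subsolution a h b c x ->
  (forall k, 0 <= g k) -> (forall k, S k \subset T k) ->
  (forall s j, b - hbar <= s -> s < b ->
     x s j <= base + \sum_(k < q) g k * (j \in T k)%:R) ->
  (forall j, x b j <= base + \sum_(k < q) g k * (j \in S k)%:R) ->
  forall i t, b <= t -> t <= c ->
    x t i <= base + \sum_(k < q) g k * level (S k) (T k) i t.
Proof.
move=> hb [acx aex] g0 ST hist init i t bt tc.
pose Y i t := base + \sum_(k < q) g k * level (S k) (T k) i t.
pose dY i t := \sum_(k < q) g k * level_rate (S k) (T k) i t.
have acY j : acd b c (Y j) (dY j).
  have H : acd b c (fun t => \sum_(k < q) g k * level (S k) (T k) j t) (dY j).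
    by apply: acd_sum => k _; apply: acd_scale; exact: level_acd.
  have [ac1 ae1] := acd_add (acd_cst b c base) H; split => //.
  by apply: aeW ae1 => s H' bs sc; have := H' bs sc; rewrite add0r.
rewrite -subr_le0.
apply: (@max_principle R I (fun i t => x t i - Y i t) tot_flow tot_rate b c) => //.
- exact: tot_acd.
- by move=> j; apply: acB; [exact: acx|exact: (proj1 (acY j))].
- move=> j; rewrite subr_le0 (le_trans (init j)) // /Y lerD2l ler_sum // => k _.
  by rewrite level_b.
- have := ae_forall (fun j => proj2 (acY j)).
  apply: aeW2 aex => s Hx HY bs sc j.
  have [d Hd dle] := Hx bs sc j.
  exists (d - dY j s); first by apply: is_deriveB => //; exact: (HY j bs sc).
  move=> E E0 EE.
  have [bs' sc'] : b <= s /\ s <= c by split; exact: ltW.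
  have h1 k : x (s - h j k s) k <= E + base + \sum_(l < q) g l * level_bound (S l) (T l) k s.
    have /andP[hk0 hk1] := hb j k s bs sc.
    have [hs|hs] := leP b (s - h j k s).
      have := EE k (s - h j k s) hs; rewrite gerBl hk0 => /(_ isT).
      rewrite lerBlDr => /le_trans; apply; rewrite /Y addrA lerD2l ler_sum // => l _.
      by rewrite ler_wpM2l // level_le_bound // gerBl.
    have hs' : b - hbar <= s - h j k s by lra.
    rewrite (le_trans (hist _ _ hs' hs)) // -[leLHS]add0r -[leRHS]addrA lerD // lerD2l.
    rewrite ler_sum // => l _.
    rewrite ler_wpM2l // /level_bound; case: ifP => // _.
    rewrite [leLHS](_ : _ = low_level (S l) (T l) b); last first.
      rewrite /low_level /into_flow big1 ?oppr0 ?expR0 ?subrr // => i' _.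
      by rewrite big1 // => j' _; exact: incrb.
    exact: low_level_le.
  have h2 : d <= \sum_k a j k s * (E + base + \sum_(l < q) g l *
      level_bound (S l) (T l) k s - x s j).
    rewrite (le_trans dle) // ler_sum // => k _; rewrite ler_wpM2l ?a_ge0 //.
    by rewrite lerD2r.
  have h3 : \sum_k a j k s * (E + base + \sum_(l < q) g l * level_bound (S l) (T l) k s - x s j) =
     tot_rate j s * (E - (x s j - Y j s)) +
     \sum_(l < q) g l * \sum_k a j k s * (level_bound (S l) (T l) k s - level (S l) (T l) j s).
    under [X in _ = _ + X]eq_bigr do rewrite big_distrr /=.
    rewrite exchange_big /= /tot_rate big_distrl /= -big_split /=.
    apply: eq_bigr => k _; rewrite /Y.
    have -> : \sum_(l < q) g l * (a j k s * (level_bound (S l) (T l) k s - level (S l) (T l) j s)) =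
      a j k s * (\sum_(l < q) g l * level_bound (S l) (T l) k s - \sum_(l < q) g l *
          level (S l) (T l) j s).
      rewrite -sumrB big_distrr /=; apply: eq_bigr => l _; ring.
    ring.
  have h4 : \sum_(l < q) g l * (\sum_k a j k s * (level_bound (S l) (T l) k s - level (S l) (T l)
      j s))
     <= dY j s.
    by apply: ler_sum => l _; rewrite ler_wpM2l // level_rate_ge.
  lra.
Qed.

Section Caps.
Context (h : I -> I -> R -> R) (hbar : R) (x : R -> I -> R).
Context (h_bnd : forall i j t, b < t -> t < c -> 0 <= h i j t <= hbar).
Context (subx : subsolution a h b c x).

Lemma stays_below N : (forall s j, b - hbar <= s -> s < b -> x s j <= N) ->
  (forall j, x b j <= N) -> forall i t, b <= t -> t <= c -> x t i <= N.
Proof.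
move=> hist init i t bt tc.
have := @superposition h hbar x 0 (fun=> 0) (fun=> finset.set0) (fun=> finset.set0) N
  h_bnd subx (fun=> lexx 0) (fun=> subxx _).
move=> /(_ _ _ i t bt tc); rewrite !big_ord0 addr0; apply.
- by move=> s j s1 s2; rewrite big_ord0 addr0 hist.
- by move=> j; rewrite big_ord0 addr0.
Qed.

Lemma rises_slowly S lo N : lo <= N ->
  (forall s j, b - hbar <= s -> s < b -> x s j <= if j \in S then N else lo) ->
  (forall j, x b j <= if j \in S then N else lo) ->
  forall i t, i \notin S -> b <= t -> t <= c -> x t i <= lo + (N - lo) * low_level S S t.
Proof.
move=> loN hist init i t iS bt tc.
have gap j : lo + \sum_(k < 1) (N - lo) * (j \in S)%:R = if j \in S then N else lo.
  by rewrite big_ord1; case: ifP => _; rewrite ?mulr1 ?mulr0 ?addr0 // addrC subrK.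
have gap0 : 0 <= N - lo by rewrite subr_ge0.
have := @superposition h hbar x 1 (fun=> N - lo) (fun=> S) (fun=> S) lo
  h_bnd subx (fun=> gap0) (fun=> subxx _).
move=> /(_ _ _ i t bt tc); rewrite big_ord1 /level (negbTE iS); apply.
- by move=> s j s1 s2; rewrite gap; exact: hist.
- by move=> j; rewrite gap.
Qed.

End Caps.
End OneInterval.
End Supersolutions.

(** * Weighted sums of ranked values *)

Section RankedSums.
Context (R : realType) (I : finType) (q : R).
Context (q_gt0 : 0 < q) (q_le1 : q <= 1).
Implicit Types (s : seq I) (x y : I -> R) (S T : {set I}).

(** The r-th entry of s has weight q ^+ r, in Horner form. *)
Fixpoint wsum s x : R := if s is i :: s' then x i + q * wsum s' x else 0.

Fixpoint geom m : R := if m is m'.+1 then 1 + q * geom m' else 0.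

Lemma geomS m : geom m.+1 = geom m + q ^+ m.
Proof.
elim: m => [|m IH]; first by rewrite /= mulr0 addr0 expr0 add0r.
by rewrite -[geom m.+2]/(1 + q * geom m.+1) {1}IH exprS -[geom m.+1]/(1 + q * geom m); ring.
Qed.

Lemma geom_diff l m : (l <= m)%N -> (1 - q) * (geom m - geom l) <= q ^+ l.
Proof.
move=> lm; have E k : (1 - q) * geom k = 1 - q ^+ k.
  elim: k => [|k IH]; first by rewrite mulr0 expr0 subrr.
  by rewrite geomS mulrDr IH exprS; ring.
rewrite mulrBr !E; have := exprn_ge0 m (ltW q_gt0); lra.
Qed.

Lemma geom_le : {homo geom : l m / (l <= m)%N >-> l <= m}.
Proof.
apply: homo_leq => [//|? ? ?|k]; first exact: le_trans.
by rewrite geomS lerDl exprn_ge0 // ltW.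
Qed.

Lemma geom_lt l m : (l < m)%N -> geom l + q ^+ l <= geom m.
Proof. by rewrite -geomS; exact: geom_le. Qed.

Lemma wsum_le s x y : (forall i, x i <= y i) -> wsum s x <= wsum s y.
Proof. by move=> H; elim: s => //= i s IH; rewrite lerD // ler_pM2l. Qed.

Lemma wsumD s x y : wsum s (fun i => x i + y i) = wsum s x + wsum s y.
Proof. by elim: s => [|i s IH] /=; rewrite ?addr0 // IH; ring. Qed.

Lemma wsumZ s k x : wsum s (fun i => k * x i) = k * wsum s x.
Proof. by elim: s => [|i s IH] /=; rewrite ?mulr0 // IH; ring. Qed.

Lemma wsum_cst s k : wsum s (fun=> k) = k * geom (size s).
Proof. by elim: s => [|i s IH] /=; rewrite ?mulr0 // IH; ring. Qed.

Lemma wsum_sum s m (F : 'I_m -> I -> R) :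
  wsum s (fun i => \sum_(k < m) F k i) = \sum_(k < m) wsum s (F k).
Proof.
elim: s => [|i s IH] /=; first by rewrite big1.
by rewrite IH big_distrr /= -big_split.
Qed.

(** Moving the entries that satisfy P to the front only increases their
weights. *)
Lemma wsum_count s (P : pred I) : wsum s (fun i => (P i)%:R) <= geom (count P s).
Proof.
elim: s => //= i s IH; case: (P i) => /=; first by rewrite lerD2l ler_pM2l.
rewrite add0r (le_trans _ IH) //.
suff : 0 <= wsum s (fun i => (P i)%:R) by move=> h; rewrite ler_piMl.
by elim: (s) => //= j s' h; rewrite addr_ge0 ?ler0n // mulr_ge0 // ltW.
Qed.

(** In a sequence sorted by decreasing x, the entries above a threshold come
first, so wsum_count is an equality for all thresholds at once. *)
Lemma wsum_sorted s x th : sorted (fun i j => x j <= x i) s ->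
  wsum s (fun i => (th <= x i)%R%:R) = geom (count (fun i => th <= x i) s).
Proof.
elim: s => //= i s IH ps; case: (leP th (x i)) => /= hi.
  by rewrite IH // (path_sorted ps).
have H : all (fun j => ~~ (th <= x j)) s.
  have tr : transitive (fun i j => x j <= x i) by move=> a b c h1 h2; exact: le_trans h2 h1.
  have := order_path_min tr ps; apply: sub_all => j h; rewrite -ltNge.
  exact: le_lt_trans hi.
have -> : count (fun j => th <= x j) s = 0%N.
  by apply/eqP; rewrite -leqn0 leqNgt -has_count -all_predC.
have {ps IH}: wsum s (fun i => (th <= x i)%R%:R) = 0.
  elim: s H {ps IH} => //= j s IH /andP[/negbTE -> /IH ->].
  by rewrite mulr0 addr0.
by move=> ->; rewrite mulr0 add0r.
Qed.

Definition ranking s := perm_eq s (enum I).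

Lemma ranking_size s : ranking s -> size s = #|I|.
Proof. by move=> /perm_size ->; rewrite -cardE. Qed.

Lemma ranking_count s S : ranking s -> count [in S] s = #|S|.
Proof. by move=> /permP ->; rewrite -size_filter enumT cardE. Qed.

Lemma wsum_set s S : ranking s -> wsum s (fun i => (i \in S)%:R) <= geom #|S|.
Proof. by move=> rs; rewrite -(ranking_count S rs); exact: wsum_count. Qed.

Definition rank_by x : seq I := sort (fun i j => x j <= x i) (enum I).

Lemma rank_byP x : ranking (rank_by x).
Proof. by rewrite /ranking perm_sort. Qed.

Lemma wsum_rank_by x th : 
  wsum (rank_by x) (fun i => (th <= x i)%R%:R) = geom #|[set i | (th <= x i)%R]%SET|.
Proof.
rewrite wsum_sorted; last by apply: sort_sorted => i j; exact: le_total.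
rewrite -(ranking_count [set i | th <= x i]%SET (rank_byP x)); congr geom.
by apply: eq_count => i; rewrite !inE.
Qed.

Lemma wsum_bound s S y u : ranking s -> u <= 1 ->
  (forall i, i \in S -> y i <= 1) -> (forall i, i \notin S -> y i <= u) ->
  wsum s y <= geom #|S| + u * (geom #|I| - geom #|S|).
Proof.
move=> rs u1 y1 yu.
have h : wsum s y <= wsum s (fun i => u + (1 - u) * (i \in S)%:R).
  apply: wsum_le => i; case: (boolP (i \in S)) => iS; last by rewrite mulr0 addr0 yu.
  by rewrite mulr1 addrC subrK y1.
apply: le_trans h _; rewrite wsumD wsum_cst wsumZ ranking_size //.
have u1' : 0 <= 1 - u by rewrite subr_ge0.
have := ler_wpM2l u1' (wsum_set S rs); lra.
Qed.

(** The worst ranking puts i0 last among the members of S, where its weight is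
q ^+ l. *)
Lemma wsum_bound_drop s S y u v i0 l : ranking s -> #|S| = l.+1 -> i0 \in S ->
  u <= v -> v <= 1 -> y i0 <= v ->
  (forall i, i \in S -> y i <= 1) -> (forall i, i \notin S -> y i <= u) ->
  wsum s y <= geom l + v * q ^+ l + u * (geom #|I| - geom l.+1).
Proof.
move=> rs cS i0S uv v1 y0 y1 yu.
have h : wsum s y <= wsum s (fun i => u + ((v - u) * (i \in S)%:R + (1 - v) * (i \in S :\ i0)%:R)).
  apply: wsum_le => i; rewrite in_setD1; case: (boolP (i \in S)) => iS; last first.
    by rewrite andbF !mulr0 !addr0 yu.
  by case: eqVneq => [->|_] /=; rewrite ?mulr0 ?mulr1; [|have := y1 i iS]; lra.
apply: le_trans h _; rewrite !wsumD wsum_cst !wsumZ ranking_size //.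
have cS' : #|S :\ i0| = l by move: cS; rewrite (cardsD1 i0) i0S => -[].
have h1 := wsum_set S rs; have h2 := wsum_set (S :\ i0) rs; rewrite cS in h1; rewrite cS' in h2.
have u1' : 0 <= v - u by rewrite subr_ge0.
have v1' : 0 <= 1 - v by rewrite subr_ge0.
have := ler_wpM2l u1' h1; have := ler_wpM2l v1' h2.
rewrite geomS; lra.
Qed.

End RankedSums.

Section OneLevel.
Context (R : realType) (I : finType) (eta c0 q B : R).
Context (eta_gt0 : 0 < eta) (eta_le1 : eta <= 1) (c0_gt0 : 0 < c0) (c0_le : c0 <= eta).
Context (q_gt0 : 0 < q) (q_half : q <= 1 / 2) (q_eta : q <= eta / 2).
Context (BE : B * eta = 8) (qB : q * (1 + B) <= c0 / 4).
Implicit Types (S T : {set I}).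

Let q_le1 : q <= 1. Proof. have := q_half; lra. Qed.

Definition drop_rate : R := q ^+ #|I| * (c0 * eta / 2).

Lemma drop_rate_gt0 : 0 < drop_rate.
Proof. by rewrite mulr_gt0 ?exprn_gt0 // divr_gt0 // mulr_gt0. Qed.

(** Here S and T are the agents whose current, respectively stale, value is 1,
and beta is the flow across the cut.  For S = T, the loss c0 * beta of one
member of S has weight at least q ^+ (#|S| - 1), while the agents outside S
gain at most u <= beta with weights that add up to at most 2 * q ^+ #|S| for yz
and B times as much for yx.  For S <> T, the stale part falls by a fixed
fraction of B * q ^+ #|S|, because u <= 1 - eta, and B is large enough for this
to exceed the whole possible gain of yz. *)
Lemma one_level s s' S T yz yx u beta :
  ranking s -> ranking s' -> S \subset T ->
  0 <= u -> u <= beta -> eta * beta <= u -> u <= 1 - eta ->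
  (forall i, i \in S -> yz i <= 1) -> (forall i, i \notin S -> yz i <= u) ->
  (forall i, i \in S -> yx i <= 1) -> (forall i, i \notin S -> yx i <= u) ->
  (S = T -> beta = 0 \/ exists2 i0, i0 \in S & yz i0 <= 1 - c0 * beta) ->
  wsum q s yz + B * wsum q s' yx <=
    geom q #|S| + B * geom q #|T| - drop_rate * (if S == T then beta else 1).
Proof.
move=> rs rs' ST u0 ub bu u1 yz1 yzu yx1 yxu HST.
have h_eta0 := eta_gt0; have h_eta1 := eta_le1; have h_c0 := c0_gt0; have h_c1 := c0_le.
have h_q0 := q_gt0; have h_q2 := q_half; have h_qe := q_eta; have h_qB := qB; have h_q1 := q_le1.
have B0 : 0 < B by rewrite -(pmulr_lgt0 _ eta_gt0) BE.
have cSI := max_card (mem S).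
have ql0 : 0 < q ^+ #|S| by rewrite exprn_gt0.
have gd : geom q #|I| - geom q #|S| <= 2 * q ^+ #|S|.
  have h := geom_diff q_gt0 cSI.
  have h0 : 0 <= geom q #|I| - geom q #|S| by rewrite subr_ge0 geom_le.
  have h1 : 1 / 2 * (geom q #|I| - geom q #|S|) <= (1 - q) * (geom q #|I| - geom q #|S|).
    by rewrite ler_wpM2r //; lra.
  lra.
have u_le1 : u <= 1 by lra.
have hx := wsum_bound q_gt0 q_le1 rs' u_le1 yx1 yxu.
have hz := wsum_bound q_gt0 q_le1 rs u_le1 yz1 yzu.
have hu := ler_wpM2l u0 gd.
have qI0 : 0 < q ^+ #|I| by rewrite exprn_gt0.
case: eqVneq => [E|nE]; last first.
  have cST : (#|S| < #|T|)%N by apply: proper_card; rewrite finset.properEneq nE.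
  have hT := geom_lt q_gt0 cST.
  have hu1 : u * (geom q #|I| - geom q #|S|) <= (1 - eta / 2) * q ^+ #|S|.
    have h := geom_diff q_gt0 cSI.
    have h0 : 0 <= geom q #|I| - geom q #|S| by rewrite subr_ge0 geom_le.
    have e0 : 0 <= 1 - eta / 2 by lra.
    have := ler_wpM2l e0 h; rewrite mulrA.
    have h2 : u <= (1 - eta / 2) * (1 - q) by nra.
    have := ler_wpM2r h0 h2; lra.
  have hB := ler_wpM2l (ltW B0) hx.
  have hB1 := ler_wpM2l (ltW B0) hu1.
  have hBT := ler_wpM2l (ltW B0) hT.
  have E8 : B * (eta / 2 * q ^+ #|S|) = 4 * q ^+ #|S|.
    by rewrite mulrA mulrA BE; field.
  have qlI : q ^+ #|I| <= q ^+ #|S| by rewrite ler_wiXn2l // ltW.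
  have hk : drop_rate <= q ^+ #|S|.
    rewrite /drop_rate (le_trans _ qlI) // ger_pMr //; nra.
  have hu2 : u * (2 * q ^+ #|S|) <= 1 * (2 * q ^+ #|S|) by rewrite ler_wpM2r // mulr_ge0 // ltW.
  lra.
have [b0|[i0 i0S yi0]] := HST E.
  have u00 : u = 0 by apply/eqP; rewrite eq_le u0 andbT -b0.
  rewrite b0 mulr0 subr0 -E; rewrite u00 mul0r addr0 in hx hz.
  by rewrite lerD // ler_pM2l.
have : (0 < #|S|)%N by apply/card_gt0P; exists i0.
case cS : #|S| => [//|l] _; rewrite -E cS.
have ui : u <= 1 - c0 * u by nra.
have v1 : 1 - c0 * u <= 1 by rewrite gerBl mulr_ge0 // ltW.
have yi0' : yz i0 <= 1 - c0 * u.
  by rewrite (le_trans yi0) // lerD2l lerN2 ler_wpM2l // ltW.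
have h1 := wsum_bound_drop q_gt0 q_le1 rs cS i0S ui v1 yi0' yz1 yzu.
rewrite cS in hx hu gd.
have hB := ler_wpM2l (ltW B0) hx.
have hBu := ler_wpM2l (ltW B0) hu.
have Ez : geom q l.+1 = geom q l + q ^+ l by rewrite geomS.
have ql : 0 < q ^+ l by rewrite exprn_gt0.
have e1 : u * (2 * q ^+ l.+1) * (1 + B) <= u * q ^+ l * (c0 / 2).
  have -> : u * (2 * q ^+ l.+1) * (1 + B) = u * q ^+ l * (2 * (q * (1 + B))) by rewrite exprS; ring.
  apply: ler_wpM2l; [by rewrite mulr_ge0 // ltW | lra].
have qlI : q ^+ #|I| <= q ^+ l by rewrite ler_wiXn2l // ?(ltW q_gt0) // (leq_trans _ cSI) // cS.
have e2 : drop_rate * beta <= u * q ^+ l * (c0 / 2).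
  have -> : drop_rate * beta = (c0 / 2) * (q ^+ #|I| * (eta * beta)) by rewrite /drop_rate; field.
  rewrite [leRHS]mulrC ler_wpM2l ?divr_ge0 ?(ltW c0_gt0) // mulrC.
  have b0 : 0 <= eta * beta by rewrite mulr_ge0 ?(ltW eta_gt0) // (le_trans u0).
  by rewrite ler_pM // ltW.
lra.
Qed.

End OneLevel.

Section Layers.
Context (R : realType).

(** If v = th m, the terms with k < m telescope.  A term with k >= m can only
count when th k.+1 <= th m <= th k, and then its gap is zero. *)
Lemma layer_cake (th : nat -> R) q v m : {homo th : k l / (k <= l)%N >-> k <= l} ->
  (m <= q)%N -> v = th m ->
  v = th 0%N + \sum_(k < q) (th k.+1 - th k) * (th k.+1 <= v)%R%:R.
Proof.
move=> th_le mq ->.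
rewrite (eq_bigr (fun k : 'I_q => if (k < m)%N then th k.+1 - th k else 0)); last first.
  move=> k _; case: ltnP => km; first by rewrite th_le // mulr1.
  case: leP => h; last by rewrite mulr0.
  apply/eqP; rewrite mulr1 subr_eq0 eq_le (le_trans h) ?th_le //=.
rewrite -big_mkcond /= -(big_mkord (fun k => (k < m)%N) (fun k => th k.+1 - th k)).
rewrite (big_cat_nat (n := m)) //= [X in _ + (_ + X)]big_nat_cond.
rewrite [X in _ + (_ + X)]big_pred0 ?addr0; last first.
  by move=> k; case: (ltnP k m) => km; rewrite ?andbF //= leqNgt km.
rewrite big_nat_cond (eq_bigl (fun k => (0 <= k < m)%N)); last first.
  by move=> k; case: (k < m)%N; rewrite ?andbF.
by rewrite -big_nat telescope_sumr // addrC subrK.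
Qed.

Lemma levels_exist (L : seq R) : L != [::] -> exists (th : nat -> R) q,
  {homo th : k l / (k <= l)%N >-> k <= l} /\
  forall v, v \in L -> exists2 m, (m <= q)%N & v = th m.
Proof.
move=> Ln; pose s := sort <=%O L.
have s0 : (0 < size s)%N by rewrite size_sort lt0n size_eq0.
have ms k : (minn k (size s).-1 < size s)%N.
  by rewrite -[X in (_ < X)%N](prednK s0) ltnS geq_minr.
exists (fun k => nth 0 s (minn k (size s).-1)), (size s).-1; split.
  move=> k l kl; apply: (sorted_leq_nth le_trans lexx 0 (sort_sorted le_total L));
      rewrite ?inE ?ms //.
  by rewrite leq_min geq_minr andbT (leq_trans _ kl) // geq_minl.
move=> v; rewrite -(mem_sort <=%O) -/s => vs; exists (index v s).
  by rewrite -ltnS prednK // index_mem.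
rewrite (minn_idPl _) ?nth_index // -ltnS prednK // index_mem //.
Qed.

End Layers.

(** * Decrease of the potential over one block *)

Section Constants.
Context (R : realType) (n : nat) (C K : R).

(** The total flow within a block is at most n * n * C, so a distance that decays
at the rate of a flow keeps at least this fraction of its initial value. *)
Definition survival : R := expR (- (n%:R * n%:R * C)).

(** The losses of the members of S add up to at least survival ^ 2 / K times the
flow into the complement, and fewer than n + 1 agents share them. *)
Definition loss_rate : R := survival * survival / (n.+1%:R * K).

(** The value for which the fall of the stale part in one_level, of relative
size survival / 2, is four times the largest weight outside S. *)
Definition stale_weight : R := 8 / survival.
Definition rank_ratio : R := loss_rate / (4 * (1 + stale_weight)).

Lemma survival_gt0 : 0 < survival. Proof. exact: expR_gt0. Qed.

Lemma survival_le1 : 0 <= C -> survival <= 1.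
Proof. by move=> C0; rewrite -expR0 ler_expR oppr_le0 !mulr_ge0. Qed.

Lemma loss_rate_gt0 : 1 <= K -> 0 < loss_rate.
Proof.
move=> K1; have K0 : 0 < K by exact: lt_le_trans K1.
by rewrite divr_gt0 ?mulr_gt0 ?survival_gt0.
Qed.

Lemma loss_rate_le : 0 <= C -> 1 <= K -> loss_rate <= survival.
Proof.
move=> C0 K1; have K0 : 0 < K by exact: lt_le_trans K1.
rewrite ler_pdivrMr ?mulr_gt0 // ler_pM2l ?survival_gt0 // (le_trans (survival_le1 C0)) //.
by rewrite (le_trans K1) // ler_peMl ?(ltW K0) // ler1n.
Qed.

Lemma stale_weight_gt0 : 0 < stale_weight. Proof. by rewrite divr_gt0 ?survival_gt0. Qed.

Lemma stale_weightE : stale_weight * survival =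
    8. Proof. by rewrite divfK // gt_eqF // survival_gt0. Qed.

Lemma rank_ratio_gt0 : 1 <= K -> 0 < rank_ratio.
Proof. by move=> K1; rewrite divr_gt0 ?loss_rate_gt0 // mulr_gt0 // addr_gt0 ?stale_weight_gt0. Qed.

Lemma rank_ratio_stale : rank_ratio * (1 + stale_weight) <= loss_rate / 4.
Proof.
have := stale_weight_gt0; rewrite /rank_ratio => B0.
have B1 : 1 + stale_weight != 0 by rewrite gt_eqF // addr_gt0.
by rewrite le_eqVlt; apply/orP; left; apply/eqP; field.
Qed.

Lemma rank_ratio_survival : 0 <= C -> 1 <= K -> rank_ratio <= survival / 2.
Proof.
move=> C0 K1; have := loss_rate_le C0 K1; have := rank_ratio_stale; have := rank_ratio_gt0 K1;
    have := stale_weight_gt0.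
move=> h1 h2 h3 h4; have : 0 < rank_ratio * stale_weight by rewrite mulr_gt0.
have := loss_rate_gt0 K1; lra.
Qed.

Lemma rank_ratio_half : 0 <= C -> 1 <= K -> rank_ratio <= 1 / 2.
Proof. by move=> C0 K1; have := rank_ratio_survival C0 K1; have := survival_le1 C0; lra. Qed.

End Constants.

(** The relative rise caused by a flow beta is 1 - exp (- beta): it is comparable
with beta and stays away from 1 as long as beta is bounded. *)
Lemma one_sub_exp_bounds (R : realType) (L beta : R) : 0 <= beta -> beta <= L ->
  [/\ 0 <= 1 - expR (- beta), 1 - expR (- beta) <= beta,
      expR (- L) * beta <= 1 - expR (- beta) & 1 - expR (- beta) <= 1 - expR (- L)].
Proof.
move=> b0 bL; have e1 : expR (- L) <= expR (- beta) by rewrite ler_expR lerN2.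
have h1 := expR_ge1Dx (- beta).
split; [| lra | | lra].
  by rewrite subr_ge0 -expR0 ler_expR oppr_le0.
have h3 : expR (- beta) * (1 + beta) <= 1.
  by rewrite -[leRHS](expRxMexpNx_1 beta) mulrC ler_pM2r ?expR_gt0 //; exact: expR_ge1Dx.
have h4 := ler_wpM2r b0 e1.
lra.
Qed.

Section OneStep.
Context (R : realType) (I : finType).
Implicit Types (S T : {set I}).
Local Notation n := #|I|.

Definition Phi C K (x : I -> R) : R := wsum (rank_ratio n C K) (rank_by x) x.
Definition Psi C K (z xi : I -> R) : R := Phi C K z + stale_weight n C * Phi C K xi.
Definition kappa C K : R := drop_rate I (survival n C) (loss_rate n C K) (rank_ratio n C K).

Lemma kappa_gt0 C K : 1 <= K -> 0 < kappa C K.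
Proof.
by move=> K1; apply: drop_rate_gt0; [exact: survival_gt0|exact: loss_rate_gt0|exact:
    rank_ratio_gt0].
Qed.

Context (b c hbar C K : R) (a G h : I -> I -> R -> R) (x : R -> I -> R).
Context (hbar_ge0 : 0 <= hbar) (long : b + hbar <= c).
Context (acG : forall i j, acd b c (G i j) (a i j)).
Context (a_ge0 : forall i j t, b < t -> t < c -> 0 <= a i j t).
Context (h_bnd : forall i j t, b < t -> t < c -> 0 <= h i j t <= hbar).
Context (subx : subsolution a h b c x).
Local Notation w i j := (incr b G i j c).
Context (wC : forall i j, w i j <= C) (wK : forall i j, w i j <= K * w j i).
Context (C_ge0 : 0 <= C) (K_ge1 : 1 <= K).

Let le_bc : b <= c. Proof. by apply: le_trans long; rewrite lerDl. Qed.
Let w_ge0 i j : 0 <= w i j. Proof. by apply: (incr_ge0 acG). Qed.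

Lemma sum_le_card (P Q : pred I) (F : I -> I -> R) : (forall i j, 0 <= F i j) ->
  (forall i j, F i j <= C) -> \sum_(i | P i) \sum_(j | Q j) F i j <= n%:R * n%:R * C.
Proof.
move=> F0 FC; apply: (@le_trans _ _ (\sum_(i : I) \sum_(j : I) C)); last first.
  have E (d : R) : \sum_(i : I) d = n%:R * d by rewrite sumr_const mulr_natl.
  by under [leLHS]eq_bigr do rewrite E; rewrite E mulrA.
rewrite big_mkcond ler_sum // => i _; case: ifP => _; last by rewrite sumr_ge0.
by rewrite big_mkcond ler_sum // => j _; case: ifP.
Qed.

Lemma into_flow_le S T : into_flow b G S T c <= n%:R * n%:R * C.
Proof. exact: sum_le_card. Qed.

Lemma into_flow_ge0 S T : 0 <= into_flow b G S T c.
Proof. by apply: sumr_ge0 => i _; exact: sumr_ge0. Qed.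

Lemma tot_flow_le i : tot_flow b G i c <= n%:R * n%:R * C.
Proof.
have := @sum_le_card (pred1 i) predT (fun i j => w i j) w_ge0 wC.
by rewrite big_pred1_eq.
Qed.

Lemma level_flow_bounds S T : let beta := into_flow b G S T c in
  let u := low_level b G S T c in
  [/\ 0 <= u, u <= beta, survival n C * beta <= u & u <= 1 - survival n C].
Proof.
move=> beta u; apply: one_sub_exp_bounds; first exact: into_flow_ge0.
exact: into_flow_le.
Qed.

(** By reciprocity the flow from outside into S is at least beta / K; one of the
members of S receives at least the average. *)
Lemma loss_large S : let beta := into_flow b G S S c in
  beta = 0 \/ exists2 i0, i0 \in S & level b c G S S i0 c <= 1 - loss_rate n C K * beta.
Proof.
move=> beta.
have K0 : 0 < K by exact: lt_le_trans K_ge1.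
have b0 : 0 <= beta by exact: into_flow_ge0.
have [->|bn0] := eqVneq beta 0; [by left|right].
have {b0 bn0} b0 : 0 < beta by rewrite lt_neqAle eq_sym bn0.
have [//|H] := pselect (exists2 i0, i0 \in S & level b c G S S i0 c <= 1 - loss_rate n C K * beta).
exfalso.
have {}H i : i \in S -> loss b c G S S i c < loss_rate n C K * beta.
  move=> iS; rewrite ltNge; apply/negP => h'; apply: H; exists i => //.
  by rewrite /level iS lerD2l lerN2.
have out0 i : 0 <= out_flow b G S i c by exact: sumr_ge0.
have H1 i : i \in S -> survival n C * survival n C * out_flow b G S i c <= loss_rate n C K * beta.
  move=> iS; apply: le_trans (ltW (H i iS)); rewrite /loss eqxx -mulrA [out_flow _ _ _ _ _ *
      _]mulrC.
  have e1 : survival n C <= expR (- into_flow b G S S c) by rewrite ler_expR lerN2 into_flow_le.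
  have e2 : survival n C <= expR (- tot_flow b G i c) by rewrite ler_expR lerN2 tot_flow_le.
  have e0 := ltW (survival_gt0 n C).
  by rewrite ler_pM // ?mulr_ge0 // ler_pM.
have H2 : \sum_(i in S) survival n C * survival n C * out_flow b G S i c <=
    n%:R * (loss_rate n C K * beta).
  apply: (@le_trans _ _ (\sum_(i : I) loss_rate n C K * beta));
      last by rewrite sumr_const mulr_natl.
  rewrite big_mkcond ler_sum // => i _; case: ifP => [iS|_]; first exact: H1.
  by rewrite mulr_ge0 // ltW // loss_rate_gt0.
have H3 : beta <= K * \sum_(i in S) out_flow b G S i c.
  rewrite /beta /into_flow /out_flow exchange_big /= big_distrr ler_sum //= => i _.
  by rewrite big_distrr ler_sum.
rewrite -big_distrr /= in H2.
have e0 := survival_gt0 n C.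
have H4 : survival n C * survival n C * beta <= K * (n%:R * (loss_rate n C K * beta)).
  rewrite (le_trans (ler_wpM2l _ H3)) ?mulr_ge0 ?(ltW e0) //.
  by rewrite mulrCA ler_pM2l.
have E : K * (n%:R * (loss_rate n C K * beta)) =
    survival n C * survival n C * beta * (n%:R / n.+1%:R).
  by rewrite /loss_rate; field; rewrite addrC natr1 pnatr_eq0 (gt_eqF K0).
move: H4; rewrite E leNgt => /negP; apply.
rewrite gtr_pMr ?mulr_gt0 // ltr_pdivrMr // mul1r ltr_nat //.
Qed.

Let level_c_le1 S T i : i \in S -> level b c G S T i c <= 1.
Proof. by move=> iS; rewrite /level iS gerBl (loss_ge0 acG a_ge0 _ _ _ le_bc). Qed.

(** The levels th contain all the values of z and xi, so z and xi are the layer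
cakes of their level sets S k and T k.  Ranking by z (or xi) is optimal for all
level sets at once, which gives Psi of the initial state exactly; the final
state is below the superposition, whose levels one_level bounds for an
arbitrary ranking. *)
Lemma one_step (z xi z' xi' : I -> R) (th : nat -> R) m :
  {homo th : k l / (k <= l)%N >-> k <= l} ->
  (forall i, exists2 k, (k <= m)%N & z i = th k) ->
  (forall i, exists2 k, (k <= m)%N & xi i = th k) ->
  (forall i, x b i = z i) -> (forall i, z i <= xi i) ->
  (forall s i, b - hbar <= s -> s < b -> x s i <= xi i) ->
  (forall i, x c i = z' i) ->
  (forall i M, (forall s, c - hbar <= s -> s <= c -> x s i <= M) -> xi' i <= M) ->
  let S k := [set i | th k.+1 <= z i]%SET in
  let T k := [set i | th k.+1 <= xi i]%SET in
  is_true (Psi C K z' xi' <= Psi C K z xi - kappa C K *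
    \sum_(k < m) (th k.+1 - th k) *
       (if S k == T k then into_flow b G (S k) (S k) c else 1)).
Proof.
move=> th_le zth xith xz zxi xxi xz' xixi' S T.
have g0 k : 0 <= th k.+1 - th k by rewrite subr_ge0 th_le.
have ST k : S k \subset T k.
  by apply/fintype.subsetP => i; rewrite !inE => /le_trans; apply.
have zE i : z i = th 0%N + \sum_(k < m) (th k.+1 - th k) * (i \in S k)%:R.
  have [k km zk] := zth i; rewrite {1}(layer_cake th_le km zk); congr (_ + _).
  by apply: eq_bigr => l _; rewrite inE.
have xiE i : xi i = th 0%N + \sum_(k < m) (th k.+1 - th k) * (i \in T k)%:R.
  have [k km zk] := xith i; rewrite {1}(layer_cake th_le km zk); congr (_ + _).
  by apply: eq_bigr => l _; rewrite inE.
have sup := superposition le_bc acG a_ge0 h_bnd subx g0 ST.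
have {sup} sup i t : b <= t -> t <= c ->
    x t i <= th 0%N + \sum_(k < m) (th k.+1 - th k) * level b c G (S k) (T k) i t.
  by apply: sup => [s j s1 s2|j]; [rewrite -xiE; exact: xxi|rewrite -zE xz].
have z'le i : z' i <= th 0%N + \sum_(k < m) (th k.+1 - th k) * level b c G (S k) (T k) i c.
  by rewrite -xz' sup.
pose yx k i : R := if i \in S k then 1 else low_level b G (S k) (T k) c.
have xi'le i : xi' i <= th 0%N + \sum_(k < m) (th k.+1 - th k) * yx k i.
  apply: xixi' => s s1 s2.
  have bs : b <= s by have := long; lra.
  rewrite (le_trans (sup i s bs s2)) // lerD2l ler_sum // => k _.
  rewrite ler_wpM2l // /level /yx; case: ifP => _.
    by rewrite gerBl (loss_ge0 acG a_ge0).
  exact: (low_level_le acG a_ge0).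
have q0 := rank_ratio_gt0 n C K_ge1.
have B0 := stale_weight_gt0 n C.
have EPhi y : (forall i, exists2 k, (k <= m)%N & y i = th k) ->
    Phi C K y = th 0%N * geom (rank_ratio n C K) n +
     \sum_(k < m) (th k.+1 - th k) * geom (rank_ratio n C K) #|[set i | th k.+1 <= y i]%SET|.
  move=> yth; rewrite /Phi.
  have E : wsum (rank_ratio n C K) (rank_by y) y = wsum (rank_ratio n C K) (rank_by y)
      (fun i => th 0%N + \sum_(k < m) (th k.+1 - th k) * (th k.+1 <= y i)%R%:R).
    congr wsum; apply/funext => i; have [k km yk] := yth i; exact: layer_cake yk.
  rewrite E wsumD wsum_cst ranking_size ?rank_byP // wsum_sum; congr (_ + _).
  by apply: eq_bigr => k _; rewrite wsumZ wsum_rank_by.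
have LPhi y (Y : nat -> I -> R) : (forall i, y i <=
    th 0%N + \sum_(k < m) (th k.+1 - th k) * Y k i) ->
    Phi C K y <= th 0%N * geom (rank_ratio n C K) n +
     \sum_(k < m) (th k.+1 - th k) * wsum (rank_ratio n C K) (rank_by y) (Y k).
  move=> yY; apply: le_trans (wsum_le q0 (rank_by y) yY) _.
  rewrite wsumD wsum_cst ranking_size ?rank_byP // wsum_sum lerD2l ler_sum // => k _.
  by rewrite wsumZ.
have H1 := LPhi _ (fun k i => level b c G (S k) (T k) i c) z'le.
have H2 := LPhi _ yx xi'le.
rewrite /Psi (EPhi z zth) (EPhi xi xith).
have H3 : \sum_(k < m) (th k.+1 - th k) * wsum (rank_ratio n C K) (rank_by z') (fun i => level b
    c G (S k) (T k) i c)
   + stale_weight n C * \sum_(k < m) (th k.+1 - th k) * wsum (rank_ratio n C K) (rank_by xi') (yx k)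
   <= \sum_(k < m) (th k.+1 - th k) * geom (rank_ratio n C K) #|S k| +
      stale_weight n C * \sum_(k < m) (th k.+1 - th k) * geom (rank_ratio n C K) #|T k| -
      kappa C K * \sum_(k < m) (th k.+1 - th k) * (if S k == T k then into_flow b G (S k) (S k) c
          else 1).
  rewrite !big_distrr /= -!big_split /= -sumrB ler_sum // => k _.
  have [u0 ub bu u1] := level_flow_bounds (S k) (T k).
  have -> : (if S k == T k then into_flow b G (S k) (S k) c else 1) =
      (if S k == T k then into_flow b G (S k) (T k) c else 1).
    by case: eqVneq => // {2}->.
  suff H : wsum (rank_ratio n C K) (rank_by z') (fun i => level b c G (S k) (T k) i c) +
     stale_weight n C * wsum (rank_ratio n C K) (rank_by xi') (yx k) <=
     geom (rank_ratio n C K) #|S k| + stale_weight n C * geom (rank_ratio n C K) #|T k| -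
     kappa C K * (if S k == T k then into_flow b G (S k) (T k) c else 1).
    by have := ler_wpM2l (g0 k) H; lra.
  apply: (@one_level _ _ (survival n C) (loss_rate n C K) (rank_ratio n C K) (stale_weight n C)
    (survival_gt0 _ _) (survival_le1 _ C_ge0) (loss_rate_gt0 _ _ K_ge1) (loss_rate_le _ C_ge0
        K_ge1) q0
    (rank_ratio_half _ C_ge0 K_ge1) (rank_ratio_survival _ C_ge0 K_ge1) (stale_weightE _ _)
        (rank_ratio_stale _ _ _) _ _ _ _ _ _
    (low_level b G (S k) (T k) c)) => //; try exact: rank_byP.
  - by move=> i; exact: level_c_le1.
  - by move=> i /negbTE iS; rewrite /level iS.
  - by move=> i iS; rewrite /yx iS.
  - by move=> i /negbTE iS; rewrite /yx iS.
  - by move=> E; rewrite -E; exact: loss_large.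
have H4 := ler_wpM2l (ltW B0) H2.
lra.
Qed.

End OneStep.

(** * Trajectories over a sequence of blocks *)

Section Trajectory.
Context (R : realType) (I : finType) (hbar T0 C K : R).
Context (a G h : I -> I -> R -> R) (tau : nat -> R).
Implicit Types (S : {set I}) (x y : R -> I -> R) (p q : nat).
Local Notation n := #|I|.

Definition weight p i j : R := G i j (tau p.+1) - G i j (tau p).
Definition cut_flow S p : R := \sum_(i | i \notin S) \sum_(j in S) weight p i j.

(** A block is at least as long as the maximal delay, so that the delay window
before its right end lies inside it. *)
Record reciprocal_blocks : Prop := ReciprocalBlocks {
  rb_hbar : 0 <= hbar;
  rb_acG : forall c i j, acd T0 c (G i j) (a i j);
  rb_a : forall i j t, T0 < t -> 0 <= a i j t;
  rb_h : forall i j t, T0 < t -> 0 <= h i j t <= hbar;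
  rb_start : forall p, T0 + hbar <= tau p;
  rb_long : forall p, tau p + hbar <= tau p.+1;
  rb_C : forall p i j, weight p i j <= C;
  rb_K : forall p i j, weight p i j <= K * weight p j i;
  rb_C0 : 0 <= C;
  rb_K1 : 1 <= K }.

(** The inequality is required from T0 + hbar on, when the delayed arguments can
no longer precede T0. *)
Definition bounded_sub x (M : R) :=
  [/\ forall c i, abs_continuous_on T0 c (x^~ i),
      forall b c, T0 + hbar <= b -> subsolution a h b c x
    & forall t i, T0 <= t -> `|x t i| <= M].

Context (rb : reciprocal_blocks).

Definition window x p i : R := sup [set x s i | s in `[tau p - hbar, tau p]].
Definition value x p i : R := x (tau p) i.
Definition potential x p : R := Psi C K (value x p) (window x p).

Lemma window_sup x M p i : bounded_sub x M ->
  has_sup [set x s i | s in `[tau p - hbar, tau p]].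
Proof.
move=> [_ _ xM]; split.
  exists (x (tau p) i), (tau p) => //=; rewrite in_itv /= lexx andbT.
  by have := rb_hbar rb; lra.
exists M => y [s /=]; rewrite in_itv /= => /andP[s1 _] <-.
rewrite (le_trans (ler_norm _)) // xM //.
by have := rb_start rb p; lra.
Qed.

Lemma window_ge x M p i s : bounded_sub x M ->
  tau p - hbar <= s -> s <= tau p -> x s i <= window x p i.
Proof.
move=> bx s1 s2; apply: ub_le_sup; first by have [] := window_sup p i bx.
by exists s => //=; rewrite in_itv /= s1.
Qed.

Lemma window_le x M p i N : bounded_sub x M ->
  (forall s, tau p - hbar <= s -> s <= tau p -> x s i <= N) -> window x p i <= N.
Proof.
move=> bx H; apply: ge_sup; first by have [] := window_sup p i bx.
by move=> y [s /=]; rewrite in_itv /= => /andP[s1 s2] <-; exact: H.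
Qed.

Lemma value_le_window x M p i : bounded_sub x M -> value x p i <= window x p i.
Proof.
by move=> bx; apply: (window_ge _ bx) => //; have := rb_hbar rb; lra.
Qed.

Lemma value_bound x M p i : bounded_sub x M -> `|value x p i| <= M.
Proof.
by move=> [_ _]; apply; have := rb_start rb p; have := rb_hbar rb; lra.
Qed.

Lemma window_bound x M p i : bounded_sub x M -> `|window x p i| <= M.
Proof.
move=> bx; rewrite ler_norml; apply/andP; split.
  apply: le_trans (value_le_window p i bx); have := value_bound p i bx.
  by rewrite ler_norml => /andP[].
apply: (window_le bx) => s s1 _.
have [_ _ xM] := bx; rewrite (le_trans (ler_norm _)) // xM //.
by have := rb_start rb p; lra.
Qed.

Let start0 p : T0 <= tau p.
Proof. by have := rb_start rb p; have := rb_hbar rb; lra. Qed.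

Let acGp p c i j : acd (tau p) c (G i j) (a i j).
Proof. exact: acd_restrict (start0 p) (lexx c) (rb_acG rb c i j). Qed.

Let a_p p c i j t : tau p < t -> t < c -> 0 <= a i j t.
Proof. by move=> pt _; apply: (rb_a rb); exact: le_lt_trans pt. Qed.

Let h_p p c i j t : tau p < t -> t < c -> 0 <= h i j t <= hbar.
Proof. by move=> pt _; apply: (rb_h rb); exact: le_lt_trans pt. Qed.

Let tau_leS p : tau p <= tau p.+1.
Proof. by have := rb_long rb p; have := rb_hbar rb; lra. Qed.

Lemma weight_ge0 p i j : 0 <= weight p i j.
Proof. by apply: (incr_ge0 (acGp p _) (@a_p p _)). Qed.

Lemma cut_flow_ge0 S p : 0 <= cut_flow S p.
Proof. by apply: sumr_ge0 => i _; apply: sumr_ge0 => j _; exact: weight_ge0. Qed.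

Lemma cut_flowC S p : cut_flow (~: S) p <= K * cut_flow S p.
Proof.
rewrite /cut_flow exchange_big /= big_distrr /=.
rewrite [leRHS](eq_bigl (fun i => i \in ~: S)); last by move=> i; rewrite inE.
apply: ler_sum => i _; rewrite big_distrr /=.
rewrite [leLHS](eq_bigl (fun i => i \in S)); last by move=> k; rewrite !inE negbK.
by apply: ler_sum => j _; exact: (rb_K rb).
Qed.

Lemma cap x M N p : bounded_sub x M -> (forall i, window x p i <= N) ->
  forall t i, tau p <= t -> x t i <= N.
Proof.
move=> bx H t i pt; have [_ sx _] := bx.
apply: (stays_below pt (acGp p t) (@a_p p t) (@h_p p t) (sx _ t (rb_start rb p))) => //.
- by move=> s j s1 s2; rewrite (le_trans _ (H j)) // (window_ge _ bx s1 (ltW s2)).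
- by move=> j; rewrite (le_trans _ (H j)) // (value_le_window _ _ bx).
Qed.

Lemma window_spread x M N lo S p : bounded_sub x M -> lo <= N ->
  (forall i, window x p i <= N) -> (forall i, i \notin S -> window x p i <= lo) ->
  forall i, i \notin S -> window x p.+1 i <= lo + (N - lo) * cut_flow S p.
Proof.
move=> bx loN HN Hlo i iS; have [_ sx _] := bx.
have gap0 : 0 <= N - lo by rewrite subr_ge0.
have le_p1 := tau_leS p.
have Hw j : window x p j <= if j \in S then N else lo.
  by case: ifPn => jS; [exact: HN|exact: Hlo].
apply: (window_le bx) => s s1 s2.
have s0 : tau p <= s by have := rb_long rb p; lra.
apply: le_trans (rises_slowly le_p1 (acGp p _) (@a_p p _) (@h_p p _)
    (sx _ _ (rb_start rb p)) loN _ _ iS s0 s2) _.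
- by move=> r j r1 r2; rewrite (le_trans (window_ge j bx r1 (ltW r2))).
- by move=> j; rewrite (le_trans (value_le_window p j bx)).
rewrite lerD2l ler_wpM2l // (le_trans (low_level_le (acGp p _) (@a_p p _) _ _ s0 s2 (lexx _))) //.
by have [] := one_sub_exp_bounds (cut_flow_ge0 S p) (lexx _).
Qed.

Let step_levels x M p (L : seq R) : bounded_sub x M -> L != [::] ->
  exists (th : nat -> R) m, let S k := [set i | th k.+1 <= value x p i]%SET in
  let T k := [set i | th k.+1 <= window x p i]%SET in
  [/\ {homo th : k l / (k <= l)%N >-> k <= l},
   forall v, v \in L -> exists2 k, (k <= m)%N & v = th k,
   forall i, exists2 k, (k <= m)%N & value x p i = th k,
   forall i, exists2 k, (k <= m)%N & window x p i = th k
   & potential x p.+1 <= potential x p - kappa I C K *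
     \sum_(k < m) (th k.+1 - th k) * (if S k == T k then cut_flow (S k) p else 1)].
Proof.
move=> bx Ln; have [_ sx _] := bx.
have [|th [m [th_le thL]]] := @levels_exist R (L ++ ([seq value x p i | i <- enum I] ++ [seq
    window x p i | i <- enum I])).
  by case: (L) Ln.
exists th, m => S T.
have thv i : exists2 k, (k <= m)%N & value x p i = th k.
  by apply: thL; rewrite !mem_cat map_f ?orbT // mem_enum.
have thw i : exists2 k, (k <= m)%N & window x p i = th k.
  by apply: thL; rewrite !mem_cat [_ \in [seq window _ _ _ | _ <- _]]map_f ?orbT // mem_enum.
split => //; first by move=> v vL; apply: thL; rewrite mem_cat vL.
apply: (one_step (rb_hbar rb) (rb_long rb p) (acGp p _) (@a_p p _) (@h_p p _)
  (sx _ _ (rb_start rb p)) (rb_C rb p) (rb_K rb p) (rb_C0 rb) (rb_K1 rb) th_le thv thw) => //.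
- by move=> i; exact: value_le_window bx.
- by move=> s i s1 s2; exact: window_ge bx s1 (ltW s2).
- by move=> i N; exact: window_le bx.
Qed.

Let kappa0 : 0 < kappa I C K.
Proof. exact: kappa_gt0 (rb_K1 rb). Qed.

(** On every level between value x p i and window x p i, agent i separates the
two level sets, and such a level contributes its full gap. *)
Lemma potential_drop_stale x M p i : bounded_sub x M ->
  potential x p.+1 <= potential x p - kappa I C K * (window x p i - value x p i).
Proof.
move=> bx; have [th [m [th_le _ thv thw H]]] := step_levels p bx (L := [:: 0]) isT.
apply: le_trans H _; rewrite lerD2l lerN2 ler_pM2l //.
have [k km Ek] := thv i; have [l lm El] := thw i.
rewrite {1}(layer_cake th_le lm El) {1}(layer_cake th_le km Ek).
rewrite opprD addrACA subrr add0r -sumrB ler_sum // => r _.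
rewrite -mulrBr ler_wpM2l ?subr_ge0 ?th_le //.
case: eqVneq => [E|_].
  have : (i \in [set i | th r.+1 <= value x p i]%SET) = (i \in [set i | th r.+1 <=
      window x p i]%SET) by rewrite E.
  by rewrite !inE => ->; rewrite subrr cut_flow_ge0.
by case: (_ <= window _ _ _); case: (_ <= value _ _ _);
    rewrite /= ?subrr ?subr0 ?sub0r ?lerN10 ?ler01 // lerNl oppr0 ler01.
Qed.

Lemma potential_nonincr x M p : bounded_sub x M -> potential x p.+1 <= potential x p.
Proof.
move=> bx; have [th [m [th_le _ _ _ H]]] := step_levels p bx (L := [:: 0]) isT.
apply: le_trans H _; rewrite gerBl mulr_ge0 ?(ltW kappa0) // sumr_ge0 // => k _.
by rewrite mulr_ge0 ?subr_ge0 ?th_le //; case: ifP => // _; exact: cut_flow_ge0.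
Qed.

(** On every level between lo and hi both level sets are S. *)
Lemma potential_drop_cut x M p S lo hi : bounded_sub x M -> lo <= hi ->
  (forall i, i \in S -> hi <= value x p i) -> (forall i, i \notin S -> window x p i <= lo) ->
  potential x p.+1 <= potential x p - kappa I C K * ((hi - lo) * cut_flow S p).
Proof.
move=> bx lohi Hhi Hlo; have [th [m [th_le thL thv thw H]]] := step_levels p bx (L := [:: lo;
    hi]) isT.
apply: le_trans H _; rewrite lerD2l lerN2 ler_pM2l //.
have [|k km Ek] := thL lo; first by rewrite !inE eqxx.
have [|l lm El] := thL hi; first by rewrite !inE eqxx orbT.
rewrite {1}(layer_cake th_le lm El) {1}(layer_cake th_le km Ek).
rewrite opprD addrACA subrr add0r -sumrB big_distrl ler_sum //= => r _.
rewrite -mulrBr -mulrA ler_wpM2l ?subr_ge0 ?th_le //.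
have [h1|h1] := leP (th r.+1) hi; last first.
  have h2 : (th r.+1 <= lo) = false by apply/negbTE; rewrite -ltNge (le_lt_trans lohi).
  by rewrite h2 subrr mul0r; case: ifP => // _; exact: cut_flow_ge0.
have [h2|h2] := leP (th r.+1) lo.
  by rewrite subrr mul0r; case: ifP => // _; exact: cut_flow_ge0.
rewrite subr0 mul1r.
have -> : [set i | th r.+1 <= value x p i]%SET = S.
  apply/setP => i; rewrite inE; case: (boolP (i \in S)) => iS.
    by rewrite (le_trans h1) // Hhi.
  by apply/negbTE; rewrite -ltNge (le_lt_trans (value_le_window p i bx)) // (le_lt_trans (Hlo i
      iS)).
have -> : [set i | th r.+1 <= window x p i]%SET = S.
  apply/setP => i; rewrite inE; case: (boolP (i \in S)) => iS.
    by rewrite (le_trans h1) // (le_trans (Hhi i iS)) // (value_le_window p i bx).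
  by apply/negbTE; rewrite -ltNge (le_lt_trans (Hlo i iS)).
by rewrite eqxx.
Qed.

Lemma potential_bounded x M : bounded_sub x M -> exists N, forall p, N <= potential x p.
Proof.
move=> bx; exists (- M * geom (rank_ratio n C K) n +
    stale_weight n C * (- M * geom (rank_ratio n C K) n)) => p.
have Hphi (y : I -> R) : (forall i, `|y i| <= M) -> - M * geom (rank_ratio n C K) n <= Phi C K y.
  move=> yM; have E := wsum_cst (rank_ratio n C K) (rank_by y) (- M).
  rewrite ranking_size ?rank_byP // in E; rewrite -E.
  apply: wsum_le; first exact: rank_ratio_gt0 (rb_K1 rb).
  by move=> i; have := yM i; rewrite ler_norml => /andP[].
rewrite lerD // ?ler_pM2l ?stale_weight_gt0 // Hphi // => i.
  exact: value_bound bx.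
exact: window_bound bx.
Qed.

Lemma nonincr_cauchy (u : nat -> R) N : (forall p, u p.+1 <= u p) -> (forall p, N <= u p) ->
  forall e, 0 < e -> exists P, forall p q, (P <= p)%N -> (P <= q)%N -> u p - u q < e.
Proof.
move=> ui uN e e0.
have ud : {homo u : p q / (p <= q)%N >-> q <= p}.
  by apply: homo_leq => [//|p q r h1 h2|p]; [exact: le_trans h2 h1|exact: ui].
have hi : has_inf (range u) by split; [exists (u 0%N), 0%N|exists N => _ [p _ <-]].
have [_ [P _ <-] HP] := inf_adherent e0 hi.
exists P => p q Pp Pq; have h1 : inf (range u) <= u q by apply: ge_inf; [case: hi|exists q].
by have := ud _ _ Pp; lra.
Qed.

(** Cut the interval above z i2 into #|I| pieces: as z i2 is inside none of
them, one of them contains no value of z. *)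
Lemma gap_exists (z : I -> R) i1 i2 D : 0 < D -> D <= z i1 - z i2 ->
  exists S lo hi, [/\ i1 \in S, i2 \notin S, D / n%:R <= hi - lo,
    forall i, i \in S -> hi <= z i & forall i, i \notin S -> z i <= lo].
Proof.
move=> D0 Dz.
have n0 : (0 < n)%N by apply/card_gt0P; exists i1.
pose d := D / n%:R; pose m := z i2.
have d0 : 0 < d by rewrite divr_gt0 // ltr0n.
have [[k Hk]|H] := pselect (exists k : 'I_n, forall i, ~ (m + k%:R * d < z i /\
    z i < m + k.+1%:R * d)).
  exists [set i | m + k.+1%:R * d <= z i]%SET, (m + k%:R * d), (m + k.+1%:R * d).
  split.
  - rewrite inE -lerBrDl (le_trans _ Dz) // -ler_pdivlMr //.
    rewrite /d invf_div mulrCA divff ?gt_eqF // mulr1 ler_nat //.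
  - rewrite inE -ltNge ltrDl mulr_gt0 // ltr0n //.
  - by have -> : m + k.+1%:R * d - (m + k%:R * d) = d by rewrite -natr1; ring.
  - by move=> i; rewrite inE.
  - move=> i; rewrite inE -ltNge => hi; rewrite leNgt; apply/negP => lo.
    by apply: (Hk i).
have /choice[f Hf] : forall k : 'I_n, exists i, m + k%:R * d < z i /\ z i < m + k.+1%:R * d.
  move=> k; apply: contrapT => H'; apply: H; exists k => i hki.
  by apply: H'; exists i.
have finj : injective f.
  move=> k l E; apply: val_inj => /=; have [h1 h2] := Hf k; have [h3 h4] := Hf l.
  rewrite -E in h3 h4.
  have h5 := lt_trans h1 h4; have h6 := lt_trans h3 h2.
  rewrite ltrD2l ltr_pM2r // ltr_nat ltnS in h5.
  rewrite ltrD2l ltr_pM2r // ltr_nat ltnS in h6.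
  by apply/eqP; rewrite eqn_leq h5 h6.
have : (#|codom f| <= #|predC1 i2|)%N.
  apply/subset_leq_card/fintype.subsetP => _ /codomP[k ->]; rewrite !inE.
  apply/eqP => E; have [h1 _] := Hf k; rewrite E in h1.
  by move: h1; rewrite ltNge lerDl mulr_ge0 // ltW.
rewrite card_codom // card_ord; have := cardC1 i2.
by rewrite /predC1 => ->; rewrite -ltnS prednK // ltnn.
Qed.

End Trajectory.

(** * Consensus for a connected graph *)

Section CoreConsensus.
Context (R : realType) (I : finType) (hbar T0 C K : R).
Context (a G h : I -> I -> R -> R) (tau : nat -> R).
Implicit Types (S : {set I}) (x y : R -> I -> R) (p q : nat).
Local Notation n := #|I|.
Local Notation flow := (cut_flow G tau).
Context (rb : reciprocal_blocks hbar T0 C K a G h tau).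
Context (connected : forall S, S != finset.set0 -> S != [set: I]%SET -> forall p0 (M : R),
  exists q, M < \sum_(p0 <= p < q) (flow S p + flow (~: S) p)).
Context (x y : R -> I -> R) (M : R).
Context (bx : bounded_sub hbar T0 a h x M) (by_ : bounded_sub hbar T0 a h y M).
Context (near_opp : forall e : R, 0 < e -> exists T, forall t i, T <= t -> `|x t i + y t i| < e).
Context (tau_oo : forall A : R, exists P, forall p, (P <= p)%N -> A <= tau p).

Local Notation win := (window hbar tau).
Local Notation val := (value tau).

Let max_win (z : R -> I -> R) (i0 : I) p : exists i, forall j, win z p j <= win z p i.
Proof.
have [i _ H] := @arg_maxP _ _ I i0 predT (win z p) isT.
by exists i => j; exact: H.
Qed.

Let peak (z : R -> I -> R) p : R := sup (range (win z p)).

Let peak_has_sup z (bz : bounded_sub hbar T0 a h z M) (i0 : I) p : has_sup (range (win z p)).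
Proof.
split; first by exists (win z p i0), i0.
by exists M => _ [i _ <-]; rewrite (le_trans (ler_norm _)) // (window_bound rb _ _ bz).
Qed.

Let peak_ge z (bz : bounded_sub hbar T0 a h z M) p i : win z p i <= peak z p.
Proof. by apply: ub_le_sup; [have [] := peak_has_sup bz i p|exists i]. Qed.

Let peak_attained z (bz : bounded_sub hbar T0 a h z M) (i0 : I) p : exists i, win z p i = peak z p.
Proof.
have [i Hi] := max_win z i0 p; exists i; apply/eqP; rewrite eq_le peak_ge //=.
by apply: ge_sup; [exists (win z p i0), i0|move=> _ [j _ <-]].
Qed.

Let limit z : R := inf (range (peak z)).

Let peak_bound z (bz : bounded_sub hbar T0 a h z M) (i0 : I) p : - M <= peak z p.
Proof.
apply: le_trans (peak_ge bz p i0); have := window_bound rb p i0 bz.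
by rewrite ler_norml => /andP[].
Qed.

Let limit_has_inf z (bz : bounded_sub hbar T0 a h z M) (i0 : I) : has_inf (range (peak z)).
Proof.
split; first by exists (peak z 0%N), 0%N.
by exists (- M) => _ [p _ <-]; exact: peak_bound.
Qed.

Let limit_le z (bz : bounded_sub hbar T0 a h z M) (i0 : I) p : limit z <= peak z p.
Proof. by apply: ge_inf; [have [] := limit_has_inf bz i0|exists p]. Qed.

Let eventually_below z (bz : bounded_sub hbar T0 a h z M) (e : R) : 0 < e ->
  exists T, forall t i, T <= t -> z t i <= limit z + e.
Proof.
move=> e0; have [i0 _|I0] := pickP (predT : pred I); last first.
  by exists 0 => t i; have := I0 i.
have [_ [p _ <-] Hp] := inf_adherent e0 (limit_has_inf bz i0).
exists (tau p) => t i pt; apply: le_trans (ltW Hp).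
by apply: (cap rb bz (fun i => peak_ge bz p i)).
Qed.

(** Otherwise the values stay spread over a length d > 0.  Once the potentials of
x and y have nearly settled, windows and values agree up to e, and some gap of
length at least d / (2 n) separates a set S from its complement.  As the flow
across this cut grows the gap shrinks at most proportionally, so it is still
half open when a flow k has crossed; by then the potential of x has dropped by
more than its remaining decrease. *)
Let no_gap (i0 : I) : limit x + limit y <= 0.
Proof.
rewrite leNgt; apply/negP => d0; set d := limit x + limit y in d0.
have n0 : 0 < n%:R :> R by rewrite ltr0n; apply/card_gt0P; exists i0.
have n1 : 1 <= n%:R :> R by rewrite ler1n; apply/card_gt0P; exists i0.
have M0 : 0 <= M by apply: le_trans (value_bound rb 0 i0 bx).
have K1 := rb_K1 rb.
pose delta := d / 2 / n%:R; pose D := 2 * M + 1.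
have D0 : 0 < D by rewrite /D; lra.
have delta0 : 0 < delta by rewrite !divr_gt0.
have delta_d : delta <= d / 2 by rewrite ler_pdivrMr // ler_peMr // ltW // divr_gt0.
(* The four errors of size e between values, windows and the two trajectories
   cost delta / 4; a flow k shrinks the gap by another delta / 4 at most. *)
pose e := delta / 16; pose k := delta / (8 * D).
have e0 : 0 < e by rewrite divr_gt0.
have k0 : 0 < k by rewrite divr_gt0 // mulr_gt0.
have kap0 : 0 < kappa I C K := kappa_gt0 I C K1.
pose Delta := kappa I C K * (delta / 2 * (k / (1 + K))).
have K10 : 0 < 1 + K by lra.
have Delta0 : 0 < Delta.
  by apply: mulr_gt0 => //; apply: mulr_gt0; apply: divr_gt0.
have [Nx HNx] := potential_bounded rb bx.
have [Ny HNy] := potential_bounded rb by_.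
have eps0 : 0 < Num.min Delta (kappa I C K * e) by rewrite lt_min Delta0 mulr_gt0.
have [Px HPx] := nonincr_cauchy (fun p => potential_nonincr rb p bx) HNx eps0.
have [Py HPy] := nonincr_cauchy (fun p => potential_nonincr rb p by_) HNy eps0.
have [T HT] := near_opp e0.
have [PT HPT] := tau_oo T.
pose p0 := maxn PT (maxn Px Py).
have p0T : (PT <= p0)%N by exact: leq_maxl.
have p0x : (Px <= p0)%N by rewrite /p0 !leq_max leqnn orbT.
have p0y : (Py <= p0)%N by rewrite /p0 !leq_max leqnn !orbT.
have opp p i : (p0 <= p)%N -> `|val x p i + val y p i| < e.
  by move=> pp; apply: HT; apply: HPT; exact: leq_trans pp.
have stale_x i : win x p0 i - val x p0 i <= e.
  have h1 := potential_drop_stale rb p0 i bx.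
  have := HPx _ p0.+1 p0x (leqW p0x); rewrite lt_min => /andP[_ h2].
  by rewrite -(ler_pM2l kap0); lra.
have stale_y i : win y p0 i - val y p0 i <= e.
  have h1 := potential_drop_stale rb p0 i by_.
  have := HPy _ p0.+1 p0y (leqW p0y); rewrite lt_min => /andP[_ h2].
  by rewrite -(ler_pM2l kap0); lra.
have [i1 Hi1] := peak_attained bx i0 p0.
have [i2 Hi2] := peak_attained by_ i0 p0.
have spread : d / 2 <= val x p0 i1 - val x p0 i2.
  have h1 := limit_le bx i0 p0; have h2 := limit_le by_ i0 p0.
  have h3 := stale_x i1; have h4 := stale_y i2.
  have := opp p0 i2 (leqnn _); rewrite ltr_norml => /andP[_ h5].
  have h6 : e <= d / 32 by rewrite /e; lra.
  rewrite Hi1 in h3; rewrite Hi2 in h4; rewrite /d in h6 *; lra.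
have d20 : 0 < d / 2 by rewrite divr_gt0.
have [S [lo [hi [i1S i2S gap Hhi Hlo]]]] := gap_exists d20 spread.
have S0 : S != finset.set0 by apply/set0Pn; exists i1.
have ST : S != [set: I]%SET by apply: contraNneq i2S => ->; rewrite finset.in_setT.
pose cum q := \sum_(p0 <= p < q) (flow S p + flow (~: S) p).
have flow0 A p : 0 <= flow A p := cut_flow_ge0 rb A p.
have cumS q : (p0 <= q)%N -> cum q.+1 = cum q + (flow S q + flow (~: S) q).
  by move=> pq; rewrite /cum big_nat_recr.
have cum0 : cum p0 = 0 by rewrite /cum big_geq.
(* When the bound exceeds M, it holds because all windows are below M. *)
have spread_step (z : R -> I -> R) (A : {set I}) (l c' f' : R) q : bounded_sub hbar T0 a h z M ->
    0 <= f' -> (forall i, i \notin A -> - M <= l) ->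
    (forall i, i \notin A -> win z q i <= l + D * c') -> 0 <= c' ->
    (forall i, i \notin A -> win z q.+1 i <= l + D * (c' + (flow A q + f'))).
  move=> bz f'0 lM H c'0 i iA.
  have [h1|h1] := leP (l + D * c') M; last first.
    have h2 : D * (flow A q + f') >= 0 by rewrite mulr_ge0 ?(ltW D0) // addr_ge0.
    have : win z q.+1 i <= M by rewrite (le_trans (ler_norm _)) // (window_bound rb _ _ bz).
    lra.
  have bz' j : win z q j <= M by rewrite (le_trans (ler_norm _)) // (window_bound rb _ _ bz).
  have h3 := window_spread rb bz h1 bz' H iA.
  have h4 : (M - (l + D * c')) * flow A q <= D * flow A q.
    rewrite ler_wpM2r //; have := lM i iA; have : 0 <= D * c' by rewrite mulr_ge0 // ltW.
    by have DE : D = 2 * M + 1 by []; lra.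
  have : 0 <= D * f' by rewrite mulr_ge0 // ltW.
  lra.
have cum_ge0 q : 0 <= cum q by apply: sumr_ge0 => p _; rewrite addr_ge0.
have low q : (p0 <= q)%N -> forall i, i \notin S -> win x q i <= (lo + e) + D * cum q.
  elim: q => [|q IH].
    by rewrite leqn0 => /eqP E i iS; rewrite -E cum0 mulr0 addr0; have := stale_x i;
        have := Hlo i iS; lra.
  rewrite leq_eqVlt => /predU1P[E|pq] i iS.
    by rewrite -E cum0 mulr0 addr0; have := stale_x i; have := Hlo i iS; lra.
  rewrite cumS //; apply: (spread_step x S (lo + e) (cum q) _ q bx) => // [j jS|];
      last exact: (IH pq).
  have := Hlo j jS; have := value_bound rb p0 j bx; rewrite ler_norml => /andP[+ _].
  by lra.
pose e2 := 2 * e; have e2E : e2 = 2 * e by [].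
have high q : (p0 <= q)%N -> forall i, i \notin ~: S -> win y q i <= (- hi + e2) + D * cum q.
  have base i : i \notin ~: S -> win y p0 i <= - hi + e2.
    rewrite inE negbK => iS; have := stale_y i; have := Hhi i iS.
    by have := opp p0 i (leqnn _); rewrite ltr_norml => /andP[_]; lra.
  elim: q => [|q IH].
    by rewrite leqn0 => /eqP E i iS; rewrite -E cum0 mulr0 addr0; exact: base.
  rewrite leq_eqVlt => /predU1P[E|pq] i iS; first by rewrite -E cum0 mulr0 addr0; exact: base.
  rewrite cumS // [flow S q + _]addrC.
  apply: (spread_step y (~: S) (- hi + e2) (cum q) _ q by_) => // [j|]; last exact: (IH pq).
  rewrite inE negbK => jS; have := Hhi j jS; have := value_bound rb p0 j by_.
  have := opp p0 j (leqnn _); rewrite ltr_norml => /andP[h3 h4]; rewrite ler_norml => /andP[h5 h6].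
  lra.
have sep q : (p0 <= q)%N -> cum q <= k ->
    potential hbar C K tau x q.+1 <= potential hbar C K tau x q - kappa I C K * (delta / 2 *
        flow S q).
  move=> pq ck.
  have Dk : D * cum q <= delta / 8.
    have := ler_wpM2l (ltW D0) ck; rewrite /k.
    by have -> : D * (delta / (8 * D)) = delta / 8 by field; rewrite gt_eqF.
  pose lo' := lo + e + D * cum q; pose hi' := hi - 3 * e - D * cum q.
  have gap' : delta / 2 <= hi' - lo'.
    by rewrite /hi' /lo' /e; move: gap; rewrite -/delta => gap; lra.
  have lohi : lo' <= hi' by rewrite -subr_ge0 (le_trans _ gap') // divr_ge0 // ltW.
  have Hhi' i : i \in S -> hi' <= val x q i.
    move=> iS; have iS' : i \notin ~: S by rewrite inE negbK.
    have h1 := high q pq i iS'; have h2 := value_le_window rb q i by_.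
    have := opp q i pq; rewrite ltr_norml => /andP[h3 h4].
    by rewrite /hi'; lra.
  apply: le_trans (potential_drop_cut rb bx lohi Hhi' (low q pq)) _.
  by rewrite lerD2l lerN2 ler_pM2l // ler_wpM2r.
(* q1 is the first block at which the flow exceeds k: until then the gap stays
   at least delta / 2, and the flow into the complement of S up to q1 is at
   least k / (1 + K). *)
have [q Hq] := connected S0 ST p0 k; rewrite -/(cum q) in Hq.
have exq : exists q, k < cum q by exists q.
pose q1 := ex_minn exq.
have [Hq1 minq1] : k < cum q1 /\ forall q, (q < q1)%N -> cum q <= k.
  rewrite /q1; case: ex_minnP => m Hm mm; split => // q' lt; rewrite leNgt.
  by apply/negP => /mm; rewrite leqNgt lt.
have p0q1 : (p0 <= q1)%N.
  rewrite leqNgt; apply/negP => lt; move: Hq1; rewrite /cum big_geq 1?ltnW //.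
  by rewrite ltNge ltW.
have total q' : (p0 <= q')%N -> (q' <= q1)%N ->
    potential hbar C K tau x q' <= potential hbar C K tau x p0 -
      kappa I C K * (delta / 2 * \sum_(p0 <= p < q') flow S p).
  elim: q' => [|q' IH].
    by rewrite leqn0 => /eqP -> _; rewrite big_geq // !mulr0 subr0.
  rewrite leq_eqVlt => /predU1P[<- _|pq qq]; first by rewrite big_geq // !mulr0 subr0.
  have h1 := sep q' pq (minq1 q' qq); have h2 := IH pq (ltnW qq).
  by rewrite big_nat_recr //=; lra.
have h1 := total q1 p0q1 (leqnn _).
have h2 : k / (1 + K) <= \sum_(p0 <= p < q1) flow S p.
  rewrite ler_pdivrMr // (le_trans (ltW Hq1)) // /cum mulrC big_distrr /= ler_sum // => p _.
  by rewrite mulrDl mul1r lerD2l (cut_flowC rb).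
have := HPx p0 q1 p0x (leq_trans p0x p0q1); rewrite lt_min => /andP[+ _].
rewrite ltNge => /negP; apply.
have h3 : Delta <= kappa I C K * (delta / 2 * \sum_(p0 <= p < q1) flow S p).
  by rewrite /Delta ler_pM2l // ler_pM2l // divr_gt0.
lra.
Qed.

(** The values of x are eventually below limit x and those of y, which is
asymptotically the opposite of x, below limit y; no_gap closes the gap. *)
Lemma core_consensus : exists l : R, forall i, x t i @[t --> +oo] --> l.
Proof.
exists (limit x) => i; apply/cvgrPdist_le => e e0.
have e30 : 0 < e / 3 by rewrite divr_gt0.
have [T1 H1] := eventually_below bx e30; have [T2 H2] := eventually_below by_ e30.
have [T3 H3] := near_opp e30.
have lim0 := no_gap i.
exists (Num.max T1 (Num.max T2 T3)); split; first exact: num_real.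
move=> t; rewrite !gt_max => /andP[/ltW t1 /andP[/ltW t2 /ltW t3]].
have := H3 t i t3; rewrite ltr_norml => /andP[h3 h4].
have h1 := H1 t i t1; have h2 := H2 t i t2.
by rewrite ler_norml; apply/andP; split; lra.
Qed.

End CoreConsensus.

(** * Primitives of nonnegative locally summable functions *)

Section Primitives.
Context (R : realType).
Local Notation mu := (@lebesgue_measure R).
Local Notation leb := (@completed_lebesgue_measure R).

Definition borel (f : R -> R) :=
  @measurable_fun _ _ (measurableTypeR R) (measurableTypeR R) setT f.

Lemma lebesgue_measurable_borel_null (A : set (lebesgueType R)) : measurable A ->
  exists2 B : set (measurableTypeR R), measurable B &
    exists2 N, mu.-negligible N & B `|` N = A.
Proof.
rewrite /measurable /=.
have := @completed_caratheodory_measurable R; rewrite g_sigma_completed_algebra_genE => E.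
by move=> mA; have : completed_algebra_gen mu A by rewrite E.
Qed.

Lemma id_measurable : @measurable_fun _ _ (lebesgueType R) (measurableTypeR R) setT id.
Proof. by move=> _ A mA; rewrite setTI; exact: sub_caratheodory. Qed.

Lemma borel_lebesgue (f : R -> R) : borel f -> lebesgue_measurable_fun setT f.
Proof. by move=> bf; apply: (measurableT_comp bf); exact: id_measurable. Qed.

(** Each of the countably many sets where f exceeds a rational number is a Borel
set up to a null set.  Replacing f by 0 on a Borel null set that contains all
these null sets makes it Borel. *)
Lemma borel_version (f : R -> R) : lebesgue_measurable_fun setT f ->
  exists g : R -> R, [/\ borel g, {ae mu, forall t, f t = g t}
    & forall t, g t = f t \/ g t = 0].
Proof.
move=> mf; pose r n : R := if unpickle n is Some q then ratr (q : rat) else 0.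
have rP x y : x < y -> exists2 n, x < r n & r n < y.
  move=> xy; have [q] := rat_in_itvoo xy; rewrite in_itv /= => /andP[h1 h2].
  by exists (pickle q); rewrite /r pickleK.
have gt_meas y : @measurable _ (lebesgueType R) [set t | y < f t].
  rewrite (_ : [set t | _] = setT `&` f @^-1` `]y, +oo[%classic).
    by apply: mf => //; exact: measurable_itv.
  by rewrite setTI; apply/seteqP; split => t /=; rewrite in_itv /= andbT.
have /choice[B HB] : forall n, exists B : set (measurableTypeR R), measurable B /\
    exists2 N, mu.-negligible N & B `|` N = [set t | r n < f t].
  by move=> n; have [B mB HN] := lebesgue_measurable_borel_null (gt_meas (r n)); exists B.
have /choice[N HN] : forall n, exists N : set R, mu.-negligible N /\
    B n `|` N = [set t | r n < f t].
  by move=> n; have [_ [N ? ?]] := HB n; exists N.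
have [Z [mZ Z0 NZ]] : mu.-negligible (\bigcup_n N n).
  by apply: negligible_bigcup => n; have [] := HN n.
pose g t := if t \in Z then 0 else f t.
exists g; split.
- rewrite /borel; apply: (@measurability _ _ (measurableTypeR R) (measurableTypeR R) setT g
    (@RGenOInfty.G R)).
    exact: RGenOInfty.measurableE.
  move=> _ [_ [y ->] <-]; rewrite setTI.
  have -> : g @^-1` `]y, +oo[%classic =
      (\bigcup_n (if y < r n then B n `\` Z else set0)) `|` (if y < 0 then Z else set0).
    apply/seteqP; split => t /=.
      rewrite in_itv /= andbT /g; case: ifPn => tZ yt.
        by right; rewrite yt; rewrite inE in tZ.
      rewrite notin_setE in tZ; left; have [n yr rt] := rP _ _ yt.
      exists n => //; rewrite yr; split => //.
      have [_ E] := HN n; have : (B n `|` N n) t by rewrite E.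
      by case=> // Nt; exfalso; apply: tZ; apply: NZ; exists n.
    rewrite in_itv /= andbT => -[[n _]|]; last first.
      by case: ifP => // y0 Zt; rewrite /g mem_set.
    case: ifP => // yr [Bt nZ]; rewrite /g memNset //.
    have [_ E] := HN n; have : [set t | r n < f t] t by rewrite -E; left.
    exact: lt_trans.
  apply: measurableU; last by case: ifP.
  apply: bigcupT_measurable => n; case: ifP => // _; apply: measurableD => //.
  by have [] := HB n.
- exists Z; split => // t /= h; apply: contrapT => nZ; apply: h.
  by rewrite /g memNset.
- by move=> t; rewrite /g; case: ifP => _; [right|left].
Qed.

Lemma integral_borel (g : R -> R) (D : set R) : borel g -> (forall t, 0 <= g t) ->
  @measurable _ (measurableTypeR R) D ->
  (\int[leb]_(t in D) (g t)%:E = \int[mu]_(t in D) (g t)%:E)%E.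
Proof.
move=> bg g0 mD.
have mg : @measurable_fun _ _ (measurableTypeR R) _ D (EFin \o g).
  by apply/measurable_EFinP; exact: measurable_funTS.
have := ge0_integral_pushforward id_measurable leb mD mg (fun t _ => g0 t).
rewrite preimage_id => <-.
by apply: eq_measure_integral => [|A mA _ //]; exact: id_measurable.
Qed.

Definition primitive (f : R -> R) (t : R) : R := fine (\int[leb]_(s in `[0%R, t]) (f s)%:E)%E.

Lemma acd_near b c (F1 F2 df : R -> R) : (forall t, b <= t -> t <= c -> F1 t = F2 t) ->
  acd b c F1 df -> acd b c F2 df.
Proof.
move=> E [ac1 ae1]; split.
  apply: (@ac_lip _ _ _ _ F1 F1 1) => // u v bu uv vc.
  rewrite -!E //; try by [exact: le_trans uv _|exact: le_trans bu _].
  by rewrite mul1r lerDl.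
apply: aeW ae1 => t H bt tc; apply: near_eq_is_derive (H bt tc).
near=> s; apply: E.
  by near: s; exact: lt_le_nbhsr.
by near: s; exact: lt_le_nbhsl.
Unshelve. all: by end_near. Qed.

Lemma primitive_acd_borel (g : R -> R) T : borel g -> (forall t, 0 <= g t) ->
  mu.-integrable setT (EFin \o g) ->
  acd 0 T (fun t => fine (\int[mu]_(s in `[0%R, t]) (g s)%:E)%E) g.
Proof.
move=> bg g0 ig.
have mgD D : @measurable_fun _ _ (measurableTypeR R) _ D (EFin \o g).
  by apply/measurable_EFinP; exact: measurable_funTS.
pose P t := (\int[mu]_(s in `[0%R, t]) (g s)%:E)%E.
have int_fin D : measurable D -> (\int[mu]_(s in D) (g s)%:E)%E \is a fin_num.
  by move=> mD; apply: integrable_fin_num => //; apply: integrableS ig.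
have Padd u v : 0 <= u -> u <= v -> fine (P v) - fine (P u) =
    fine (\int[mu]_(s in `]u, v[) (g s)%:E)%E.
  move=> u0 uv; have -> : P v = (P u + \int[mu]_(s in `]u, v[) (g s)%:E)%E.
    rewrite /P (@itv_bndbnd_setU _ _ _ (BRight u)) ?bnd_simp //=.
    rewrite ge0_integral_setU //=; first last.
    - apply/disj_setPS => s [/=]; rewrite !in_itv /= => /andP[_ h1] /andP[h2 _].
      by move: h2; rewrite ltNge h1.
    - by move=> s _; rewrite lee_fin.
    by congr (_ + _)%E; rewrite integral_itv_bndo_bndc //; exact: mgD.
  by rewrite fineD ?int_fin // addrAC subrr add0r.
split.
  move=> e e0; have [d [d0 Hd]] := integral_normr_continuous ig e0.
  exists d => // n u v uv tI sum_d.
  pose A := \big[setU/set0]_(k <- enum 'I_n) `]u k, v k[%classic.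
  have mA : measurable A by apply: bigsetU_measurable => k _; exact: measurable_itv.
  have tI' : trivIset [set` enum 'I_n] (fun k => `]u k, v k[%classic).
    by apply: sub_trivIset tI.
  have muA : (mu A < d%:E)%E.
    have -> : mu A = (\sum_(k < n) (v k - u k))%:E; last by rewrite lte_fin.
    rewrite /A big_enum /= (@measure_bigsetU_ord _ _ _ mu n xpredT (fun k => `]u k, v
        k[%classic)) //.
    rewrite -sumEFin; apply: eq_bigr => k _; rewrite /= lebesgue_measure_itv /= lte_fin.
    have [_ [uv1 _]] := uv k.
    by move: uv1; rewrite le_eqVlt => /predU1P[->|->]; rewrite ?subrr ?ltxx ?EFinB.
  have := Hd A mA muA; rewrite /Rintegral.
  under eq_integral do rewrite ger0_norm //.
  rewrite (@ge0_integral_bigsetU _ _ _ mu _ (fun k : 'I_n => `]u k, v k[%classic)) ?enum_uniq //.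
    move=> h; apply: le_lt_trans h; rewrite big_enum /=.
    rewrite -[leLHS]/(fine (\sum_(k < n) `|fine (P (v k)) - fine (P (u k))|)%:E).
    rewrite -sumEFin le_eqVlt; apply/orP; left; apply/eqP; congr fine.
    apply: eq_bigr => k _; have [u0 [uv1 _]] := uv k.
    rewrite Padd // ger0_norm ?fineK ?int_fin //.
    by apply: fine_ge0; apply: integral_ge0 => s _; rewrite lee_fin.
  by move=> s _; rewrite lee_fin.
have locg : locally_integrable setT g by apply: open_integrable_locally => //; exact: openT.
have igy y : mu.-integrable [set` Interval (BLeft 0%R) (BRight y)] (EFin \o g).
  by apply: integrableS ig => //; exact: measurable_itv.
have := @FTC1 R g (BLeft 0) igy locg.
move=> /ae_completed; apply: aeW => t H t0 tT.
have [|dF FE] := H; first by rewrite lte_fin.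
by apply: DeriveDef; [exact: dF|rewrite -derive1E].
Qed.

Lemma borel_representative (f : R -> R) T : (forall t, 0 <= t -> 0 <= f t) ->
  leb.-integrable `[0, T] (fun t : lebesgueType R => (f t)%:E) ->
  exists g : R -> R, [/\ borel g, (forall t, 0 <= g t), mu.-integrable setT (EFin \o g),
    {ae mu, forall t, 0 <= t -> t <= T -> f t = g t} &
    forall D, @measurable _ (measurableTypeR R) D -> D `<=` `[0, T] ->
      (\int[leb]_(s in D) (f s)%:E = \int[mu]_(s in D) (g s)%:E)%E].
Proof.
move=> f0 intf.
have mI u : @measurable _ (lebesgueType R) `[0, u]%classic by apply: sub_caratheodory;
    exact: measurable_itv.
have mf : lebesgue_measurable_fun setT (f \_ `[0, T]).
  apply: (iffLR (measurable_restrictT _ (mI T))).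
  by apply/measurable_EFinP; have /integrableP[] := intf.
have [g [bg aeg gE]] := borel_version mf.
have g0 t : 0 <= g t.
  have [->|->//] := gE t; rewrite patchE; case: ifPn => //.
  by rewrite inE /= in_itv /= => /andP[t0 _]; exact: f0.
have eqI D : @measurable _ (measurableTypeR R) D -> D `<=` `[0, T] ->
      (\int[leb]_(s in D) (f s)%:E = \int[mu]_(s in D) (g s)%:E)%E.
  move=> mD sub; rewrite -integral_borel //.
  apply: ge0_ae_eq_integral.
  - exact: sub_caratheodory.
  - by apply: (measurable_funS (mI T) sub); have /integrableP[] := intf.
  - apply/measurable_EFinP; apply: measurable_funTS; exact: borel_lebesgue.
  - by move=> s /sub /=; rewrite in_itv /= => /andP[s0 _]; rewrite lee_fin f0.
  - by move=> s _; rewrite lee_fin.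
  - move/ae_completed : aeg; apply: aeW => s E sI; congr EFin; rewrite -E patchE mem_set //.
    exact: sub.
have intg : mu.-integrable setT (EFin \o g).
  apply/integrableP; split; first by apply/measurable_EFinP.
  under eq_integral do rewrite /= ger0_norm //.
  rewrite -integral_borel //.
  rewrite (@ge0_ae_eq_integral _ _ _ leb setT _ (fun s => (f \_ `[0, T] s)%:E)) //.
  - have -> : (fun s => (f \_ `[0, T] s)%:E) = (EFin \o f) \_ `[0, T].
      by apply/funext => s; rewrite !patchE; case: ifP.
    rewrite -integral_mkcond.
    have /integrableP[_] := intf; apply: le_lt_trans; rewrite le_eqVlt; apply/orP; left; apply/eqP.
    apply: eq_integral => s; rewrite inE /= in_itv /= => /andP[s0 _].
    by rewrite ger0_norm // f0.
  - by apply/measurable_EFinP; exact: borel_lebesgue.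
  - by apply/measurable_EFinP.
  - by move=> s _; rewrite lee_fin.
  - move=> s _; rewrite lee_fin patchE; case: ifPn => //.
    by rewrite inE /= in_itv /= => /andP[s0 _]; exact: f0.
  - by move/ae_completed : aeg; apply: aeW => s -> _.
exists g; split => //.
apply/ae_completed; move/ae_completed : aeg; apply: aeW => t E t0 tT.
by rewrite -E patchE mem_set //= in_itv /= t0.
Qed.

(** Lebesgue differentiation and the absolute continuity of the integral hold for
a Borel representative of f, which has the same primitive. *)
Lemma primitive_acd (f : R -> R) T : (forall t, 0 <= t -> 0 <= f t) ->
  leb.-integrable `[0, T] (fun t : lebesgueType R => (f t)%:E) ->
  acd 0 T (primitive f) f.
Proof.
move=> f0 intf; have [g [bg g0 intg aeg eqI]] := borel_representative f0 intf.
have H : acd 0 T (primitive f) g.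
  apply: acd_near (primitive_acd_borel T bg g0 intg) => t _ tT.
  rewrite /primitive eqI //.
  by move=> s /=; rewrite !in_itv /= => /andP[-> h]; exact: le_trans tT.
split; first exact: (proj1 H).
move/ae_completed : aeg => aeg; apply: aeW2 aeg (proj2 H) => t E D t0 tT.
by rewrite E ?ltW //; exact: D.
Qed.

Section LocallySummable.
Context (f : R -> R) (f_ge0 : forall t, 0 <= t -> 0 <= f t) (f_loc : locally_summable f).

Lemma integral_primitive b c : 0 <= b -> b <= c ->
  (\int[leb]_(s in `[b, c]) (f s)%:E = (primitive f c - primitive f b)%:E)%E.
Proof.
move=> b0 bc; have [g [bg g0 intg _ eqI]] := borel_representative f_ge0 (f_loc c).
have mgD D : @measurable_fun _ _ (measurableTypeR R) _ D (EFin \o g).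
  by apply/measurable_EFinP; exact: measurable_funTS.
have sub0 u : u <= c -> `[0, u]%classic `<=` `[0, c]%classic.
  by move=> uc s /=; rewrite !in_itv /= => /andP[-> h]; exact: le_trans uc.
have fin D : @measurable _ (measurableTypeR R) D -> (\int[mu]_(s in D) (g s)%:E)%E \is a fin_num.
  by move=> mD; apply: integrable_fin_num => //; apply: integrableS intg.
have sub1 : `[b, c]%classic `<=` `[0, c]%classic.
  by move=> s /=; rewrite !in_itv /= => /andP[h ->]; rewrite (le_trans b0).
rewrite /primitive (eqI _ (measurable_itv _) (sub0 _ bc)) (eqI _ (measurable_itv _) sub1).
rewrite (eqI _ (measurable_itv _) (sub0 _ (lexx c))).
have -> : (\int[mu]_(s in `[0%R, c]) (g s)%:E =
    \int[mu]_(s in `[0%R, b]) (g s)%:E + \int[mu]_(s in `[b, c]) (g s)%:E)%E.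
  rewrite (@itv_bndbnd_setU _ _ _ (BLeft b)) ?bnd_simp //=.
  rewrite ge0_integral_setU //=; first last.
  - apply/disj_setPS => s [/=]; rewrite !in_itv /= => /andP[_ h1] /andP[h2 _].
    by move: h1; rewrite ltNge h2.
  - by move=> s _; rewrite lee_fin.
  by rewrite integral_itv_bndo_bndc //; exact: mgD.
by rewrite fineD ?fin // addrAC subrr add0r fineK ?fin.
Qed.

Lemma primitive_le s t : 0 <= s -> s <= t -> primitive f s <= primitive f t.
Proof.
move=> s0 st; rewrite -subr_ge0 -lee_fin -integral_primitive //.
apply: integral_ge0 => r /=; rewrite in_itv /= => /andP[sr _].
by rewrite lee_fin f_ge0 // (le_trans s0).
Qed.

Lemma primitive0 : primitive f 0 = 0.
Proof. by rewrite {1}/primitive integral_primitive //= subrr. Qed.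

Lemma primitive_unbounded :
  (\int[leb]_(t in `[0%R, +oo[) (f t)%:E = +oo)%E <->
  (forall M : R, exists2 t, 0 <= t & M < primitive f t).
Proof.
have mItv D : @measurable _ (measurableTypeR R) D -> @measurable _ (lebesgueType R) D.
  exact: sub_caratheodory.
have E0 t : 0 <= t -> (\int[leb]_(s in `[0%R, t]) (f s)%:E = (primitive f t)%:E)%E.
  by move=> t0; rewrite integral_primitive // primitive0 subr0.
pose F (n : nat) := `[0%R, n%:R]%classic : set (lebesgueType R).
have mF n : measurable (F n) by apply: mItv; exact: measurable_itv.
have F_bigcup : \bigcup_n F n = `[0%R, +oo[%classic.
  apply/seteqP; split => t /=.
    by move=> [n _]; rewrite /F /= !in_itv /= andbT => /andP[].
  rewrite in_itv /= andbT => t0; exists (Num.truncn t).+1 => //.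
  by rewrite /F /= in_itv /= t0 ltW // truncnS_gt.
have mfF n : measurable_fun (F n) (fun t : lebesgueType R => (f t)%:E).
  by have /integrableP[] := f_loc n%:R.
have f0' : forall t, `[0%R, +oo[%classic t -> (0 <= (f t)%:E)%E.
  by move=> t /=; rewrite in_itv /= andbT => t0; rewrite lee_fin f_ge0.
have mf : measurable_fun (`[0%R, +oo[%classic : set (lebesgueType R)) (fun t :
    lebesgueType R => (f t)%:E).
  by rewrite -F_bigcup; apply/measurable_fun_bigcup.
split=> [foo M|H].
  apply: contrapT => H.
  have HM t : 0 <= t -> primitive f t <= M.
    by move=> t0; rewrite leNgt; apply/negP => h; apply: H; exists t.
  have : (\int[leb]_(t in `[0%R, +oo[) (f t)%:E <= M%:E)%E; last by rewrite foo leNgt ltry.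
  rewrite -F_bigcup.
  have ndF : nondecreasing_seq F.
    move=> m n mn; rewrite subsetEset => t; rewrite /F /= !in_itv /= => /andP[-> h].
    by rewrite (le_trans h) // ler_nat.
  have F0 n t : F n t -> (0 <= (f t)%:E)%E.
    by move=> Ft; apply: f0'; rewrite -F_bigcup; exists n.
  have cv := @ge0_nondecreasing_set_cvg_integral _ _ _ F (fun t => (f t)%:E) leb ndF mF mfF F0.
  apply: cvge_le cv; near=> n; rewrite /F E0 // lee_fin HM //.
apply/eqP; rewrite -leye_eq leNgt; apply/negP => lt.
have fin : (\int[leb]_(t in `[0%R, +oo[) (f t)%:E)%E \is a fin_num.
  by rewrite ge0_fin_numE // integral_ge0.
have [t t0] := H (fine (\int[leb]_(t in `[0%R, +oo[) (f t)%:E)%E).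
rewrite -lte_fin (fineK fin) ltNge => /negP; apply; rewrite -(E0 t t0).
apply: ge0_subset_integral => //; first by apply: mItv; exact: measurable_itv.
- by apply: mItv; exact: measurable_itv.
- by move=> s /=; rewrite !in_itv /= andbT => /andP[].
Unshelve. all: by end_near. Qed.

End LocallySummable.
End Primitives.

(** * Blocks of intervals and limits of solutions *)

Section MergeIntervals.
Context (R : realType) (V : finType) (G : V -> V -> R -> R) (t : nat -> R) (hbar K C0 C1 : R).
Context (G_le : forall i j s s', 0 <= s -> s <= s' -> G i j s <= G i j s').
Context (t_ge0 : forall p, 0 <= t p).
Context (t_oo : forall A : R, exists P, forall p, (P <= p)%N -> A <= t p).
Context (recip : forall p i j,
  G i j (t p.+1) - G i j (t p) <= K * (G j i (t p.+1) - G j i (t p))).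
Context (bound0 : forall p i j, G i j (t p.+1) - G i j (t p) <= C0).
Context (bound1 : forall s i j, 0 <= s -> G i j (s + (hbar + 1)) - G i j s <= C1).

Lemma recip_long i j p q : (p <= q)%N ->
  G i j (t q) - G i j (t p) <= K * (G j i (t q) - G j i (t p)).
Proof.
elim: q => [|q IH]; first by rewrite leqn0 => /eqP ->; rewrite !subrr mulr0.
rewrite leq_eqVlt => /predU1P[->|pq]; first by rewrite !subrr mulr0.
by have := IH pq; have := recip q i j; lra.
Qed.

Let next_ex p : exists q, (p < q)%N && (t p + hbar <= t q).
Proof.
have [P HP] := t_oo (t p + hbar); exists (maxn P p.+1); rewrite leq_maxr HP //.
exact: leq_maxl.
Qed.

Let next p := ex_minn (next_ex p).

(** A block ends at the first t q at distance at least hbar from its start.  All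
its intervals but the last one then span less than hbar + 1, and are controlled
by C1; the last one is controlled by C0. *)
Lemma merge_intervals (T1 : R) : 0 <= hbar -> 0 <= C0 -> 0 <= C1 -> exists tau : nat -> R,
  [/\ forall p, T1 <= tau p, forall p, tau p + hbar <= tau p.+1,
      forall p i j, G i j (tau p.+1) - G i j (tau p) <= C0 + C1,
      forall p i j, G i j (tau p.+1) - G i j (tau p) <= K * (G j i (tau p.+1) - G j i (tau p))
    & forall A : R, exists P, forall p, (P <= p)%N -> A <= tau p].
Proof.
move=> hb0 C00 C10; have [n0 Hn0] := t_oo T1.
pose idx k := iter k next n0.
have nextP p : (p < next p)%N /\ t p + hbar <= t (next p).
  by rewrite /next; case: ex_minnP => m /andP[].
have idx_ge k : (n0 + k <= idx k)%N.
  elim: k => [|k IH]; first by rewrite addn0.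
  by rewrite addnS (leq_ltn_trans IH) //; have [] := nextP (idx k).
exists (fun k => t (idx k)); split.
- by move=> p; apply: Hn0; rewrite (leq_trans _ (idx_ge p)) // leq_addr.
- by move=> p; have [] := nextP (idx p).
- move=> p i j; rewrite -/(idx p) /=; set n := idx p.
  rewrite /next; case: ex_minnP => m /andP[nm _] minm.
  case: m nm minm => // m; rewrite ltnS => nm minm.
  have h1 := bound0 m i j.
  have h2 : G i j (t m) - G i j (t n) <= C1.
    move: nm; rewrite leq_eqVlt => /predU1P[<-|nm]; first by rewrite subrr.
    have tm : t m < t n + hbar.
      rewrite ltNge; apply/negP => h; have := minm m; rewrite nm h => /(_ isT).
      by rewrite ltnn.
    apply: le_trans (bound1 i j (t_ge0 n)); rewrite lerD2r; apply: G_le => //; lra.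
  lra.
- by move=> p i j; apply: recip_long; rewrite ltnW //; have [] := nextP (idx p).
- move=> A; have [P HP] := t_oo A; exists P => p Pp; apply: HP.
  by rewrite (leq_trans Pp) // (leq_trans _ (idx_ge p)) // leq_addl.
Qed.

End MergeIntervals.

Lemma ereal_sup_bound (R : realType) (S : set (\bar R)) : (ereal_sup S < +oo)%E ->
  exists2 C : R, 0 <= C & forall y, S y -> (y <= C%:E)%E.
Proof.
move=> fS; exists (Num.max 0 (fine (ereal_sup S))); first by rewrite le_max lexx.
move=> y Sy; apply: (le_trans (ereal_sup_ubound Sy)).
move: fS; case: (ereal_sup S) => [r _|//|_]; last exact: leNye.
by rewrite lee_fin le_max lexx orbT.
Qed.

Section Solutions.
Context (R : realType) (V : finType) (hbar : R) (a h : V -> V -> R -> R).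
Context (hbar_ge0 : 0 <= hbar)
  (a_ge0 : forall (i j : V) (t : R), 0 <= t -> 0 <= a i j t)
  (a_loc : forall i j : V, locally_summable (a i j))
  (h_bnd : forall (i j : V) (t : R), 0 <= t -> 0 <= h i j t <= hbar)
  (a_nits : NITS a) (a_unif : uniformly_summable a).
Local Notation leb := (@completed_lebesgue_measure R).
Local Notation e := (persistent_graph a).

(** With a zero diagonal, the sums over the other agents become sums over all
agents. *)
Definition arc_rate (i j : V) (t : R) : R := if i == j then 0 else a i j t.
Definition arc_mass (i j : V) (t : R) : R := if i == j then 0 else primitive (a i j) t.

Lemma rate_ge0 i j t : 0 <= t -> 0 <= arc_rate i j t.
Proof. by move=> t0; rewrite /arc_rate; case: ifP => // _; exact: a_ge0. Qed.

Lemma mass_acd b c i j : 0 <= b -> acd b c (arc_mass i j) (arc_rate i j).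
Proof.
move=> b0; apply: (acd_restrict b0 (lexx c)); rewrite /arc_mass /arc_rate.
case: (i == j); first exact: acd_cst.
by apply: primitive_acd; [exact: a_ge0|exact: a_loc].
Qed.

Lemma mass_le i j s t : 0 <= s -> s <= t -> arc_mass i j s <= arc_mass i j t.
Proof.
move=> s0 st; rewrite /arc_mass; case: ifP => // _.
by apply: primitive_le => // u u0; exact: a_ge0.
Qed.

Lemma integral_weightE i j b c : i != j -> 0 <= b -> b <= c ->
  integral_weight a i j b c = (arc_mass i j c - arc_mass i j b)%:E.
Proof.
move=> ij b0 bc; rewrite /arc_mass (negbTE ij).
by apply: integral_primitive => // u u0; exact: a_ge0.
Qed.

Lemma persistentE i j : i != j ->
  e j i = `[< forall M : R, exists2 t, 0 <= t & M < arc_mass i j t >].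
Proof.
move=> ij; rewrite /arc_mass (negbTE ij); apply: asbool_equiv_eq.
by apply: primitive_unbounded; [exact: a_ge0|exact: a_loc].
Qed.

Lemma nits_real : exists (t : nat -> R) (K C : R),
  [/\ forall p, 0 <= t p, {homo t : p q / (p <= q)%N >-> p <= q},
   forall A : R, exists P, forall p, (P <= p)%N -> A <= t p,
   0 <= C /\ 1 <= K &
   (forall p i j, arc_mass i j (t p.+1) - arc_mass i j (t p) <=
       K * (arc_mass j i (t p.+1) - arc_mass j i (t p))) /\
   (forall p i j, arc_mass i j (t p.+1) - arc_mass i j (t p) <= C)].
Proof.
have [t [K [t0 ti too K1 [sym bnd]]]] := a_nits.
have tle : {homo t : p q / (p <= q)%N >-> p <= q} by move=> p q pq; rewrite ti.
have [C C0 HC] := ereal_sup_bound bnd.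
have tt p : t p <= t p.+1 by exact: tle.
exists t, K, C; split => //.
- move=> A; have /cvgryPge /(_ A) [P _ HP] := too.
  by exists P => p Pp; exact: HP.
- split=> p i j; case: (eqVneq i j) => [->|ij].
  + by rewrite /arc_mass eqxx subrr mulr0.
  + have [_] := sym i j p; rewrite !integral_weightE ?t0 //; last by rewrite eq_sym.
  + by rewrite /arc_mass eqxx subrr.
  + by rewrite -lee_fin -integral_weightE ?t0 //; apply: HC; exists p, i, j.
Qed.

Lemma blocks T1 : exists (tau : nat -> R) (K C : R),
  [/\ forall p, T1 <= tau p, forall p, tau p + hbar <= tau p.+1,
      forall A : R, exists P, forall p, (P <= p)%N -> A <= tau p,
      0 <= C /\ 1 <= K &
   (forall p i j, arc_mass i j (tau p.+1) - arc_mass i j (tau p) <=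
       K * (arc_mass j i (tau p.+1) - arc_mass j i (tau p))) /\
   (forall p i j, arc_mass i j (tau p.+1) - arc_mass i j (tau p) <= C)].
Proof.
have [t [K [C [t0 tle too [C0 K1] [rec bnd]]]]] := nits_real.
have hb1 : 0 < hbar + 1 by rewrite ltr_wpDl.
have [C1 C10 HC1] := ereal_sup_bound (a_unif hb1).
have b1 s i j : 0 <= s -> arc_mass i j (s + (hbar + 1)) - arc_mass i j s <= C1.
  move=> s0; case: (eqVneq i j) => [->|ij]; first by rewrite /arc_mass eqxx subrr.
  have ss : s <= s + (hbar + 1) by rewrite lerDl ltW.
  by rewrite -lee_fin -integral_weightE //; apply: HC1; exists s, i, j.
have [tau [h1 h2 h3 h4 h5]] := merge_intervals mass_le t0 too rec bnd b1 T1 hbar_ge0 C0 C10.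
by exists tau, K, (C + C1); split => //; split => //; exact: addr_ge0.
Qed.

(** Up to its value at the start, the mass of an arc is at most K times that of
the reverse arc at the end of each block. *)
Lemma persistent_sym i j : e i j -> e j i.
Proof.
case: (eqVneq i j) => [->//|ij].
rewrite !persistentE //; last by rewrite eq_sym.
move=> /asboolP H; apply/asboolP => M.
have [tau [K [C [tau0 tauS tau_oo [C0 K1] [rec bnd]]]]] := blocks 0.
have tau_le : {homo tau : p q / (p <= q)%N >-> p <= q}.
  apply: homo_leq => [//|? ? ?|p]; first exact: le_trans.
  by have := tauS p; have := hbar_ge0; lra.
have [t t_ge0 Ht] := H (K * (M - arc_mass i j (tau 0%N)) + arc_mass j i (tau 0%N)).
have [P HP] := tau_oo t; exists (tau P) => //.
have tP := HP P (leqnn P).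
have h1 := recip_long rec j i (leq0n P).
have h2 := mass_le j i t_ge0 tP.
have K0 : 0 < K by exact: lt_le_trans K1.
have : K * (M - arc_mass i j (tau 0%N)) < K * (arc_mass i j (tau P) - arc_mass i j (tau 0%N)) by
    lra.
by rewrite ltr_pM2l // ltrD2r.
Qed.

Lemma sum_arc_rate i t (F : V -> R) :
  \sum_(j | j != i) a i j t * F j = \sum_j arc_rate i j t * F j.
Proof.
rewrite big_mkcond; apply: eq_bigr => j _; rewrite /arc_rate eq_sym.
by case: (i == j) => //=; rewrite mul0r.
Qed.

Lemma solution_sub ts xs phi x b c : 0 <= ts -> is_solution a h hbar ts xs phi x -> ts <= b ->
  subsolution arc_rate h b c x /\ subsolution arc_rate h b c (fun t i => - x t i).
Proof.
move=> ts0 [_ _ acx dx] tsb.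
have E i t := sum_arc_rate i t (fun j => x (t - h i j t) j - x t i).
split; split => [i|].
- exact: ac_restrict (acx c i).
- apply: aeW dx => t dx bt _ i; have := dx (le_lt_trans tsb bt) i.
  by rewrite E => ?; eexists; [eassumption|].
- by apply: acN; exact: ac_restrict (acx c i).
- apply: aeW dx => t dx bt _ i; have := dx (le_lt_trans tsb bt) i.
  rewrite E => dxi; eexists; first by apply: is_deriveN; exact: dxi.
  rewrite -sumrN; apply: ler_sum => j _; rewrite -mulrN.
  by rewrite opprB opprK addrC.
Qed.

Lemma solution_bounded ts xs phi x : 0 <= ts -> is_solution a h hbar ts xs phi x ->
  exists2 M : R, 0 <= M & forall t i, ts <= t -> `|x t i| <= M.
Proof.
move=> ts0 sol; have [_ _ acx _] := sol.
pose b := ts + hbar.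
have tsb : ts <= b by rewrite lerDl.
have b0 : 0 <= b by exact: le_trans tsb.
have /choice[M HM] : forall i, exists M, forall t, ts <= t -> t <= b -> `|x t i| <= M.
  by move=> i; have [M _ ?] := ac_bounded (acx b i); exists M.
pose N := \sum_i `|M i|.
have HN t i : ts <= t -> t <= b -> `|x t i| <= N.
  move=> h1 h2; rewrite (le_trans (HM i t h1 h2)) // (le_trans (ler_norm _)) //.
  by rewrite /N (bigD1 i) //= lerDl sumr_ge0.
exists N; first exact: sumr_ge0.
move=> t i tst; have [tb|bt] := leP t b; first exact: HN.
have rate0 k l s : b < s -> s < t -> 0 <= arc_rate k l s.
  by move=> bs _; apply: rate_ge0; exact: le_trans b0 (ltW bs).
have hb k l s : b < s -> s < t -> 0 <= h k l s <= hbar.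
  by move=> bs _; apply: h_bnd; exact: le_trans b0 (ltW bs).
have H (y : R -> V -> R) : subsolution arc_rate h b t y ->
    (forall s j, ts <= s -> s <= b -> y s j <= N) -> y t i <= N.
  move=> suby yN.
  apply: (stays_below (ltW bt) (fun k l => mass_acd t k l b0) rate0 hb suby) => //.
  - by move=> s j s1 s2; apply: yN; [move: s1; rewrite /b addrK|exact: ltW].
  - by move=> j; exact: yN.
  - exact: ltW.
have [sub1 sub2] := solution_sub t ts0 sol tsb.
rewrite ler_norml lerNl; apply/andP; split.
  apply: (H _ sub2) => s j s1 s2; rewrite (le_trans (ler_norm _)) // normrN; exact: HN.
apply: (H _ sub1) => s j s1 s2; rewrite (le_trans (ler_norm _)) //; exact: HN.
Qed.

(** The total weight, up to time t, with which agents outside the component of i0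
act on it. *)
Definition leak i0 (t : R) : R :=
  \sum_(i | connect e i0 i) \sum_(l | ~~ connect e i0 l) arc_mass i l t.

Lemma mass_bounded i l : ~~ e l i -> exists M : R, forall t, 0 <= t -> arc_mass i l t <= M.
Proof.
case: (eqVneq i l) => [->|il].
  by move=> _; exists 0 => t _; rewrite /arc_mass eqxx.
rewrite persistentE // => /asboolP H; apply: contrapT => H'; apply: H => M.
apply: contrapT => H; apply: H'; exists M => t t0; rewrite leNgt; apply/negP => lt.
by apply: H; exists t.
Qed.

Lemma crossing_mass_bounded i0 i l : connect e i0 i -> ~~ connect e i0 l ->
  exists M : R, forall t, 0 <= t -> arc_mass i l t <= M.
Proof.
move=> ci cl; apply: mass_bounded; apply: contra cl => eli.
by rewrite (connect_trans ci) // connect1 // persistent_sym.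
Qed.

Lemma sum_bounded (P : pred V) (F : V -> R -> R) :
  (forall k, P k -> exists M : R, forall t, 0 <= t -> F k t <= M) ->
  exists M : R, forall t, 0 <= t -> \sum_(k | P k) F k t <= M.
Proof.
move=> H; have /choice[M HM] : forall k, exists M : R, P k -> forall t, 0 <= t -> F k t <= M.
  move=> k; case: (boolP (P k)) => [/H[M HM]|_]; last by exists 0.
  by exists M.
by exists (\sum_(k | P k) M k) => t t0; apply: ler_sum => k Pk; exact: HM.
Qed.

Lemma leak_bounded i0 : exists M : R, forall t, 0 <= t -> leak i0 t <= M.
Proof.
apply: sum_bounded => i ci; apply: sum_bounded => l cl.
exact: crossing_mass_bounded ci cl.
Qed.

Lemma inflow_bounded i0 : exists M : R, forall t, 0 <= t ->
  \sum_(l | ~~ connect e i0 l) \sum_(i | connect e i0 i) arc_mass l i t <= M.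
Proof.
apply: sum_bounded => l cl; apply: sum_bounded => i ci.
apply: mass_bounded; apply: contra cl => eil.
by rewrite (connect_trans ci) // connect1.
Qed.

Lemma leak_le i0 s t : 0 <= s -> s <= t -> leak i0 s <= leak i0 t.
Proof.
by move=> s0 st; apply: ler_sum => i _; apply: ler_sum => l _; exact: mass_le.
Qed.

Lemma crossing_edge (S : {set V}) i j : i \in S -> j \notin S -> connect e i j ->
  exists u v, [/\ u \in S, v \notin S & e u v].
Proof.
move=> iS jS /connectP[p pp Ej]; move: jS; rewrite {}Ej.
elim: p i iS pp => [|k p IH] i iS /=; first by rewrite iS.
move=> /andP[eik pp] jS; case: (boolP (k \in S)) => kS; first exact: (IH k).
by exists i, k.
Qed.

(** Agents outside the component can move x i by at most 2 * M times their
weights, and these have a finite total mass.  Hence x - F and - x - F, for a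
function F that dominates this effect and tends to 0, are subsolutions of the
system restricted to the component, in which every cut is crossed by an
infinite mass. *)
Lemma component_limit ts xs phi x i0 : 0 <= ts -> is_solution a h hbar ts xs phi x ->
  exists l : R, forall i, connect e i0 i -> x t i @[t --> +oo] --> l.
Proof.
move=> ts0 sol; have [M M0 xM] := solution_bounded ts0 sol.
have [tau [K [C [tau0 tauS tau_oo [C0 K1] [rec bnd]]]]] := blocks (ts + hbar).
have [_ _ acx _] := sol.
pose I : finType := {i : V | connect e i0 i}.
pose aI (i j : I) := arc_rate (val i) (val j).
pose GI (i j : I) := arc_mass (val i) (val j).
pose hI (i j : I) := h (val i) (val j).
have rb : reciprocal_blocks hbar ts C K aI GI hI tau.
  split => //.
  - by move=> c i j; exact: mass_acd.
  - by move=> i j t tst; apply: rate_ge0; exact: le_trans ts0 (ltW tst).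
  - by move=> i j t tst; apply: h_bnd; exact: le_trans ts0 (ltW tst).
  - by move=> p i j; exact: bnd.
  - by move=> p i j; exact: rec.
pose Z : set R := [set leak i0 t | t in [set t | 0 <= t]].
have hZ : has_sup Z.
  split; first by exists (leak i0 0), 0 => //=.
  by have [N HN] := leak_bounded i0; exists N => _ [t t0 <-]; exact: HN.
(* F is nondecreasing, tends to 0, and its derivative dominates everything that
   agents of other components can add to the derivative of x i or - x i. *)
pose F t := 2 * M * (leak i0 t - sup Z).
have F_le0 t : 0 <= t -> F t <= 0.
  move=> t0; rewrite mulr_ge0_le0 ?mulr_ge0 // subr_le0; apply: ub_le_sup; first by case: hZ.
  by exists t.
have F_le s t : 0 <= s -> s <= t -> F s <= F t.
  by move=> s0 st; rewrite ler_wpM2l ?mulr_ge0 // lerD2r leak_le.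
have F_small r : 0 < r -> exists T, forall t, T <= t -> - r < F t.
  move=> r0; have r1 : 0 < r / (2 * M + 1) by rewrite divr_gt0 // ltr_wpDl // mulr_ge0.
  have [_ [T /= T0 <-] HT] := sup_adherent r1 hZ.
  exists T => t Tt; apply: lt_le_trans (F_le _ _ T0 Tt).
  rewrite ltrNl /F -mulrN opprB; apply: (@le_lt_trans _ _ (2 * M * (r / (2 * M + 1)))).
    by rewrite ler_wpM2l ?mulr_ge0 //; lra.
  by rewrite mulrCA gtr_pMr // ltr_pdivrMr ?mul1r ?ltrDl // ltr_wpDl // mulr_ge0.
pose dF t := 2 * M * \sum_(i | connect e i0 i) \sum_(l | ~~ connect e i0 l) arc_rate i l t.
have acF b c : 0 <= b -> acd b c F dF.
  move=> b0.
  have H1 : acd b c (fun t => leak i0 t - sup Z) (fun t => \sum_(i | connect e i0 i) \sum_(l | ~~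
      connect e i0 l) arc_rate i l t + 0).
    apply: acd_add; last exact: acd_cst.
    by apply: acd_sum => i _; apply: acd_sum => l _; exact: mass_acd.
  have [ac1 ae1] := acd_scale (2 * M) H1; split => //.
  by apply: aeW ae1 => t; rewrite addr0.
have bsub (y : R -> V -> R) : (forall c i, abs_continuous_on ts c (y^~ i)) ->
    (forall b c, ts <= b -> subsolution arc_rate h b c y) ->
    (forall t i, ts <= t -> `|y t i| <= M) ->
    bounded_sub hbar ts aI hI (fun t (i : I) => y t (val i) - F t) (M - F ts).
  move=> acy suby yM; split.
  - by move=> c i; apply: acB (proj1 (acF _ _ _)).
  - move=> b c tsb.
    have tsb' : ts <= b by apply: le_trans tsb; rewrite lerDl.
    split=> [i|].
      by apply: acB; [exact: ac_restrict (acy c (val i))|exact: (proj1 (acF _ _ (le_trans ts0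
          tsb')))].
    apply: aeW2 (proj2 (suby b c tsb')) (proj2 (acF b c (le_trans ts0 tsb'))) => t dy dFt bt tc i.
    have [d Hd dle] := dy bt tc (val i); have {}dFt := dFt bt tc.
    exists (d - dF t); first exact: is_deriveB.
    have t0 : 0 <= t by apply: le_trans ts0 (le_trans tsb' (ltW bt)).
    have split_sum (H : V -> R) : \sum_j H j = \sum_(j : I) H (val j) +
        \sum_(j | ~~ connect e i0 j) H j.
      rewrite (bigID (fun j => connect e i0 j)) /=; congr (_ + _).
      by rewrite big_sub.
    have h1 : \sum_(j | ~~ connect e i0 j) arc_rate (val i) j t *
        (y (t - h (val i) j t) j - y t (val i)) <= dF t.
      apply: (@le_trans _ _ (\sum_(j | ~~ connect e i0 j) 2 * M * arc_rate (val i) j t)).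
        apply: ler_sum => j _; rewrite mulrC ler_wpM2r ?rate_ge0 //.
        have /andP[_ hj] := h_bnd (val i) j t0.
        have tsj : ts <= t - h (val i) j t by move: tsb bt; lra.
        have := yM _ j tsj; have := yM t (val i) (le_trans tsb' (ltW bt)).
        by rewrite !ler_norml => /andP[? ?] /andP[? ?]; lra.
      rewrite -big_distrr /= /dF ler_wpM2l ?mulr_ge0 //.
      rewrite [X in _ <= X](bigD1 (val i)) ?(valP i) //= lerDl.
      by apply: sumr_ge0 => k _; apply: sumr_ge0 => l _; exact: rate_ge0.
    have h2 : \sum_(j : I) arc_rate (val i) (val j) t *
        (y (t - h (val i) (val j) t) (val j) - y t (val i)) <=
        \sum_(j : I) aI i j t * (y (t - hI i j t) (val j) - F (t - hI i j t) - (y t (val i) - F t)).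
      apply: ler_sum => j _; rewrite ler_wpM2l ?rate_ge0 // /hI.
      have /andP[hj0 hj] := h_bnd (val i) (val j) t0.
      have : F (t - h (val i) (val j) t) <= F t.
        by apply: F_le; [move: tsb bt; lra|rewrite gerBl].
      lra.
    rewrite split_sum in dle; lra.
  - move=> t i tst; have h1 := yM t (val i) tst.
    have h2 := F_le _ _ ts0 tst; have h3 := F_le0 _ (le_trans ts0 tst).
    rewrite (le_trans (ler_normB _ _)) // lerD // ler0_norm //; lra.
have bx := bsub x acx (fun b c tsb => proj1 (solution_sub c ts0 sol tsb)) xM.
have acNx c i : abs_continuous_on ts c (fun t => - x t i).
  by have [acN _] := proj2 (solution_sub c ts0 sol (lexx ts)); exact: acN.
have Nbound t i : ts <= t -> `|- x t i| <= M by rewrite normrN; exact: xM.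
have by_ := bsub (fun t i => - x t i) acNx (fun b c tsb => proj2 (solution_sub c ts0 sol tsb))
    Nbound.
have near_opp r : 0 < r -> exists T, forall t (i : I), T <= t ->
    `|x t (val i) - F t + (- x t (val i) - F t)| < r.
  move=> r0; have r20 : 0 < r / 2 by rewrite divr_gt0.
  have [T HT] := F_small _ r20; exists (Num.max T 0) => t i.
  rewrite ge_max => /andP[Tt t0]; have := HT t Tt; have := F_le0 t t0.
  have -> : x t (val i) - F t + (- x t (val i) - F t) = - (2 * F t) by ring.
  move: (F t) => f f0 rf; rewrite normrN ltr_norml; apply/andP; split; lra.
have conn (S : {set I}) : S != finset.set0 -> S != [set: I]%SET -> forall p0 N, exists q,
    N < \sum_(p0 <= p < q) (cut_flow GI tau S p + cut_flow GI tau (~: S) p).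
  move=> /set0Pn[i iS] ST p0 N.
  have [j jS] : exists j, j \notin S.
    apply: contrapT => H; move/negP: ST; apply; rewrite -finset.subTset;
        apply/fintype.subsetP => k _.
    by apply: contrapT => /negP kS; apply: H; exists k.
  have csym : connect_sym e.
    by apply: sym_connect_sym => u v; apply/idP/idP; exact: persistent_sym.
  have cij : connect e (val i) (val j).
    by apply: connect_trans (valP j); rewrite csym (valP i).
  have iS' : val i \in [set val k | k in S]%SET by apply: imset_f.
  have jS' : val j \notin [set val k | k in S]%SET.
    by apply: contra jS => /imsetP[k kS /val_inj ->].
  have [_ [v [/imsetP[u uS ->] vS euv]]] := crossing_edge iS' jS' cij.
  have cv : connect e i0 v by rewrite (connect_trans (valP u)) // connect1.
  pose v' : I := exist _ v cv.
  have v'S : v' \notin S by apply: contra vS => v'S; apply/imsetP; exists v'.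
  have uv : v != val u by apply: contraNneq vS => ->; apply: imset_f.
  move: euv; rewrite persistentE // => /asboolP H.
  have [t t0 Ht] := H (N + arc_mass v (val u) (tau p0)).
  have [P HP] := tau_oo t.
  exists (maxn P p0).
  have hle : arc_mass v (val u) t <= arc_mass v (val u) (tau (maxn P p0)).
    by apply: mass_le => //; apply: HP; rewrite leq_maxl.
  apply: (@lt_le_trans _ _ (\sum_(p0 <= p < maxn P p0) (arc_mass v (val u) (tau p.+1) - arc_mass
      v (val u) (tau p)))).
    by rewrite telescope_sumr ?leq_maxr //; lra.
  apply: ler_sum => p _.
  have c0 A : 0 <= cut_flow GI tau A p := cut_flow_ge0 rb A p.
  apply: (@le_trans _ _ (cut_flow GI tau S p)); last by rewrite lerDl.
  have w0 k l : 0 <= weight GI tau p k l := weight_ge0 rb p k l.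
  rewrite /cut_flow (bigD1 v') //= (bigD1 u) //= -addrA lerDl addr_ge0 //.
    exact: sumr_ge0.
  by apply: sumr_ge0 => k _; exact: sumr_ge0.
have [l Hl] := core_consensus rb conn bx by_ near_opp tau_oo.
exists l => i ci; have := Hl (exist _ i ci) => /= cvx.
have cvF : F t @[t --> +oo] --> (0 : R).
  apply/cvgrPdist_lt => r r0; have [T HT] := F_small r r0.
  exists (Num.max T 0); split; first exact: num_real.
  move=> t; rewrite gt_max => /andP[/ltW Tt /ltW t0].
  by rewrite sub0r normrN ler0_norm ?F_le0 // ltrNl HT.
have -> : (fun t => x t i) = (fun t => (x t i - F t) + F t).
  by apply/funext => t; rewrite subrK.
by rewrite -[l]addr0; apply: cvgD.
Qed.

End Solutions.

(** * Existence of solutions by monotone iteration *)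

Section Existence.
Context (R : realType) (V : finType) (hbar : R) (a h : V -> V -> R -> R).
Context (a_ge0 : forall (i j : V) (t : R), 0 <= t -> 0 <= a i j t)
  (a_loc : forall i j : V, locally_summable (a i j))
  (h_meas : forall i j : V, lebesgue_measurable_fun `[0, +oo[ (h i j)).
Context (ts : R) (ts_ge0 : 0 <= ts) (phi : V -> R) (phi01 : forall k, 0 <= phi k <= 1).
Implicit Types (x y : R -> V -> R).
Local Notation leb := (@completed_lebesgue_measure R).
Local Notation rate := (arc_rate a).
Local Notation mass := (arc_mass a).

Let clamp t : R := Num.max ts t.

Let clamp_ge t : ts <= clamp t. Proof. by rewrite le_max lexx. Qed.
Let clamp_ge0 t : 0 <= clamp t. Proof. exact: le_trans (clamp_ge t). Qed.
Let clamp_le s t : s <= t -> clamp s <= clamp t.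
Proof. by move=> st; rewrite ge_max !le_max lexx st orbT. Qed.
Let clamp_id t : ts <= t -> clamp t = t. Proof. by move=> /max_idPr. Qed.

Let growth k t : R := \sum_l (mass k l (clamp t) - mass k l ts).

Let growth_le k s t : s <= t -> growth k s <= growth k t.
Proof.
move=> st; apply: ler_sum => l _; rewrite lerD2r; apply: mass_le => //.
exact: clamp_le.
Qed.

Let growth_acd k T : acd ts T (growth k) (fun t => \sum_l rate k l t).
Proof.
apply: (@acd_near _ _ _ (fun t => \sum_l (mass k l t - mass k l ts))).
  by move=> t tst _; rewrite /growth clamp_id.
apply: acd_sum => l _.
have [ac1 ae1] := acd_add (mass_acd a_ge0 a_loc T k l ts_ge0) (acd_cst ts T (- mass k l ts)).
by split => //; apply: aeW ae1 => t; rewrite addr0.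
Qed.

(** The derivative of exp (growth) * x along a solution x. *)
Let source x k s : R := expR (growth k s) * \sum_l rate k l s * x (s - h k l s) l.

(** Variation of constants, constant before ts.  The integrating factor removes
the negative term of the equation, so that the map is monotone in x. *)
Definition picard x t k : R :=
  expR (- growth k t) * (phi k + (primitive (source x k) (clamp t) - primitive (source x k) ts)).

Let good x := (forall l, borel (x^~ l)) /\ forall t l, 0 <= x t l <= 1.

Let source_ge0 x k : good x -> forall s, 0 <= s -> 0 <= source x k s.
Proof.
move=> [_ x01] s s0; rewrite mulr_ge0 ?expR_ge0 // sumr_ge0 // => l _.
by rewrite mulr_ge0 ?(rate_ge0 a_ge0) //; have /andP[] := x01 (s - h k l s) l.
Qed.

Let source_le x k s : good x -> 0 <= s -> source x k s <= expR (growth k s) * \sum_l rate k l s.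
Proof.
move=> [_ x01] s0; rewrite ler_wpM2l ?expR_ge0 // ler_sum // => l _.
by rewrite ler_piMr ?(rate_ge0 a_ge0) //; have /andP[] := x01 (s - h k l s) l.
Qed.

Let mI T : @measurable _ (lebesgueType R) `[0, T]%classic.
Proof. by apply: sub_caratheodory; exact: measurable_itv. Qed.

Let rate_integrable k l T :
  leb.-integrable `[0, T] (fun t : lebesgueType R => (rate k l t)%:E).
Proof.
rewrite /arc_rate; case: (k == l); last exact: a_loc.
by exact: (@integrable0 _ _ _ leb).
Qed.

Let growth_borel k : borel (growth k).
Proof. by apply: nondecreasing_measurable => // s t; exact: growth_le. Qed.

Let source_measurable x k T : good x ->
  lebesgue_measurable_fun `[0, T] (source x k).
Proof.
move=> [bx _]; apply: measurable_funM.
  apply: measurable_funTS; apply: borel_lebesgue.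
  by apply: measurableT_comp; [exact: measurable_expR|exact: growth_borel].
apply: measurable_sum => l; apply: measurable_funM.
  by apply/measurable_EFinP; have /integrableP[] := rate_integrable k l T.
apply: (measurableT_comp (bx l)).
apply: measurable_funB; first by apply: measurable_funTS; exact: id_measurable.
apply: measurable_funS (h_meas k l); first exact: sub_caratheodory.
by move=> s /=; rewrite !in_itv /= andbT => /andP[].
Qed.

Let dominator_integrable k T :
  leb.-integrable `[0, T] (fun t : lebesgueType R => (expR (growth k T) * \sum_l rate k l t)%:E).
Proof.
have -> : (fun t : lebesgueType R => (expR (growth k T) * \sum_l rate k l t)%:E) =
    (fun t : lebesgueType R => (expR (growth k T))%:E * \sum_l (rate k l t)%:E)%E.
  by apply/funext => t; rewrite sumEFin -EFinM.
apply: integrableZl; first exact: mI.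
by apply: integrable_sum => // l _; exact: rate_integrable.
Qed.

Let source_dominated x k T s : good x -> 0 <= s -> s <= T ->
  `|source x k s| <= expR (growth k T) * \sum_l rate k l s.
Proof.
move=> gx s0 sT; rewrite (ger0_norm (source_ge0 k gx s0)).
apply: le_trans (source_le k gx s0) _; apply: ler_wpM2r.
  by apply: sumr_ge0 => l _; exact: rate_ge0.
by rewrite ler_expR; exact: growth_le.
Qed.

Let source_loc x k : good x -> locally_summable (source x k).
Proof.
move=> gx T; apply: le_integrable (dominator_integrable k T); first exact: mI.
  by apply/measurable_EFinP; exact: source_measurable.
move=> s /=; rewrite in_itv /= => /andP[s0 sT]; rewrite lee_fin.
apply: le_trans (source_dominated k gx s0 sT) (ler_norm _).
Qed.

Let gain x k t : R := primitive (source x k) (clamp t) - primitive (source x k) ts.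

Let gain_le x k s t : good x -> s <= t -> gain x k s <= gain x k t.
Proof.
move=> gx st; rewrite lerD2r; apply: primitive_le => //.
- exact: source_ge0.
- exact: source_loc.
- exact: clamp_le.
Qed.

Let gain_ge0 x k t : good x -> 0 <= gain x k t.
Proof.
move=> gx; rewrite subr_ge0; apply: primitive_le => //; [exact: source_ge0|exact: source_loc].
Qed.

Let gain_acd x k T : good x -> acd ts T (gain x k) (source x k).
Proof.
move=> gx; apply: (@acd_near _ _ _ (fun t => primitive (source x k) t - primitive (source x k) ts)).
  by move=> t tst _; rewrite /gain clamp_id.
have H := primitive_acd (source_ge0 k gx) (source_loc k gx T).
have [ac1 ae1] := acd_add (acd_restrict ts_ge0 (lexx T) H) (acd_cst ts T (- primitive (source x
    k) ts)).
by split => //; apply: aeW ae1 => t; rewrite addr0.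
Qed.

Let growth_ts k t : t <= ts -> growth k t = 0.
Proof.
move=> tts; rewrite /growth /clamp (max_idPl tts) big1 // => l _; exact: subrr.
Qed.

Let gain_ts x k t : t <= ts -> gain x k t = 0.
Proof. by move=> tts; rewrite /gain /clamp (max_idPl tts) subrr. Qed.

Lemma picard_start x t k : t <= ts -> picard x t k = phi k.
Proof.
by move=> tts; rewrite /picard growth_ts // oppr0 expR0 mul1r -/(gain x k t) gain_ts // addr0.
Qed.

(** The derivative of exp (growth) dominates source x k, because x <= 1. *)
Let gain_bound x k t : good x -> gain x k t <= expR (growth k t) - 1.
Proof.
move=> gx; have [tts|/ltW tst] := leP t ts.
  by rewrite gain_ts // growth_ts // expR0 subrr.
have H := acd_add (acd_exp (growth_acd k t)) (acd_opp (gain_acd k t gx)).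
have := acd_le H _ (lexx ts) tst (lexx t).
rewrite growth_ts // gain_ts // expR0 subr0 => H'.
rewrite lerBrDl -lerBrDr; apply: H' => s tss _.
by rewrite subr_ge0 source_le // (le_trans ts_ge0) // ltW.
Qed.

Let picard_good x : good x -> good (picard x).
Proof.
move=> gx; split=> [l|t l].
  apply: measurable_funM.
    apply: measurableT_comp; first exact: measurable_expR.
    by apply: measurableT_comp => //; exact: growth_borel.
  apply: nondecreasing_measurable => // s t st.
  by rewrite lerD2l; exact: gain_le.
have /andP[phi0 phi1] := phi01 l; rewrite /picard -/(gain x l t).
have h0 := gain_ge0 l t gx; have h1 := gain_bound l t gx.
apply/andP; split; first by rewrite mulr_ge0 ?expR_ge0 // addr_ge0.
by rewrite expRN mulrC ler_pdivrMr ?expR_gt0 // mul1r; lra.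
Qed.

Let source_mono x y k s : good x -> good y -> (forall t l, x t l <= y t l) -> 0 <= s ->
  source x k s <= source y k s.
Proof.
move=> gx gy xy s0; rewrite ler_wpM2l ?expR_ge0 // ler_sum // => l _.
by rewrite ler_wpM2l // rate_ge0.
Qed.

Let integral_gain x k t : good x -> 
  (\int[leb]_(s in `[ts, clamp t]) (source x k s)%:E)%E = (gain x k t)%:E.
Proof.
by move=> gx; apply: integral_primitive; [exact: source_ge0|exact: source_loc| |].
Qed.

Let mIts t : @measurable _ (lebesgueType R) `[ts, t]%classic.
Proof. by apply: sub_caratheodory; exact: measurable_itv. Qed.

Let sub_ts t : `[ts, t]%classic `<=` `[0, t]%classic.
Proof. by move=> s /=; rewrite !in_itv /= => /andP[h1 ->]; rewrite (le_trans ts_ge0). Qed.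

Let source_mts x k t : good x ->
  measurable_fun (`[ts, t]%classic : set (lebesgueType R)) (fun s :
      lebesgueType R => (source x k s)%:E).
Proof.
move=> gx; apply/measurable_EFinP.
exact: (measurable_funS (mI t) (sub_ts (t := t)) (@source_measurable x k t gx)).
Qed.

Let picard_mono x y : good x -> good y -> (forall t l, x t l <= y t l) ->
  forall t k, picard x t k <= picard y t k.
Proof.
move=> gx gy xy t k; apply: ler_wpM2l; first exact: expR_ge0.
rewrite lerD2l; suff : gain x k t <= gain y k t by [].
rewrite -lee_fin -(integral_gain k t gx) -(integral_gain k t gy).
have pos s : `[ts, clamp t]%classic s -> 0 <= s.
  by rewrite /= in_itv /= => /andP[s1 _]; exact: le_trans s1.
apply: ge0_le_integral; first exact: mIts.
- by move=> s /pos s0; rewrite lee_fin; exact: source_ge0.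
- exact: source_mts.
- exact: source_mts.
- by move=> s /pos s0; rewrite lee_fin; exact: source_mono.
Qed.

Let iterate m : R -> V -> R := iter m picard (fun _ _ => 0).

Let iterate_good m : good (iterate m).
Proof.
elim: m => [|m IH]; last exact: picard_good.
by split=> [l|t l]; [exact: measurable_cst|rewrite lexx ler01].
Qed.

Let iterate_leS m t k : iterate m t k <= iterate m.+1 t k.
Proof.
elim: m t k => [|m IH] t k; first by have [_ /(_ t k) /andP[]] := iterate_good 1.
exact: (picard_mono (iterate_good m) (iterate_good m.+1) IH).
Qed.

Let iterate_le t k : {homo (fun m => iterate m t k) : m p / (m <= p)%N >-> m <= p}.
Proof. by apply: homo_leq => [//|? ? ?|m]; [exact: le_trans|exact: iterate_leS]. Qed.

Let iterate_cvg t k : cvgn (fun m => iterate m t k).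
Proof.
apply: nondecreasing_is_cvgn; first exact: iterate_le.
by exists 1 => _ [m _ <-]; have [_ /(_ t k) /andP[]] := iterate_good m.
Qed.

Definition picard_limit t k : R := limn (fun m => iterate m t k).

Let limit_good : good picard_limit.
Proof.
split=> [l|t l].
  apply: (@measurable_fun_cvg _ _ _ _ (fun m t => iterate m t l)); first by move=> m;
      exact: (iterate_good m).1.
  by move=> t _; exact: iterate_cvg.
apply/andP; split.
  by apply: limr_ge (@iterate_cvg t l) _; near=> m; have [_ /(_ t l) /andP[]] := iterate_good m.
by apply: limr_le (@iterate_cvg t l) _; near=> m; have [_ /(_ t l) /andP[]] := iterate_good m.
Unshelve. all: by end_near. Qed.

Let gain_cvg k t : gain (iterate m) k t @[m --> \oo] --> gain picard_limit k t.
Proof.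
have cvs : {ae leb, forall s, `[ts, clamp t]%classic s ->
    (source (iterate m) k s)%:E @[m --> \oo] --> (source picard_limit k s)%:E}.
  apply/ae_completed/nearW => s _; apply: cvg_EFin; first exact: nearW.
  apply: cvgMr; apply: cvg_big => [|l _]; first exact: add_continuous.
  apply: cvgMr; exact: iterate_cvg.
have dom : {ae leb, forall s m, `[ts, clamp t]%classic s ->
    (`|(source (iterate m) k s)%:E| <= (expR (growth k (clamp t)) * \sum_l rate k l s)%:E)%E}.
  apply/ae_completed/nearW => s m /=; rewrite in_itv /= => /andP[s1 s2].
  by rewrite lee_fin; apply: source_dominated => //; exact: le_trans ts_ge0 s1.
have domI := integrableS (mI (clamp t)) (mIts (clamp t)) (sub_ts (t := clamp t))
    (dominator_integrable k (clamp t)).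
have [_ _ H] := @dominated_convergence _ _ _ leb `[ts, clamp t]%classic (mIts _)
  (fun m s => (source (iterate m) k s)%:E) (fun s => (source picard_limit k s)%:E)
  (fun s => (expR (growth k (clamp t)) * \sum_l rate k l s)%:E)
  (fun m => @source_mts _ k (clamp t) (iterate_good m)) (@source_mts _ k (clamp t) limit_good)
  cvs domI dom.
move: H; rewrite (integral_gain _ _ limit_good).
have -> : (fun m => (\int[leb]_(s in `[ts, clamp t]) (source (iterate m) k s)%:E)%E) =
    (fun m => (gain (iterate m) k t)%:E).
  by apply/funext => m; rewrite (integral_gain _ _ (iterate_good m)).
by move=> /fine_cvgP[].
Qed.

(** The iterates increase and stay between 0 and 1; dominated convergence passes
to the limit in the integral. *)
Lemma picard_fixpoint t k : picard_limit t k = picard picard_limit t k.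
Proof.
have H : iterate m.+1 t k @[m --> \oo] --> picard picard_limit t k.
  by apply: cvgMr; apply: cvgD; [exact: cvg_cst|exact: gain_cvg].
have H2 : iterate m.+1 t k @[m --> \oo] --> picard_limit t k.
  have := @iterate_cvg t k; rewrite -(cvg_shiftS (fun m => iterate m t k)); exact.
exact: (cvg_unique _ H2 H).
Qed.

Lemma picard_acd k T : acd ts T (picard_limit^~ k)
  (fun t => \sum_l rate k l t * (picard_limit (t - h k l t) l - picard_limit t k)).
Proof.
have ac1 := acd_exp (acd_opp (growth_acd k T)).
have ac2 := acd_add (acd_cst ts T (phi k)) (gain_acd k T limit_good).
have [ac3 ae3] := acd_mul ac1 ac2.
have Ex t : picard_limit t k = expR (- growth k t) * (phi k + gain picard_limit k t).
  exact: picard_fixpoint.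
have -> : picard_limit^~ k = (fun t => expR (- growth k t) * (phi k + gain picard_limit k t)).
  by apply/funext => t; exact: Ex.
split => //; apply: aeW ae3 => t H tst tT; have := H tst tT; congr is_derive.
have E1 : phi k + gain picard_limit k t = expR (growth k t) * picard_limit t k.
  by rewrite Ex mulrA expRxMexpNx_1 mul1r.
rewrite E1 /source add0r mulrA [expR (- _) * expR _]mulrC expRxMexpNx_1 mul1r.
rewrite [X in _ + X](_ : _ = - (picard_limit t k * \sum_l rate k l t) * (expR (growth k t) *
    expR (- growth k t))); last by ring.
rewrite expRxMexpNx_1 mulr1 big_distrr -sumrB /=; apply: eq_bigr => l _; ring.
Qed.

Lemma picard_solution : is_solution a h hbar ts phi (fun _ => phi) picard_limit.
Proof.
split.
- by move=> i; rewrite picard_fixpoint picard_start.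
- by move=> s _ s0 i; rewrite picard_fixpoint picard_start // gerDl ltW.
- by move=> T i; exact: (picard_acd i T).1.
- have H : \forall t \ae leb, forall n i, ts < t -> t < n%:R ->
      is_derive t (1 : R) (picard_limit^~ i) (\sum_l rate i l t *
          (picard_limit (t - h i l t) l - picard_limit t i)).
    apply/ae_completed/ae_foralln => n; apply/ae_completed; apply: ae_forall => i.
    exact: (picard_acd i n%:R).2.
  apply: aeW H => t H tst i; rewrite (sum_arc_rate a i t (fun j => picard_limit (t - h i j t) j -
      picard_limit t i)).
  by apply: (H (Num.truncn t).+1) => //; exact: truncnS_gt.
Qed.

Lemma constant_Linfty : Linfty_history hbar (fun _ => phi).
Proof.
move=> i; rewrite inE; apply/andP; split; rewrite inE /=.
  apply: (iffLR (measurable_restrictT _ _)); last exact: measurable_cst.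
  by apply: sub_caratheodory; exact: measurable_itv.
rewrite /finite_norm unlock /=; case: ifP => // _.
apply: (@le_lt_trans _ _ (`|phi i|)%:E); last exact: ltry.
apply/ess_supP; apply/ae_completed/nearW => t /=; rewrite lee_fin patchE.
by case: ifP => _; rewrite ?normr0.
Qed.

End Existence.

(** * Separation of components *)

Section Separation.
Context (R : realType) (V : finType) (hbar : R) (a h : V -> V -> R -> R).
Context (hbar_ge0 : 0 <= hbar)
  (a_ge0 : forall (i j : V) (t : R), 0 <= t -> 0 <= a i j t)
  (a_loc : forall i j : V, locally_summable (a i j))
  (h_meas : forall i j : V, lebesgue_measurable_fun `[0, +oo[ (h i j))
  (h_bnd : forall (i j : V) (t : R), 0 <= t -> 0 <= h i j t <= hbar)
  (a_nits : NITS a) (a_unif : uniformly_summable a).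
Local Notation e := (persistent_graph a).
Local Notation mass := (arc_mass a).

Lemma small_tail (f : R -> R) M r : 0 < r -> (forall s t, 0 <= s -> s <= t -> f s <= f t) ->
  (forall t, 0 <= t -> f t <= M) -> exists2 T, 0 <= T & forall t, T <= t -> f t - f T <= r.
Proof.
move=> r0 f_le fM; pose Z : set R := [set f t | t in [set t | 0 <= t]].
have hZ : has_sup Z.
  by split; [exists (f 0), 0 => //=|exists M => _ [t t0 <-]; exact: fM].
have [_ [T /= T0 <-] HT] := sup_adherent r0 hZ.
exists T => // t Tt; have : f t <= sup Z.
  by apply: ub_le_sup; [case: hZ|exists t => //=; exact: le_trans Tt].
lra.
Qed.

(** Start from the indicator of the component of i0 at a time after which the
masses entering and leaving the component increase by at most 1/4. *)
Lemma separated_solution i0 : exists ts xs phi x,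
  [/\ 0 <= ts, Linfty_history hbar phi, is_solution a h hbar ts xs phi x,
     forall t k, ts <= t -> connect e i0 k -> 3 / 4 <= x t k
   & forall t k, ts <= t -> ~~ connect e i0 k -> x t k <= 1 / 4].
Proof.
pose S : {set V} := [set k | connect e i0 k]%SET.
have [M1 HM1] := leak_bounded hbar_ge0 a_ge0 a_loc a_nits a_unif i0.
have [M2 HM2] := inflow_bounded a_ge0 a_loc i0.
pose inflow t : R := \sum_(l | ~~ connect e i0 l) \sum_(i | connect e i0 i) mass l i t.
have inflow_le s t : 0 <= s -> s <= t -> inflow s <= inflow t.
  by move=> s0 st; apply: ler_sum => l _; apply: ler_sum => k _; exact: mass_le.
have leak_le' s t : 0 <= s -> s <= t -> leak a i0 s <= leak a i0 t by exact: leak_le.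
have r0 : 0 < 1 / 4 :> R by rewrite divr_gt0.
have [ts ts0 Hts] : exists2 T, 0 <= T &
    forall t, T <= t -> leak a i0 t - leak a i0 T <= 1 / 4 /\ inflow t - inflow T <= 1 / 4.
  have [T1 T10 H1] := small_tail r0 leak_le' HM1.
  have [T2 T20 H2] := small_tail r0 inflow_le HM2.
  exists (Num.max T1 T2); first by rewrite le_max T10.
  move=> t; rewrite ge_max => /andP[t1 t2]; split.
    have := H1 t t1; have : leak a i0 T1 <= leak a i0 (Num.max T1 T2).
      by apply: leak_le' => //; rewrite le_max lexx.
    lra.
  have := H2 t t2; have : inflow T2 <= inflow (Num.max T1 T2).
    by apply: inflow_le => //; rewrite le_max lexx orbT.
  lra.
pose phi k : R := (k \in S)%:R.
have phi01 k : 0 <= phi k <= 1 by rewrite /phi; case: (k \in S); rewrite ?lexx ler01.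
have sol := picard_solution hbar a_ge0 a_loc h_meas ts0 phi01.
set x := picard_limit a h ts phi in sol.
have [x_ts x_hist _ _] := sol.
have hist s k : ts - hbar <= s -> s <= ts -> x s k = phi k.
  rewrite le_eqVlt => /predU1P[<-|s1] s2.
    move: s2; rewrite le_eqVlt => /predU1P[->|s2]; first exact: x_ts.
    by have := x_hist (- hbar) (lexx _); rewrite (_ : ts - hbar = ts + - hbar) //; apply; lra.
  move: s2; rewrite le_eqVlt => /predU1P[->|s2]; first exact: x_ts.
  have E : ts + (s - ts) = s by ring.
  by have := x_hist (s - ts) _ _ k; rewrite E; apply; lra.
(* an agent outside A only feels A through the flow entering its complement *)
have escape (y : R -> V -> R) (A : {set V}) base t k : ts <= t -> k \notin A ->
    subsolution (arc_rate a) h ts t y ->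
    (forall s j, ts - hbar <= s -> s <= ts -> y s j <= base + (j \in A)%:R) ->
    y t k <= base + \sum_(i | i \notin A) \sum_(j in A) (mass i j t - mass i j ts).
  move=> tst kA suby yA.
  have acG i j := mass_acd a_ge0 a_loc t i j ts0.
  have rate0 i j s : ts < s -> s < t -> 0 <= arc_rate a i j s.
    by move=> s1 _; apply: rate_ge0 => //; exact: le_trans ts0 (ltW s1).
  have hb i j s : ts < s -> s < t -> 0 <= h i j s <= hbar.
    by move=> s1 _; apply: h_bnd; exact: le_trans ts0 (ltW s1).
  have B0 : 0 <= into_flow ts mass A A t.
    by apply: sumr_ge0 => i _; apply: sumr_ge0 => j _; apply: (incr_ge0 acG rate0).
  have one j : base + (j \in A)%:R = if j \in A then base + 1 else base.
    by case: ifP => _; rewrite ?addr0.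
  have le1 : base <= base + 1 by rewrite lerDl.
  apply: le_trans (rises_slowly tst acG rate0 hb suby le1 _ _ kA tst (lexx t)) _.
  - by move=> s j s1 s2; rewrite -one; apply: yA => //; exact: ltW.
  - by move=> j; rewrite -one; apply: yA => //; rewrite gerBl.
  - rewrite [base + 1]addrC addrK mul1r lerD2l.
    by have [] := one_sub_exp_bounds B0 (lexx _).
have telescope (P Q : pred V) t :
    \sum_(i | P i) \sum_(j | Q j) (mass i j t - mass i j ts) =
    \sum_(i | P i) \sum_(j | Q j) mass i j t - \sum_(i | P i) \sum_(j | Q j) mass i j ts.
  by rewrite -sumrB; apply: eq_bigr => i _; rewrite sumrB.
exists ts, phi, (fun _ => phi), x; split => //; first exact: constant_Linfty.
  all: move=> t k tst ck; have [subx subNx] := solution_sub t ts0 sol (lexx ts).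
- have kS : k \notin ~: S by rewrite !inE negbK.
  have Hh s j : ts - hbar <= s -> s <= ts -> - x s j <= - 1 + (j \in ~: S)%:R.
    by move=> s1 s2; rewrite hist // /phi finset.in_setC; case: (j \in S); rewrite /= ?mulr1n; lra.
  have := escape (fun t k => - x t k) (~: S) (- 1) t k tst kS subNx Hh.
  rewrite telescope.
  have E s : \sum_(i | i \notin ~: S) \sum_(j in ~: S) mass i j s = leak a i0 s.
    apply: eq_big => [i|i _]; first by rewrite !inE negbK.
    by apply: eq_bigl => j; rewrite !inE.
  by rewrite !E; have [+ _] := Hts t tst; lra.
- have kS : k \notin S by rewrite inE.
  have Hh s j : ts - hbar <= s -> s <= ts -> x s j <= 0 + (j \in S)%:R.
    by move=> s1 s2; rewrite hist // add0r.
  have := escape x S 0 t k tst kS subx Hh.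
  rewrite telescope.
  have E s : \sum_(i | i \notin S) \sum_(j in S) mass i j s = inflow s.
    apply: eq_big => [i|i _]; first by rewrite inE.
    by apply: eq_bigl => j; rewrite !inE.
  by rewrite !E; have [_ +] := Hts t tst; lra.
Qed.

Lemma pair_consensus i j :
  establishes_consensus a h hbar [set i; j]%SET <-> connect e i j.
Proof.
split=> [cons|cij ts xs phi x ts0 _ sol]; last first.
  have [l Hl] := component_limit hbar_ge0 a_ge0 a_loc h_bnd a_nits a_unif i ts0 sol.
  exists (fun=> l); split=> // k; rewrite !inE => /orP[] /eqP ->; apply: Hl => //.
apply: contrapT => /negP ncij.
have [ts [xs [phi [x [ts0 Lphi sol hi lo]]]]] := separated_solution i.
have [xbar [lim same]] := cons ts xs phi x ts0 Lphi sol.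
have iS : i \in [set i; j]%SET by rewrite !inE eqxx.
have jS : j \in [set i; j]%SET by rewrite !inE eqxx orbT.
have near_ts : \forall t \near +oo, ts <= t by apply: nbhs_pinfty_ge; exact: num_real.
have h1 : 3 / 4 <= xbar i.
  rewrite -(cvg_lim (@Rhausdorff R) (lim i iS)); apply: limr_ge; first by apply: cvgP (lim i iS).
  by apply: filterS near_ts => t tst; exact: hi.
have h2 : xbar j <= 1 / 4.
  rewrite -(cvg_lim (@Rhausdorff R) (lim j jS)); apply: limr_le; first by apply: cvgP (lim j jS).
  by apply: filterS near_ts => t tst; exact: lo.
by have := same i j iS jS; lra.
Qed.

End Separation.

Unset Implicit Arguments.

Theorem theorem3 (R : realType) (V : finType) (hbar : R)
    (a h : V -> V -> R -> R)
    (hbar_ge0 : 0 <= hbar)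
    (a_ge0 : forall (i j : V) (t : R), 0 <= t -> 0 <= a i j t)
    (a_loc : forall i j : V, locally_summable (a i j))
    (h_meas : forall i j : V, lebesgue_measurable_fun `[0, +oo[ (h i j))
    (h_bnd : forall (i j : V) (t : R), 0 <= t -> 0 <= h i j t <= hbar)
    (a_nits : NITS a)
    (a_unif : uniformly_summable a) :
  all_solutions_converge a h hbar /\
  (forall i j : V,
     establishes_consensus a h hbar [set i; j]%SET <->
     connect (persistent_graph a) i j) /\
  (establishes_consensus a h hbar [set: V]%SET <->
   connected_graph (persistent_graph a)).
Proof.
have lim := component_limit hbar_ge0 a_ge0 a_loc h_bnd a_nits a_unif.
have pair := pair_consensus hbar_ge0 a_ge0 a_loc h_meas h_bnd a_nits a_unif.
split; [|split=> //; split].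
- move=> ts xs phi x ts0 _ sol i.
  by have [l Hl] := lim ts xs phi x i ts0 sol; apply: cvgP (Hl i (connect0 _ _)).
- move=> cons i j; apply/pair => ts xs phi x ts0 Lphi sol.
  have [xbar [xl xe]] := cons ts xs phi x ts0 Lphi sol.
  exists xbar; split=> [k _|k k' _ _]; first by apply: xl; rewrite inE.
  by apply: xe; rewrite inE.
- move=> conn ts xs phi x ts0 _ sol.
  have /choice[xbar xl] : forall i, exists l : R, forall j, connect (persistent_graph a) i j ->
      x t j @[t --> +oo] --> l.
    by move=> i; exact: lim ts0 sol.
  exists xbar; split=> [i _|i j _ _]; first by apply: xl.
  by apply: (cvg_unique (@Rhausdorff R)) (xl i i (connect0 _ _)) (xl j i (conn j i)).
Qed.
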